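(* Let $\xi_s$ be the horizontal shifting function of the equilibrium $\rho_0$, and let $\xi(t,\theta)$ be the free-surface perturbation in moving polar coordinates, with associated functions $a_0,a_1,a_2$ of $t$ and bilinear form $(\cdot,\cdot)_{1,\Sigma}$ as in the context. There are a sufficiently small $\delta>0$ and positive constants $c,\delta_1,\delta_2,\delta_3$, independent of $t$ and of $\xi$, such that if $\mathcal{E}(u,p,\xi)(t)\le\delta$ for $t\in(0,T)$ (some $T>0$), then for all $t\in(0,T)$ and $i\in\{0,1,2\}$ $$(\partial_t^i\xi-a_i(t)\rho_0,\ \xi_s)_{1,\Sigma}=0,$$ $$(\partial_t^i\xi-a_i(t)\rho_0,\ \partial_t^i\xi-a_i(t)\rho_0)_{1,\Sigma}\ge c\,\|\partial_t^i\xi-a_i(t)\rho_0\|_{H^1}^2 .$$ Moreover, $$(\xi-a_0\rho_0,\xi-a_0\rho_0)_{1,\Sigma}\ge c\|\xi\|_{H^1}^2-\|\xi\|_{L^2}^4,$$ $$(\partial_t\xi-a_1\rho_0,\partial_t\xi-a_1\rho_0)_{1,\Sigma}\ge\delta_1\|\partial_t\xi\|_{H^1}^2-\delta_2\|\xi\|_{L^2}^4,$$ $$(\partial_t^2\xi-a_2\rho_0,\partial_t^2\xi-a_2\rho_0)_{1,\Sigma}\ge\delta_1\|\partial_t^2\xi\|_{H^1}^2-\delta_2\|\partial_t\xi\|_{L^2}^4-\delta_3\|\partial_t^2\xi\|_{L^2}^2\|\xi\|_{L^2}^2 .$$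
   Context: Let $g,\sigma,V>0$, $|[\![\gamma]\!]|<\sigma$. $\rho_0:[0,\pi]\to(0,\infty)$ is the smooth equilibrium profile: a minimizer of $\frac g3\int_0^\pi\rho^3\sin\theta\,d\theta+\sigma\int_0^\pi\sqrt{\rho^2+\rho'^2}\,d\theta-[\![\gamma]\!](\rho(0)+\rho(\pi))$ subject to $\int_0^\pi\rho^2\,d\theta=V$, with $\rho_0(\pi-\theta)=\rho_0(\theta)$; $\xi_s=\cos\theta+\frac{\rho_0'}{\rho_0}\sin\theta$. The perturbation is $\xi=\rho-\rho_0$, where $\rho(t,\theta)$ is the droplet's free surface in polar coordinates centred at the moving pole $(\mathfrak n(t),0)$. It satisfies, for all $t$, conservation of mass $\int_0^\pi(\rho_0+\xi)^2\,d\theta=\int_0^\pi\rho_0^2\,d\theta=V$ and (by the choice of $\mathfrak n$) $\int_0^\pi\xi\,\xi_s\,d\theta=0$. Bilinear form (second variation of the energy at $\rho_0$): $$(\rho_1,\rho_2)_{1,\Sigma}=g\int_0^\pi\rho_0\rho_1\rho_2\sin\theta\,d\theta+\sigma\int_0^\pi\frac{\rho_0^2\rho_1'\rho_2'-\rho_0\rho_0'(\rho_1'\rho_2+\rho_1\rho_2')+(\rho_0''\rho_0-\rho_0'^2-\rho_0^2)\rho_1\rho_2}{(\rho_0^2+\rho_0'^2)^{3/2}}\,d\theta .$$ $$a_0=\frac{-\frac12\int_0^\pi\xi^2\,d\theta}{\int_0^\pi\rho_0^2\,d\theta},\qquad a_1=\frac{-\int_0^\pi\xi\,\partial_t\xi\,d\theta}{\int_0^\pi\rho_0^2\,d\theta},\qquad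 a_2=\frac{-\int_0^\pi(\partial_t\xi)^2\,d\theta-\int_0^\pi\xi\,\partial_t^2\xi\,d\theta}{\int_0^\pi\rho_0^2\,d\theta},$$ so that $\int_0^\pi\rho_0(\partial_t^i\xi-a_i\rho_0)\,d\theta=0$ for $i=0,1,2$. Energy: with $u$ (velocity) and $p$ (pressure perturbation) on the equilibrium domain $\Omega=\{0<\theta<\pi,0<r<\rho_0(\theta)\}$, $\omega_{eq}\in(0,\pi)$ with $\cos\omega_{eq}=[\![\gamma]\!]/\sigma$, $0<\varepsilon_-<\varepsilon_+\le\min\{1,-1+\pi/\omega_{eq}\}$, $q_+=\frac2{2-\varepsilon_+}$, $0<\alpha<\varepsilon_-$, $\alpha<\min\{\frac{1-\varepsilon_+}2,\frac{\varepsilon_+-\varepsilon_-}2\}$, $\varepsilon_+\le\frac{\varepsilon_-+1}2$, $$\begin{aligned}\mathcal{E}(u,p,\xi)=&\sum_{k=0}^2\bigl(\|\partial_t^ku\|_{L^2}^2+\|\partial_t^k\xi\|_{H^1}^2\bigr)+\|u\|_{W^{2,q_+}}^2+\|\partial_tu\|_{H^{1+\varepsilon_-/2}}^2+\|\partial_t^2u\|_{H^0}^2+\|p\|_{W^{1,q_+}}^2+\|\partial_tp\|_{L^2}^2\\&+|\mathfrak n'|^2+|\mathfrak n''|^2+\|\xi\|_{W^{3-1/q_+,q_+}}^2+\|\partial_t\xi\|_{H^{\frac32+\frac{\varepsilon_--\alpha}2}}^2+\|\partial_t^2\xi\|_{H^1}^2 ,\end{aligned}$$ norms of $u,p$ over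 $\Omega$ and of $\xi$ over $(0,\pi)$. *)

(* Defs.v *)
From HB Require Import structures.
From mathcomp Require Import all_boot all_order all_algebra.
From mathcomp Require Import all_classical all_reals all_analysis.

Set Implicit Arguments.
Unset Strict Implicit.
Unset Printing Implicit Defensive.

Import Order.TTheory GRing.Theory Num.Theory.
Import numFieldNormedType.Exports.

Local Open Scope classical_set_scope.
Local Open Scope ring_scope.

(* Sobolev and Sobolev-Slobodeckij norms of real functions on a set U of a
   measure space (X, mu), with values in \bar R: the value is +oo when a weak
   derivative is missing or an integral diverges.  [idx j] lists the
   multi-indices of order j, [weak a f g] says that g is a weak derivative
   D^a f on U, n is the dimension and [dist] the Euclidean distance. *)
Section sobolev_norms.
Context {R : realType} {d : measure_display} {X : measurableType d}.
Variables (mu : {measure set X -> \bar R}) (U : set X).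
Variables (M : eqType) (idx : nat -> seq M).
Variable weak : M -> (X -> R) -> (X -> R) -> Prop.
Variables (n : nat) (dist : X -> X -> R).

Definition weak_deriv (a : M) (f : X -> R) : X -> R :=
  xget (cst 0) [set g | weak a f g].

Definition weakly_differentiable (m : nat) (f : X -> R) : Prop :=
  measurable_fun U f /\
  forall j a, (0 < j <= m)%N -> a \in idx j -> exists g, weak a f g.

Definition Lp_pow (p : R) (f : X -> R) : \bar R :=
  (\int[mu]_(x in U) (`|f x| `^ p)%:E)%E.

Definition sobolev_pow (m : nat) (p : R) (f : X -> R) : \bar R :=
  (if `[< weakly_differentiable m f >] then
     Lp_pow p f +
     \sum_(1 <= j < m.+1) \sum_(a <- idx j) Lp_pow p (weak_deriv a f)
   else +oo)%E.

Definition sobolev_norm (m : nat) (p : R) (f : X -> R) : \bar R :=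
  (sobolev_pow m p f `^ p^-1)%E.

(* The p-th power of the Slobodeckij seminorm of order 0 < s < 1.  On the
   diagonal the integrand is 0 / 0 = 0. *)
Definition slobodeckij_pow (s p : R) (f : X -> R) : \bar R :=
  (\int[mu]_(x in U) \int[mu]_(y in U)
     (`|f x - f y| `^ p / dist x y `^ (n%:R + s * p))%:E)%E.

(* The norm of W^{m+s,p}, for a positive integer m and 0 < s < 1. *)
Definition slobodeckij_norm (m : nat) (s p : R) (f : X -> R) : \bar R :=
  ((sobolev_pow m p f +
    \sum_(a <- idx m) slobodeckij_pow s p (weak_deriv a f)) `^ p^-1)%E.

End sobolev_norms.

Section interval.
Context {R : realType}.
Implicit Types (f g phi r : R -> R).

Definition smooth1 f : Prop := forall k x, derivable (derive1n k f) x 1.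

Definition test1 (U : set R) phi : Prop :=
  smooth1 phi /\
  exists K : set R, [/\ compact K, K `<=` U & forall x, ~ K x -> phi x = 0].

Definition weak1 (U : set R) (k : nat) f g : Prop :=
  [/\ locally_integrable U f, locally_integrable U g &
      forall phi, test1 U phi ->
        \int[lebesgue_measure]_(x in U) (f x * derive1n k phi x) =
        (-1) ^+ k * \int[lebesgue_measure]_(x in U) (g x * phi x)].

Definition dom0pi : set R := `]0, pi[%classic.

Definition sob1 : nat -> R -> (R -> R) -> \bar R :=
  sobolev_norm lebesgue_measure dom0pi (fun j => [:: j]) (weak1 dom0pi).

Definition slob1 : nat -> R -> R -> (R -> R) -> \bar R :=
  slobodeckij_norm lebesgue_measure dom0pi (fun j => [:: j]) (weak1 dom0pi)
    1 (fun x y : R => `|x - y|).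

(* The weak derivative on (0, pi). *)
Definition wder f : R -> R := weak_deriv (weak1 dom0pi) 1 f.

End interval.

Section plane.
Context {R : realType}.
Implicit Types (f g phi : R * R -> R).

Definition partial2 (a : nat * nat) f : R * R -> R :=
  iter a.1 (fun h : R * R -> R => 'D_((1, 0) : R * R) h)
    (iter a.2 (fun h : R * R -> R => 'D_((0, 1) : R * R) h) f).

Definition smooth2 f : Prop := forall a x, differentiable (partial2 a f) x.

Definition test2 (U : set (R * R)) phi : Prop :=
  smooth2 phi /\
  exists K : set (R * R),
    [/\ compact K, K `<=` U & forall x, ~ K x -> phi x = 0].

Definition lebesgue2 :
    {measure set (measurableTypeR R * measurableTypeR R)%type -> \bar R} :=
  (lebesgue_measure \x lebesgue_measure)%E.

Definition locally_integrable2 (U : set (R * R)) f : Prop :=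
  measurable_fun (U : set (measurableTypeR R * measurableTypeR R)%type) f /\
  forall K : set (R * R), K `<=` U -> compact K ->
    (\int[lebesgue2]_(x in K) `|f x|%:E < +oo)%E.

Definition weak2 (U : set (R * R)) (a : nat * nat) f g : Prop :=
  [/\ locally_integrable2 U f, locally_integrable2 U g &
      forall phi, test2 U phi ->
        \int[lebesgue2]_(x in U) (f x * partial2 a phi x) =
        (-1) ^+ (a.1 + a.2) * \int[lebesgue2]_(x in U) (g x * phi x)].

Definition idx2 (j : nat) : seq (nat * nat) :=
  [seq (i, (j - i)%N) | i <- iota 0 j.+1].

Definition edist2 (x y : R * R) : R :=
  Num.sqrt ((x.1 - y.1) ^+ 2 + (x.2 - y.2) ^+ 2).

Definition sob2 (U : set (R * R)) : nat -> R -> (R * R -> R) -> \bar R :=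
  sobolev_norm lebesgue2 U idx2 (weak2 U).

Definition slob2 (U : set (R * R)) : nat -> R -> R -> (R * R -> R) -> \bar R :=
  slobodeckij_norm lebesgue2 U idx2 (weak2 U) 2 edist2.

End plane.

Section droplet.
Context {R : realType}.
Implicit Types (g sigma gam V T t : R) (r f : R -> R).

Definition int0pi f : R := \int[lebesgue_measure]_(x in `[0, pi]) f x.

(* A function on [0, pi] is represented by an extension to R, so regularity up
   to the end points is regularity on R; no condition is put on the values
   outside [0, pi]. *)
Definition C1 f : Prop := (forall x, derivable f x 1) /\ continuous (derive1 f).

Definition droplet_energy g sigma gam r : R :=
  g / 3 * int0pi (fun x => r x ^+ 3 * sin x) +
  sigma * int0pi (fun x => Num.sqrt (r x ^+ 2 + derive1 r x ^+ 2)) -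
  gam * (r 0 + r pi).

Definition admissible V r : Prop :=
  [/\ C1 r, forall x, 0 <= x <= pi -> 0 < r x
    & int0pi (fun x => r x ^+ 2) = V].

Definition equilibrium g sigma gam V (rho0 : R -> R) : Prop :=
  [/\ smooth1 rho0, admissible V rho0,
      forall r, admissible V r ->
        droplet_energy g sigma gam rho0 <= droplet_energy g sigma gam r
    & forall x, 0 <= x <= pi -> rho0 (pi - x) = rho0 x].

Definition xi_s (rho0 : R -> R) : R -> R :=
  fun x => cos x + derive1 rho0 x / rho0 x * sin x.

(* The derivatives of r1, r2 are weak ones, since the form acts on H^1. *)
Definition bilinear_form g sigma (rho0 : R -> R) (r1 r2 : R -> R) : R :=
  g * int0pi (fun x => rho0 x * r1 x * r2 x * sin x) +
  sigma * int0pi (fun x =>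
    (rho0 x ^+ 2 * wder r1 x * wder r2 x
     - rho0 x * derive1 rho0 x * (wder r1 x * r2 x + r1 x * wder r2 x)
     + (derive1n 2 rho0 x * rho0 x - derive1 rho0 x ^+ 2 - rho0 x ^+ 2)
       * r1 x * r2 x)
    / (rho0 x ^+ 2 + derive1 rho0 x ^+ 2) `^ (3 / 2)).

Definition fluid_domain (rho0 : R -> R) : set (R * R) :=
  [set x | exists th s : R, [/\ 0 < th < pi, 0 < s < rho0 th
    & x = (s * cos th, s * sin th)]].

(* f' is the derivative of f on (0, T), where f is regarded as a function of
   time with values in the space normed by N. *)
Definition time_deriv {X : Type} (N : (X -> R) -> \bar R) T
    (f f' : R -> X -> R) : Prop :=
  forall t, 0 < t < T ->
    (fun h : R => N (fun x => h^-1 * (f (t + h) x - f t x) - f' t x)) h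
      @[h --> 0^'] --> 0%E.

Definition L2 : (R -> R) -> \bar R := sob1 0 2.
Definition H1 : (R -> R) -> \bar R := sob1 1 2.

(* The square of the norm of a vector field, given the norm N of a scalar. *)
Definition vec_sq (N : (R * R -> R) -> \bar R) (u : R * R -> R * R) : \bar R :=
  (N (fun x => (u x).1) ^+ 2 + N (fun x => (u x).2) ^+ 2)%E.

(* u k t, p k t and xi k t are the k-th time derivatives at time t; em, ep and
   al are epsilon_-, epsilon_+ and alpha. *)
Definition total_energy (rho0 : R -> R) (em ep al : R)
    (u : nat -> R -> R * R -> R * R) (p : nat -> R -> R * R -> R) (pole : R -> R) (xi : nat -> R -> R -> R) t :
    \bar R :=
  let Om := fluid_domain rho0 in
  let q := 2 / (2 - ep) in
  (\sum_(k < 3) (vec_sq (sob2 Om 0 2) (u k t) + H1 (xi k t) ^+ 2)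
   + vec_sq (sob2 Om 2 q) (u 0%N t)
   + vec_sq (slob2 Om 1 (em / 2) 2) (u 1%N t)
   + vec_sq (sob2 Om 0 2) (u 2%N t)
   + sob2 Om 1 q (p 0%N t) ^+ 2
   + sob2 Om 0 2 (p 1%N t) ^+ 2
   + (`|derive1 pole t| ^+ 2 + `|derive1n 2 pole t| ^+ 2)%:E
   (* 3 - 1/q = 2 + (1 - 1/q) *)
   + slob1 2 (1 - q^-1) q (xi 0%N t) ^+ 2
   (* 3/2 + (em - al)/2 = 1 + (1/2 + (em - al)/2) *)
   + slob1 1 (1 / 2 + (em - al) / 2) 2 (xi 1%N t) ^+ 2
   + H1 (xi 2%N t) ^+ 2)%E.

(* The coefficients a_0, a_1, a_2; only i <= 2 is meaningful. *)
Definition a_coef (rho0 : R -> R) (xi : nat -> R -> R -> R) (i : nat) t : R :=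
  match i with
  | 0%N => - (1 / 2) * int0pi (fun x => xi 0%N t x ^+ 2)
  | 1%N => - int0pi (fun x => xi 0%N t x * xi 1%N t x)
  | _ => - int0pi (fun x => xi 1%N t x ^+ 2)
         - int0pi (fun x => xi 0%N t x * xi 2%N t x)
  end / int0pi (fun x => rho0 x ^+ 2).

Definition corrected (rho0 : R -> R) (xi : nat -> R -> R -> R) (i : nat) t :
    R -> R :=
  fun x => xi i t x - a_coef rho0 xi i t * rho0 x.

End droplet.

(* Main.v *)
Require Import Defs.
From HB Require Import structures.
From mathcomp Require Import all_boot all_order all_algebra.
From mathcomp Require Import all_classical all_reals all_analysis.
From mathcomp Require Import measurable_realfun ring lra.

(** Write r for the profile, D = r^2 + r'^2, y = r sin (the height of the free
    surface above the substrate), v = f / r for a perturbation f, and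
    vs = xi_s / r, so that y' = r^2 vs.  The minimality of r gives a pressure
    lam, the multiplier of the volume constraint, for which z = lam - g y is
    sigma times the curvature of the free surface ([euler_lagrange]).  With this
    equation the form becomes, in the variable v,
      (f, f) = int A v'^2 + (g y - z) r^2 v^2,   A = sigma r^4 / D^(3/2),
    and the curvature equation itself reads A vs' = - z y ([der_shift]).

    The shift xi_s lies in the kernel of the form because horizontal
    translations preserve the energy: by A vs' = - z y the density of
    (f, xi_s) is - (z y v)', and y vanishes at both ends ([shift_in_kernel]).
    This gives the orthogonality relations, whatever f is.

    Coercivity holds on the f orthogonal to r and to xi_s in L2
    ([sobolev_coercive]).  The function vs solves the Jacobi equation of
    the form and vanishes at pi / 2 only, so that completing the square with it
    works on each half of (0, pi), for the v that vanish at pi / 2.  To admit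
    all v, the method is applied to U = z v - k, where k is the value of z v at
    pi / 2: on each half, the integrand is s^2 / A with s = A v' + y U / vs, up
    to the terms - 2 k r^2 v + k^2 lam r^2 / z^2 and the derivative of
    - (y / (vs z)) U^2 ([square_identity]).  The boundary terms
    vanish at 0 and pi because y does, and at pi / 2 because U does.  The
    volume constraint kills the term linear in k, so that int s^2 / A and k^2
    are bounded by the form.  Since (U / (z vs))' is s / (A vs) up to a multiple of
    k, Hardy's inequality bounds the distance of v - k / z to the multiples of
    vs, separately on each half ([hardy]), and the two constraints control the
    two remaining coefficients.  All this requires z > 0, which holds because
    z^2 / 2 + g sigma n_y is a first integral, n_y being the vertical component
    of the normal: a zero of z would force z to vanish identically, whereas z = lam > 0
    at both ends ([pressure_drop_neq0], [pressure_gt0]).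

    The corrected perturbations satisfy both constraints: this is what
    differentiating conservation of mass and the choice of the pole in time
    gives ([a_coefE], [shift_constraint]).  Finally a_0, a_1, a_2 are quadratic
    in the perturbation ([a_coef_sq]), so replacing the corrected perturbation
    by the perturbation itself costs the quartic terms of the theorem, and for
    a_1 a term absorbed thanks to the smallness of the energy.

    Since the perturbations are only known through weak derivatives, the proof
    also develops the one-dimensional Sobolev theory that it needs: uniqueness
    of weak derivatives, absolutely continuous representatives
    ([sobolev_representative]) and the product rule ([abscontM]). *)

Set Implicit Arguments.
Unset Strict Implicit.
Unset Printing Implicit Defensive.

Import Order.TTheory GRing.Theory Num.Theory.
Import numFieldNormedType.Exports.

Local Open Scope classical_set_scope.
Local Open Scope ring_scope.

(** * Integrals and absolutely continuous functions on an interval *)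
Section integrals.
Context {R : realType}.
Implicit Types (a b c x y : R) (f g h F G : R -> R).

Local Notation mu := (@lebesgue_measure R).

Definition itg a b f : R := \int[mu]_(x in `[a, b]) f x.

Definition L1 a b f : Prop := mu.-integrable `[a, b] (EFin \o f).

Definition cc a b f : Prop := {within `[a, b], continuous f}.

Lemma ccP a b f : cc a b f <->
  forall x, a <= x <= b -> f @ within `[a, b] (nbhs x) --> f x.
Proof.
split=> [/subspace_continuousP H x xab|H].
  by apply: H; rewrite /= in_itv.
by apply/subspace_continuousP => x; rewrite /= in_itv /=; exact: H.
Qed.

Lemma cc_cst a b c : cc a b (fun=> c).
Proof. by move=> x; exact: cvg_cst. Qed.

Lemma ccD a b f g : cc a b f -> cc a b g -> cc a b (fun x => f x + g x).
Proof. by move=> cf cg x; apply: cvgD; [exact: cf|exact: cg]. Qed.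

Lemma ccM a b f g : cc a b f -> cc a b g -> cc a b (fun x => f x * g x).
Proof. by move=> cf cg x; apply: cvgM; [exact: cf|exact: cg]. Qed.

Lemma ccN a b f : cc a b f -> cc a b (fun x => - f x).
Proof. by move=> cf x; apply: cvgN; exact: cf. Qed.

Lemma ccB a b f g : cc a b f -> cc a b g -> cc a b (fun x => f x - g x).
Proof. by move=> cf cg; apply: ccD => //; exact: ccN. Qed.

Lemma ccX a b f n : cc a b f -> cc a b (fun x => f x ^+ n).
Proof.
move=> cf; elim: n => [|n IH].
  by rewrite (_ : (fun x => _) = fun=> 1) //; exact: cc_cst.
rewrite (_ : (fun x => _) = fun x => f x * f x ^+ n); first exact: ccM.
by apply/funext => x; rewrite exprS.
Qed.

Lemma ccV a b f : (forall x, a <= x <= b -> f x != 0) ->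
  cc a b f -> cc a b (fun x => (f x)^-1).
Proof.
by move=> f0 /ccP cf; apply/ccP => x xab; apply: cvgV; [exact: f0|exact: cf].
Qed.

Lemma cc_cont a b f : (forall x, a <= x <= b -> {for x, continuous f}) ->
  cc a b f.
Proof.
by move=> H; apply/ccP => x xab; apply: cvg_within_filter; exact: H.
Qed.

Lemma ccS a b c d f : a <= c -> d <= b -> cc a b f -> cc c d f.
Proof.
move=> ac db; apply: continuous_subspaceW.
by move=> x /=; rewrite !in_itv /= => /andP[cx xd]; apply/andP; split; lra.
Qed.

Lemma cc_eq a b f g : (forall x, a <= x <= b -> f x = g x) ->
  cc a b f -> cc a b g.
Proof.
move=> fg /ccP cf; apply/ccP => x xab; rewrite -(fg _ xab).
apply: cvg_trans (cf _ xab); apply: near_eq_cvg.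
rewrite near_withinE; near=> t => /=; rewrite in_itv /= => tab.
by rewrite fg.
Unshelve. all: by end_near. Qed.

Lemma cc_measurable a b f : cc a b f -> measurable_fun `[a, b] f.
Proof. by move=> cf; apply: measurable_realfun.subspace_continuous_measurable_fun. Qed.

Lemma cc_bound a b f : cc a b f ->
  exists2 M : R, 0 < M & forall x, a <= x <= b -> `|f x| <= M.
Proof.
have [ab|ba] := leP a b; last first.
  by move=> _; exists 1 => // x /andP[ax xb]; exfalso; lra.
move=> cf.
have cn : {within `[a, b], continuous (fun x => `|f x|)}.
  by move=> x; apply: cvg_norm; exact: cf.
have [c _ Hc] := EVT_max ab cn.
exists (`|f c| + 1); first by have := normr_ge0 (f c); lra.
by move=> x xab; have := Hc x; rewrite in_itv /= xab => /(_ isT); lra.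
Qed.

Lemma cc_pos a b f : cc a b f -> (forall x, a <= x <= b -> 0 < f x) ->
  exists2 m : R, 0 < m & forall x, a <= x <= b -> m <= f x.
Proof.
have [ab|ba] := leP a b; last first.
  by move=> _ _; exists 1 => // x /andP[ax xb]; exfalso; lra.
move=> cf fp; have [c + Hc] := EVT_min ab cf.
rewrite in_itv /= => cab; exists (f c); first exact: fp.
by move=> x xab; apply: Hc; rewrite in_itv.
Qed.

Lemma ccL1 a b f : cc a b f -> L1 a b f.
Proof.
move=> cf; apply: continuous_compact_integrable => //; exact: segment_compact.
Qed.

Lemma L1_measurable a b f : L1 a b f -> measurable_fun `[a, b] f.
Proof. by move=> /integrableP[/measurable_EFinP]. Qed.

Lemma L1_le a b f g : measurable_fun `[a, b] f -> L1 a b g ->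
  (forall x, a <= x <= b -> `|f x| <= `|g x|) -> L1 a b f.
Proof.
move=> /measurable_EFinP mf ig fg.
apply: (@le_integrable _ _ _ mu `[a, b] _ (EFin \o f) (EFin \o g) mf _ ig).
  exact: measurable_itv.
by move=> x; rewrite /= in_itv /= => xab; rewrite lee_fin fg.
Qed.

Lemma L1D a b f g : L1 a b f -> L1 a b g -> L1 a b (fun x => f x + g x).
Proof. by move=> If Ig; exact: (integrableD _ If Ig). Qed.

Lemma L1B a b f g : L1 a b f -> L1 a b g -> L1 a b (fun x => f x - g x).
Proof. by move=> If Ig; exact: (integrableB _ If Ig). Qed.

Lemma L1Z a b c f : L1 a b f -> L1 a b (fun x => c * f x).
Proof. by move=> If; exact: (integrableZl _ _ If). Qed.

Lemma L1abs a b f : L1 a b f -> L1 a b (fun x => `|f x|).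
Proof. by move=> If; exact: (integrable_norm If). Qed.

Lemma L1S a b c d f : a <= c -> d <= b -> L1 a b f -> L1 c d f.
Proof.
move=> ac db; apply: integrableS => //.
by move=> x /=; rewrite !in_itv /= => /andP[cx xd]; apply/andP; split; lra.
Qed.

Lemma L1_eq a b f g : (forall x, a <= x <= b -> f x = g x) ->
  L1 a b f -> L1 a b g.
Proof.
move=> fg; apply: eq_integrable => // x; rewrite inE /= in_itv /= => xab.
by rewrite fg.
Qed.

Lemma ccL1M a b f g : cc a b f -> L1 a b g -> L1 a b (fun x => f x * g x).
Proof.
move=> cf Ig; have [M M0 fM] := cc_bound cf.
apply: (@L1_le _ _ _ (fun x => M * g x)); last 2 first.
- exact: L1Z.
- move=> x xab; rewrite !normrM; apply: ler_wpM2r => //.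
  by rewrite (gtr0_norm M0) fM.
apply: measurable_funM; [exact: cc_measurable|exact: L1_measurable].
Qed.

Lemma eq_itg a b f g : (forall x, a <= x <= b -> f x = g x) ->
  itg a b f = itg a b g.
Proof.
by move=> fg; apply: eq_Rintegral => x; rewrite inE /= in_itv /=; exact: fg.
Qed.

Lemma itgD a b f g : L1 a b f -> L1 a b g ->
  itg a b (fun x => f x + g x) = itg a b f + itg a b g.
Proof. by move=> If Ig; rewrite /itg RintegralD. Qed.

Lemma itgB a b f g : L1 a b f -> L1 a b g ->
  itg a b (fun x => f x - g x) = itg a b f - itg a b g.
Proof. by move=> If Ig; rewrite /itg RintegralB. Qed.

Lemma itgZ a b c f : L1 a b f -> itg a b (fun x => c * f x) = c * itg a b f.
Proof. by move=> If; rewrite /itg RintegralZl. Qed.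

Lemma itgN a b f : L1 a b f -> itg a b (fun x => - f x) = - itg a b f.
Proof.
move=> If; rewrite (_ : (fun x => - f x) = fun x => -1 * f x) ?itgZ ?mulN1r //.
by apply/funext => x; rewrite mulN1r.
Qed.

Lemma itg_ge0 a b f : (forall x, a <= x <= b -> 0 <= f x) -> 0 <= itg a b f.
Proof. by move=> H; apply: Rintegral_ge0 => x; rewrite /= in_itv; exact: H. Qed.

Lemma le_itg a b f g : L1 a b f -> L1 a b g ->
  (forall x, a <= x <= b -> f x <= g x) -> itg a b f <= itg a b g.
Proof.
by move=> If Ig H; apply: le_Rintegral.
Qed.

Lemma itg_cst a b c : a <= b -> itg a b (fun=> c) = c * (b - a).
Proof.
move=> ab; rewrite /itg Rintegral_cst //= lebesgue_measure_itv /= lte_fin.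
by case: ltP => //= ?; congr (_ * _); lra.
Qed.

Lemma itg_split a b c f : a <= c -> c <= b -> L1 a b f ->
  itg a b f = itg a c f + itg c b f.
Proof.
move=> ac cb If.
have /= := @Rintegral_itvB _ _ (BLeft a) (BRight b) c If.
rewrite !bnd_simp => /(_ ac cb) H.
rewrite /itg -(@Rintegral_itv_obnd_cbnd _ c) -?H; first by rewrite addrC subrK.
apply: integrableS If => // x /=; rewrite !in_itv /= => /andP[cx xd].
by apply/andP; split; lra.
Qed.

Lemma itg_pt a f : itg a a f = 0.
Proof. by rewrite /itg set_itv1 Rintegral_set1. Qed.

Lemma ler_norm_itg a b f : L1 a b f ->
  `|itg a b f| <= itg a b (fun x => `|f x|).
Proof. by move=> If; exact: le_normr_Rintegral. Qed.

Lemma itg_le_sub a b c d f : a <= c -> c <= d -> d <= b -> L1 a b f ->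
  (forall x, a <= x <= b -> 0 <= f x) -> itg c d f <= itg a b f.
Proof.
move=> ac cd db If f0.
rewrite (@itg_split a b c) //; last lra.
rewrite (@itg_split c b d) //; last by apply: L1S If; lra.
have h1 : 0 <= itg a c f.
  by apply: itg_ge0 => x /andP[? ?]; apply: f0; lra.
have h2 : 0 <= itg d b f.
  by apply: itg_ge0 => x /andP[? ?]; apply: f0; lra.
lra.
Qed.

(** The primitives of integrable functions, by the identity that is used in
    place of differentiation almost everywhere. *)
Definition abscont a b F f : Prop := L1 a b f /\
  forall x y, a <= x -> x <= y -> y <= b -> itg x y f = F y - F x.

Lemma abscont_L1 a b F f : abscont a b F f -> L1 a b f.
Proof. by case. Qed.

Lemma abscont_itg a b F f : a <= b -> abscont a b F f -> itg a b f = F b - F a.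
Proof. by move=> ab [_ H]; apply: H. Qed.

Lemma abscontS a b c d F f : a <= c -> d <= b -> abscont a b F f -> abscont c d F f.
Proof.
move=> ac db [If H]; split; first exact: L1S If.
by move=> x y cx xy yd; apply: H; lra.
Qed.

Lemma abscont_eq a b F G f g : (forall x, a <= x <= b -> F x = G x) ->
  (forall x, a <= x <= b -> f x = g x) -> abscont a b F f -> abscont a b G g.
Proof.
move=> FG fg [If H]; split; first exact: L1_eq If.
move=> x y ax xy yb; rewrite -!FG ?H //; last by lra.
  rewrite -(H x y) //; apply: eq_itg => t /andP[xt ty]; rewrite fg //.
  by apply/andP; split; lra.
by lra.
Qed.

Lemma abscontD a b F G f g : abscont a b F f -> abscont a b G g ->
  abscont a b (fun x => F x + G x) (fun x => f x + g x).
Proof.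
move=> [If HF] [Ig HG]; split; first exact: L1D.
move=> x y ax xy yb; rewrite itgD ?HF ?HG //; last 2 first.
- by apply: L1S If; lra.
- by apply: L1S Ig; lra.
lra.
Qed.

Lemma abscontZ a b c F f : abscont a b F f -> abscont a b (fun x => c * F x) (fun x => c * f x).
Proof.
move=> [If HF]; split; first exact: L1Z.
move=> x y ax xy yb; rewrite itgZ ?HF //; first lra.
by apply: L1S If; lra.
Qed.

Lemma abscont_cst a b c : abscont a b (fun=> c) (fun=> 0).
Proof.
split; first exact/ccL1/cc_cst.
by move=> x y ax xy yb; rewrite itg_cst //; lra.
Qed.

Lemma abscontB a b F G f g : abscont a b F f -> abscont a b G g ->
  abscont a b (fun x => F x - G x) (fun x => f x - g x).
Proof.
move=> HF HG; apply: abscont_eq (abscontD HF (abscontZ (-1) HG)).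
- by move=> x _; rewrite mulN1r.
- by move=> x _; rewrite mulN1r.
Qed.

Lemma abscont_cc a b F f : abscont a b F f -> cc a b F.
Proof.
move=> [If H]; have [ab|ba] := leP a b; last first.
  by apply/ccP => x /andP[ax xb]; exfalso; lra.
have H1 := parameterized_integral_continuous ab If.
have : cc a b (fun x => F a + itg a x f).
  by apply: ccD; [exact: cc_cst|exact: H1].
apply: cc_eq => x /andP[ax xb]; rewrite H //; lra.
Qed.

Lemma abscont_prim a b f : L1 a b f -> abscont a b (fun x => itg a x f) f.
Proof.
move=> If; split=> // x y ax xy yb.
rewrite (@itg_split a y x) //; first lra.
by apply: L1S If; lra.
Qed.

Lemma abscont_C1 a b F f : cc a b f ->
  (forall x, a <= x <= b -> is_derive x (1 : R) F (f x)) -> abscont a b F f.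
Proof.
move=> cf dF; split; first exact: ccL1.
move=> x y ax; rewrite le_eqVlt => /predU1P[->|xy] yb.
  by rewrite itg_pt subrr.
have dx t : x <= t <= y -> is_derive t (1 : R) F (f t).
  by move=> /andP[xt ty]; apply: dF; apply/andP; split; lra.
have ct t : x <= t <= y -> {for t, continuous F}.
  by move=> /dx H; apply/differentiable_continuous/derivable1_diffP.
rewrite /itg /Rintegral (@continuous_FTC2 _ f F) //.
- by apply: (ccS _ _ cf); lra.
- split.
  + move=> t; rewrite in_itv /= => /andP[xt ty].
    by have [] := dx t; first by rewrite !ltW.
  + by apply: cvg_at_right_filter; apply: ct; rewrite lexx ltW.
  + by apply: cvg_at_left_filter; apply: ct; rewrite lexx ltW.
- move=> t; rewrite in_itv /= => /andP[xt ty].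
  have H : is_derive t (1:R) F (f t) by apply: dx; rewrite !ltW.
  by rewrite derive1E; exact: derive_val.
Qed.

End integrals.

(** * The product rule for absolutely continuous functions *)
Section product_rule.
Context {R : realType}.
Implicit Types (a b c x y : R) (f g h F G : R -> R).

Local Notation mu := (@lebesgue_measure R).

Lemma L1_restrict a b f : L1 a b f ->
  mu.-integrable setT (EFin \o (f \_ `[a, b])).
Proof.
by move=> If; rewrite -restrict_EFin; apply/(integrable_mkcond _ _).1.
Qed.

Lemma itg_restrict a b f : L1 a b f ->
  (\int[mu]_x ((f \_ `[a, b]) x)%:E = (itg a b f)%:E)%E.
Proof.
move=> If; rewrite /itg Rintegral_mkcond /Rintegral fineK //.
by apply: integrable_fin_num => //; exact: L1_restrict.
Qed.

Lemma integrable_triangle a b f g : L1 a b f -> L1 a b g ->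
  (mu \x mu)%E.-integrable setT (fun z : measurableTypeR R * measurableTypeR R =>
    (if z.1 <= z.2 then (f \_ `[a, b]) z.1 * (g \_ `[a, b]) z.2 else 0)%:E).
Proof.
move=> If Ig.
have mf := (measurable_restrictT f (measurable_itv `[a, b])).1 (L1_measurable If).
have mg := (measurable_restrictT g (measurable_itv `[a, b])).1 (L1_measurable Ig).
have mfg : measurable_fun setT (fun z : measurableTypeR R * measurableTypeR R =>
    (f \_ `[a, b]) z.1 * (g \_ `[a, b]) z.2).
  apply: measurable_funM.
    exact: (measurableT_comp mf measurable_fst).
  exact: (measurableT_comp mg measurable_snd).
have Ifg : (mu \x mu)%E.-integrable setT
   (fun z : measurableTypeR R * measurableTypeR R =>
    ((f \_ `[a, b]) z.1 * (g \_ `[a, b]) z.2)%:E).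
  apply/integrable12ltyP => /=; first exact/measurable_EFinP.
  have If' := integrable_norm (L1_restrict If).
  have Ig' := integrable_norm (L1_restrict Ig).
  under eq_integral => s _.
    under eq_integral => t _ do rewrite normrM EFinM.
    rewrite integralZl //.
    over.
  have fin := integrable_fin_num measurableT Ig'.
  rewrite -(fineK fin).
  rewrite integralZr //=.
  rewrite -(fineK (integrable_fin_num measurableT If')).
  by rewrite -EFinM ltry.
apply: (le_integrable _ _ _ Ifg) => //.
  apply/measurable_EFinP; apply: measurable_fun_ifT => //=.
  by apply: measurable_fun_ler; [exact: measurable_fst|exact: measurable_snd].
move=> z _; rewrite lee_fin; case: ifP => // _; by rewrite normr0.
Qed.

(** Fubini on the triangle s <= t of the square. *)
Lemma itg_triangle a b f g : a <= b -> L1 a b f -> L1 a b g ->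
  itg a b (fun s => f s * itg s b g) = itg a b (fun t => itg a t f * g t).
Proof.
move=> ab If Ig.
have cf := abscont_cc (abscont_prim If).
have cg : cc a b (fun s => itg s b g).
  have : cc a b (fun s => itg a b g - itg a s g).
    by apply: ccB; [exact: cc_cst|exact: abscont_cc (abscont_prim Ig)].
  apply: cc_eq => x /andP[ax xb]; rewrite (@itg_split _ a b x) //; lra.
have I1 : L1 a b (fun s => f s * itg s b g).
  by apply: L1_eq (ccL1M cg If) => x _; rewrite mulrC.
have I2 : L1 a b (fun t => itg a t f * g t) by exact: ccL1M.
have /= := Fubini (integrable_triangle If Ig).
under eq_integral => s _.
  rewrite (_ : (\int[mu]_y _)%E =
     (((fun s => f s * itg s b g) \_ `[a, b]) s)%:E); last first.
    rewrite /patch; case: ifPn => [|sab]; last first.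
      under eq_integral => t _ do rewrite mul0r if_same.
      by rewrite integral0.
    rewrite inE /= in_itv /= => /andP[as_ sb].
    rewrite EFinM -itg_restrict; last by apply: L1S Ig; lra.
    rewrite -integralZl //; last by apply: L1_restrict; apply: L1S Ig; lra.
    apply: eq_integral => t _; rewrite /patch !mem_setE !in_itv /= -EFinM.
    case: (leP s t) => st /=; last by rewrite mulr0.
    by rewrite (le_trans as_ st).
  over.
rewrite itg_restrict //.
under eq_integral => t _.
  rewrite (_ : (\int[mu]_x _)%E =
     (((fun t => itg a t f * g t) \_ `[a, b]) t)%:E); last first.
    rewrite /patch; case: ifPn => [|tab]; last first.
      under eq_integral => s _ do rewrite mulr0 if_same.
      by rewrite integral0.
    rewrite inE /= in_itv /= => /andP[at_ tb].
    rewrite EFinM -itg_restrict; last by apply: L1S If; lra.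
    rewrite -integralZr //; last by apply: L1_restrict; apply: L1S If; lra.
    apply: eq_integral => s _; rewrite /patch !mem_setE !in_itv /= -EFinM.
    case: (leP s t) => st /=; last by rewrite andbF mul0r.
    by rewrite (le_trans st tb) andbT.
  over.
by rewrite itg_restrict // => -[].
Qed.

(** Replacing F t by F x + itg x t f and G s by G y - itg s y g turns the
    claim into [itg_triangle]. *)
Lemma abscontM a b F G f g : abscont a b F f -> abscont a b G g ->
  abscont a b (fun x => F x * G x) (fun x => f x * G x + F x * g x).
Proof.
move=> HF HG; have [If EF] := HF; have [Ig EG] := HG.
have cF := abscont_cc HF; have cG := abscont_cc HG.
have I1 : L1 a b (fun x => f x * G x).
  by apply: L1_eq (ccL1M cG If) => x _; rewrite mulrC.
have I2 : L1 a b (fun x => F x * g x) by exact: ccL1M.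
split; first exact: L1D.
move=> x y ax xy yb.
have [If' Ig'] : L1 x y f /\ L1 x y g by split; [exact: L1S If|exact: L1S Ig].
have := itg_triangle xy If' Ig'.
have -> : itg x y (fun s => f s * itg s y g) =
          G y * itg x y f - itg x y (fun s => f s * G s).
  rewrite -itgZ // -itgB //; last 2 first.
  - exact: L1Z.
  - exact: L1S I1.
  by apply: eq_itg => s /andP[xs sy]; rewrite EG; [ring|lra|lra|lra].
have -> : itg x y (fun t => itg x t f * g t) =
          itg x y (fun s => F s * g s) - F x * itg x y g.
  rewrite -itgZ // -itgB //; last 2 first.
  - exact: L1S I2.
  - exact: L1Z.
  by apply: eq_itg => s /andP[xs sy]; rewrite EF; [ring|lra|lra|lra].
rewrite itgD ?EF ?EG //; last 2 first.
- exact: L1S I1.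
- exact: L1S I2.
by move=> H; have -> : itg x y (fun s => f s * G s) =
  G y * (F y - F x) - (itg x y (fun s => F s * g s) - F x * (G y - G x));
  [rewrite -H; ring|ring].
Qed.

End product_rule.

(** * Pointwise derivatives *)
Section derivatives.
Context {R : realType}.
Implicit Types (x c d e : R) (f g F G : R -> R).

Definition der x F d : Prop := is_derive x (1 : R) F d.

Lemma der_eq x F d e : der x F d -> d = e -> der x F e.
Proof. by move=> H <-. Qed.

Lemma der_cst x c : der x (fun=> c) 0.
Proof. exact: is_derive_cst. Qed.

Lemma der_id x : der x (fun t => t) 1.
Proof. exact: is_derive_id. Qed.

Lemma derD x F G d e : der x F d -> der x G e ->
  der x (fun t => F t + G t) (d + e).
Proof. by move=> dF dG; apply: (@is_deriveD _ _ _ F G). Qed.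

Lemma derB x F G d e : der x F d -> der x G e ->
  der x (fun t => F t - G t) (d - e).
Proof. by move=> dF dG; apply: (@is_deriveB _ _ _ F G). Qed.

Lemma derN x F d : der x F d -> der x (fun t => - F t) (- d).
Proof. by move=> dF; apply: (@is_deriveN _ _ _ F). Qed.

Lemma derM x F G d e : der x F d -> der x G e ->
  der x (fun t => F t * G t) (d * G x + F x * e).
Proof.
move=> dF dG; apply: der_eq (@is_deriveM _ _ F G _ _ _ _ dF dG) _.
by rewrite /GRing.scale /= addrC (mulrC (G x)).
Qed.

Lemma derZ x F c d : der x F d -> der x (fun t => c * F t) (c * d).
Proof. by move=> dF; apply: der_eq (derM (der_cst x c) dF) _; rewrite mul0r add0r. Qed.

Lemma derX x F d n : der x F d ->
  der x (fun t => F t ^+ n.+1) (n.+1%:R * F x ^+ n * d).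
Proof.
move=> dF; elim: n => [|n IH].
  by apply: der_eq dF _; rewrite expr0 !mul1r.
rewrite (_ : (fun t => _) = fun t => F t * F t ^+ n.+1); last first.
  by apply/funext => t; rewrite exprS.
by apply: der_eq (derM dF IH) _; rewrite !exprS -!natr1; ring.
Qed.

Lemma derV x F d : F x != 0 -> der x F d ->
  der x (fun t => (F t)^-1) (- d / F x ^+ 2).
Proof.
move=> F0 dF; apply: der_eq (is_deriveV F0 dF) _.
by rewrite /GRing.scale /= mulrC mulrN mulNr.
Qed.

Lemma der_comp x F G d e : der (G x) F d -> der x G e ->
  der x (fun t => F (G t)) (d * e).
Proof. by move=> dF dG; exact: (is_derive1_comp dF dG). Qed.

Lemma der_sqrt x F d : 0 < F x -> der x F d ->
  der x (fun t => Num.sqrt (F t)) (d / (2 * Num.sqrt (F x))).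
Proof.
move=> F0 dF; apply: der_eq (der_comp (is_derive1_sqrt F0) dF) _.
by rewrite mulrC.
Qed.

(** The case of a function that is flat at a point, for the point where the
    two pieces of [flat] meet. *)
Lemma der_sq x F C : (forall t, `|F t - F x| <= C * (t - x) ^+ 2) -> der x F 0.
Proof.
move=> HC.
have C0 : 0 <= C.
  have := HC (x + 1); rewrite addrAC subrr add0r expr1n mulr1.
  exact: le_trans.
have H : (fun h : R => h^-1 *: ((F \o shift x) (h *: 1) - F x)) @ 0^' --> (0:R).
  apply/cvgr0Pnorm_le => e e0; near=> h.
  have h0 : h != 0 by near: h; exact: nbhs_dnbhs_neq.
  rewrite normrZ normfV ler_pdivrMl ?normr_gt0 //= scaler1.
  apply: le_trans (HC _) _; rewrite addrK -real_normK ?num_real // expr2 mulrA.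
  rewrite mulrC ler_wpM2l //.
  have : `|h| <= e / (C + 1).
    near: h; apply: dnbhs0_le; rewrite divr_gt0 //; lra.
  rewrite ler_pdivlMr; last lra.
  by have := normr_ge0 h; nra.
apply: DeriveDef; first by apply/cvg_ex; exists 0.
exact: cvg_lim.
Unshelve. all: by end_near. Qed.

Lemma der_derivable x F d : der x F d -> derivable F x 1.
Proof. by case. Qed.

Lemma der_derive1 x F d : der x F d -> derive1 F x = d.
Proof. by move=> dF; rewrite derive1E; exact: derive_val. Qed.

Lemma derivable_der x F : derivable F x 1 -> der x F (derive1 F x).
Proof. by rewrite derive1E; exact: derivableP. Qed.

Lemma der_near x F G d : (\forall t \near x, F t = G t) ->
  der x F d -> der x G d.
Proof. by move=> FG dF; exact: (near_eq_is_derive FG dF). Qed.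

Lemma der_cont x F d : der x F d -> {for x, continuous F}.
Proof.
by move=> /der_derivable H; apply/differentiable_continuous/derivable1_diffP.
Qed.

End derivatives.

(** * Smooth functions *)
Section smooth_functions.
Context {R : realType}.
Implicit Types (x c d e : R) (f g F G : R -> R).

Lemma smooth1P f : smooth1 f <->
  (forall x, derivable f x 1) /\ smooth1 (derive1 f).
Proof.
split=> [sf|[df sf] [|k] x].
- by split=> [x|k x]; [exact: (sf 0%N)|rewrite -derive1Sn; exact: sf].
- exact: df.
- by rewrite derive1Sn; exact: sf.
Qed.

Lemma smooth_der f x : smooth1 f -> der x f (derive1 f x).
Proof. by move=> /smooth1P[df _]; exact: derivable_der. Qed.

Lemma smooth_derive1 f : smooth1 f -> smooth1 (derive1 f).
Proof. by move=> /smooth1P[]. Qed.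

Lemma smooth_cont f : smooth1 f -> continuous f.
Proof. by move=> sf x; exact: der_cont (smooth_der x sf). Qed.

(** A class of functions that contains the derivatives of its members consists
    of smooth functions; this avoids computing any derivative of high order. *)
Lemma smooth_coind (S : (R -> R) -> Prop) :
  (forall f, S f -> exists2 g, S g & forall x, der x f (g x)) ->
  forall f, S f -> smooth1 f.
Proof.
move=> H f Sf k; move: f Sf; elim: k => [|k IH] f Sf x.
  by have [g _ dg] := H _ Sf; exact: der_derivable (dg x).
rewrite derive1Sn; apply: IH; have [g Sg dg] := H _ Sf.
by rewrite (_ : derive1 f = g) //; apply/funext => t; exact: der_derive1.
Qed.

(** The expressions for which [smooth_coind] applies at once: the derivative of
    such an expression is again one. *)
Inductive smooth_alg : (R -> R) -> Prop :=
| smooth_base f : smooth1 f -> smooth_alg f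
| smooth_add f g : smooth_alg f -> smooth_alg g ->
    smooth_alg (fun x => f x + g x)
| smooth_mul f g : smooth_alg f -> smooth_alg g ->
    smooth_alg (fun x => f x * g x)
| smooth_cst c : smooth_alg (fun=> c)
| smooth_exp f : smooth_alg f -> smooth_alg (fun x => expR (f x)).

Lemma smooth_algP f : smooth_alg f -> smooth1 f.
Proof.
move: f; apply: smooth_coind => f; elim => {f}.
- move=> f /smooth1P[df sf]; exists (derive1 f); first exact: smooth_base.
  by move=> x; exact: derivable_der.
- move=> f g _ [f' Sf' df] _ [g' Sg' dg]; exists (fun x => f' x + g' x).
    exact: smooth_add.
  by move=> x; exact: derD.
- move=> f g Sf [f' Sf' df] Sg [g' Sg' dg].
  exists (fun x => f' x * g x + f x * g' x).
    by apply: smooth_add; exact: smooth_mul.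
  by move=> x; exact: derM.
- by move=> c; exists (fun=> 0); [exact: smooth_cst|move=> x; exact: der_cst].
- move=> f Sf [f' Sf' df]; exists (fun x => expR (f x) * f' x).
    by apply: smooth_mul => //; exact: smooth_exp.
  by move=> x; apply: der_comp => //; exact: is_derive_expR.
Qed.

(** Stated for the variable t = 1 / x of [flat], and with the power of t that a
    difference quotient at x = 0 brings in. *)
Lemma expR_poly_bound (p : {poly R}) k :
  exists2 C : R, 0 <= C & forall t : R, 0 < t -> `|p.[t]| * t ^+ k * expR (- t) <= C.
Proof.
elim/poly_ind: p k => [|p c IH] k.
  by exists 0 => // t t0; rewrite horner0 normr0 !mul0r.
have [C C0 HC] := IH k.+1.
exists (C + `|c| * k.+1%:R ^+ k.+1 + `|c|) => [|t t0].
  by rewrite !addr_ge0 // mulr_ge0.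
(* (1 + t / (k + 1)) ^ (k + 1) is at most expR t *)
have pw : t ^+ k.+1 * expR (- t) <= k.+1%:R ^+ k.+1.
  rewrite expRN ler_pdivrMr ?expR_gt0 //.
  have -> : t = k.+1%:R * (t / k.+1%:R) by rewrite mulrC divfK // pnatr_eq0.
  rewrite exprMn expRM_natl; apply: ler_pM => //.
  - by rewrite exprn_ge0 // divr_ge0 // ltW.
  - by rewrite lerXn2r // ?nnegrE ?expR_ge0 ?divr_ge0 ?(ltW t0) //;
    apply: ltW; apply: lt_le_trans (expR_ge1Dx _); rewrite ltrDr.
have tk : t ^+ k * expR (- t) <= k.+1%:R ^+ k.+1 + 1.
  have e0 := expR_gt0 (- t).
  have [t1|t1] := leP t 1.
    have : t ^+ k * expR (- t) <= 1.
      rewrite mulr_ile1 ?exprn_ge0 ?exprn_ile1 ?(ltW e0) ?(ltW t0) //.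
      by rewrite expR_le1; lra.
    by move=> /le_trans; apply; rewrite lerDr exprn_ge0.
  apply: le_trans (_ : _ <= t ^+ k.+1 * expR (- t)) _; last lra.
  by apply: ler_wpM2r; [exact: ltW|rewrite ler_weXn2l // ltW].
rewrite !hornerE.
have : `|p.[t] * t + c| * t ^+ k * expR (- t) <=
  (`|p.[t]| * t + `|c|) * t ^+ k * expR (- t).
  rewrite -!mulrA; apply: ler_wpM2r.
    by rewrite mulr_ge0 ?expR_ge0 ?exprn_ge0 // ltW.
  by rewrite (le_trans (ler_normD _ _)) // normrM (gtr0_norm t0).
move=> /le_trans; apply.
have := HC t t0; rewrite exprS => h1.
have h2 : `|c| * (t ^+ k * expR (- t)) <= `|c| * (k.+1%:R ^+ k.+1 + 1).
  exact: ler_wpM2l.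
lra.
Qed.

(** The functions p(1/x) exp(-1/x), extended by 0; with all polynomials p the
    class is closed under derivation. *)
Definition flat (p : {poly R}) : R -> R :=
  fun x => if 0 < x then p.[x^-1] * expR (- x^-1) else 0.

Lemma der_flat p x : der x (flat p) (flat ('X^2 * (p - p^`())) x).
Proof.
have [x0|x0|->] := ltgtP x 0.
- rewrite [flat ('X^2 * _) x]/flat ltNge (ltW x0) /=.
  apply: (der_near _ (der_cst x 0)).
  near=> t; rewrite /flat ltNge ltW //=.
  by near: t; exact: lt_nbhsl.
- rewrite [flat ('X^2 * _) x]/flat x0.
  apply: (@der_near _ _ (fun x => p.[x^-1] * expR (- x^-1))).
    near=> t; rewrite /flat ifT //.
    by near: t; exact: lt_nbhsr.
  have dV : der x (fun t => t^-1) (- x ^- 2).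
    apply: der_eq (derV (lt0r_neq0 x0) (der_id x)) _.
    by rewrite mulN1r.
  apply: der_eq (derM (der_comp (is_derive_poly p _) dV)
    (der_comp (is_derive_expR _) (derN dV))) _.
  by rewrite /= !hornerE /= exprVn; ring.
- rewrite [flat ('X^2 * _) 0]/flat ltxx.
  have [C C0 HC] := expR_poly_bound p 2.
  apply: (@der_sq _ _ _ C) => t; rewrite subr0 /flat ltxx subr0.
  case: ifPn => t0; last by rewrite normr0 mulr_ge0 // sqr_ge0.
  have := HC t^-1; rewrite invr_gt0 => /(_ t0) H.
  rewrite normrM (gtr0_norm (expR_gt0 _)) -ler_pdivrMr ?exprn_gt0 //.
  by move: H; rewrite exprVn; lra.
Unshelve. all: by end_near. Qed.

End smooth_functions.

(** * Bump functions and plateaus *)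
Section bumps.
Context {R : realType}.
Implicit Types (a b c x : R) (f g h : R -> R).

Local Notation mu := (@lebesgue_measure R).

Lemma smooth_flat p a b : smooth1 (fun x : R => flat p (a * x + b)).
Proof.
apply: (@smooth_coind _ (fun f => exists p a b, f = fun x : R => flat p (a * x + b)));
  last by exists p, a, b.
move=> _ [{}p [{}a [{}b ->]]].
exists (fun x => flat (a *: ('X^2 * (p - p^`()))) (a * x + b)).
  by exists (a *: ('X^2 * (p - p^`()))), a, b.
move=> x; apply: der_eq (der_comp (der_flat p _)
  (derD (derZ a (der_id x)) (der_cst x b))) _.
by rewrite mulr1 addr0 /flat; case: ifP => _; rewrite ?hornerZ ?mul0r //; ring.
Qed.

Definition bumpf a b x : R := flat 1 (x - a) * flat 1 (b - x).

Lemma flat1_ge0 x : 0 <= flat 1 x.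
Proof. by rewrite /flat; case: ifP => // _; rewrite hornerE mul1r expR_ge0. Qed.

Lemma flat1_gt0 x : 0 < x -> 0 < flat 1 x.
Proof. by rewrite /flat => ->; rewrite hornerE mul1r expR_gt0. Qed.

Lemma flat_le0 p x : x <= 0 -> flat p x = 0.
Proof. by rewrite /flat leNgt => /negbTE ->. Qed.

Lemma bump_smooth a b : smooth1 (bumpf a b).
Proof.
apply: smooth_algP; apply: smooth_mul; apply: smooth_base.
- rewrite (_ : (fun x => _) = fun x => flat 1 (1 * x + - a)); first exact: smooth_flat.
  by apply/funext => x; rewrite mul1r.
- rewrite (_ : (fun x => _) = fun x => flat 1 ((- 1) * x + b)); first exact: smooth_flat.
  by apply/funext => x; rewrite mulN1r addrC.
Qed.

Lemma bump_ge0 a b x : 0 <= bumpf a b x.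
Proof. by rewrite mulr_ge0 // flat1_ge0. Qed.

Lemma bump_gt0 a b x : a < x < b -> 0 < bumpf a b x.
Proof. by move=> /andP[ax xb]; rewrite mulr_gt0 // flat1_gt0 //; lra. Qed.

Lemma bump_out a b x : ~~ (a < x < b) -> bumpf a b x = 0.
Proof.
rewrite negb_and -!leNgt => /orP[xa|bx]; rewrite /bumpf.
- by rewrite (flat_le0 _ (x:=x - a)) ?mul0r //; lra.
- by rewrite (flat_le0 _ (x:=b - x)) ?mulr0 //; lra.
Qed.

(** Test functions that increase to the indicator function of (a, b) as n
    grows, so that no mollification is needed to pass from test functions to
    integrals over intervals. *)
Definition plateau n a b x : R := 1 - expR (- (n%:R * bumpf a b x)).

Lemma plateau_smooth n a b : smooth1 (plateau n a b).
Proof.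
apply: smooth_algP.
rewrite (_ : plateau n a b = fun x => 1 + (- 1) * expR ((- n%:R) * bumpf a b x)).
  apply: smooth_add; [exact: smooth_cst|apply: smooth_mul; first exact: smooth_cst].
  apply: smooth_exp; apply: smooth_mul; first exact: smooth_cst.
  exact/smooth_base/bump_smooth.
by apply/funext => x; rewrite /plateau mulN1r mulNr.
Qed.

Lemma plateau_out n a b x : ~~ (a < x < b) -> plateau n a b x = 0.
Proof. by move=> H; rewrite /plateau bump_out // mulr0 oppr0 expR0 subrr. Qed.

Lemma plateau01 n a b x : 0 <= plateau n a b x <= 1.
Proof.
have e0 := expR_gt0 (- (n%:R * bumpf a b x)).
have e1 : expR (- (n%:R * bumpf a b x)) <= 1.
  by rewrite expR_le1 oppr_le0 mulr_ge0 // bump_ge0.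
by rewrite /plateau; lra.
Qed.

Lemma plateau_cvg a b x : a < x < b -> plateau n a b x @[n --> \oo] --> (1 : R).
Proof.
move=> xab; have b0 := bump_gt0 xab.
rewrite -[X in _ --> X]subr0; apply: cvgB; first exact: cvg_cst.
set q := expR (- bumpf a b x).
rewrite (_ : (fun n => _) = fun n => q ^+ n); last first.
  by apply/funext => n; rewrite /q -expRM_natl mulrN.
apply: cvg_expr; rewrite ger0_norm ?expR_ge0 // expR_lt1; lra.
Qed.

Lemma test_supp a b f : 0 < a -> b < pi -> smooth1 f ->
  (forall x, ~~ (a < x < b) -> f x = 0) -> test1 dom0pi f.
Proof.
move=> a0 bpi sf f0; split=> //; exists `[a, b]%classic; split.
- exact: segment_compact.
- move=> x; rewrite /dom0pi /= !in_itv /= => /andP[ax xb].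
  by apply/andP; split; lra.
- move=> x; rewrite /= in_itv /= => H; apply: f0; apply/negP => /andP[ax xb].
  by apply: H; apply/andP; split; lra.
Qed.

Lemma itg_supp a b f : 0 < a -> b < pi ->
  (forall x, ~~ (a < x < b) -> f x = 0) ->
  \int[mu]_(x in dom0pi) f x = itg a b f.
Proof.
move=> a0 bpi f0; rewrite /itg Rintegral_mkcond [RHS]Rintegral_mkcond.
apply: eq_Rintegral => x _; rewrite /patch /dom0pi !mem_setE !in_itv /=.
case: (boolP (a < x < b)) => [/andP[ax xb]|/f0 ->]; last by rewrite !if_same.
by rewrite (lt_trans a0 ax) (lt_trans xb bpi) !ltW.
Qed.

Lemma locL1 a b f : 0 < a -> b < pi -> locally_integrable dom0pi f -> L1 a b f.
Proof.
move=> a0 bpi [mf _ H].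
have sub : `[a, b]%classic `<=` dom0pi.
  move=> x; rewrite /dom0pi /= !in_itv /= => /andP[ax xb].
  by apply/andP; split; lra.
apply/integrableP; split; last by apply: H => //; exact: segment_compact.
apply/measurable_EFinP; apply: (measurable_funS _ sub mf).
exact: measurable_itv.
Qed.

Lemma itg_oo a b f : L1 a b f -> \int[mu]_(x in `]a, b[) f x = itg a b f.
Proof.
move=> If; rewrite /itg -Rintegral_itv_obnd_cbnd; last first.
  by apply: integrableS If => // x /=; rewrite !in_itv /= => /andP[/ltW -> ->].
rewrite Rintegral_itv_bndo_bndc //.
by apply: integrableS If => // x /=; rewrite !in_itv /= => /andP[/ltW -> /ltW ->].
Qed.

Lemma itg_plateau_limit a b f : L1 a b f ->
  itg a b (fun x => f x * plateau n a b x) @[n --> \oo] --> itg a b f.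
Proof.
move=> If.
have cp n : cc a b (plateau n a b).
  apply: cc_cont => x _.
  exact/smooth_cont/plateau_smooth.
have Ip n : L1 a b (fun x => f x * plateau n a b x).
  by apply: L1_eq (ccL1M (cp n) If) => x _; rewrite mulrC.
have sub : `]a, b[ `<=` `[a, b]%classic.
  by move=> x; rewrite /= !in_itv /= => /andP[/ltW -> /ltW ->].
have Io g : L1 a b g -> mu.-integrable `]a, b[ (EFin \o g).
  by move=> Ig; apply: integrableS Ig.
have H1 n : measurable_fun `]a, b[ (EFin \o (fun x => f x * plateau n a b x)).
  by have /integrableP[] := Io _ (Ip n).
have H2 : measurable_fun `]a, b[ (EFin \o f) by have /integrableP[] := Io _ If.
have H3 : {ae mu, forall x, `]a, b[%classic x ->
    (f x * plateau n a b x)%:E @[n --> \oo] --> (f x)%:E}.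
  apply: aeW => x; rewrite /= in_itv /= => xab.
  apply: cvg_EFin; first exact: nearW.
  rewrite -[X in _ --> X]mulr1; apply: cvgM; first exact: cvg_cst.
  exact: plateau_cvg.
have H4 : {ae mu, forall x n, `]a, b[%classic x ->
    (`|(f x * plateau n a b x)%:E| <= `|f x|%:E)%E}.
  apply: aeW => x n _; rewrite lee_fin normrM.
  have /andP[p0 p1] := plateau01 n a b x.
  by rewrite (ger0_norm p0) ler_piMr.
have [_ _ H] := @dominated_convergence _ _ _ mu _ (measurable_itv `]a, b[)
  (fun n x => (f x * plateau n a b x)%:E) (fun x => (f x)%:E)
  (fun x => `|f x|%:E) H1 H2 H3 (Io _ (L1abs If)) H4.
rewrite -(itg_oo If).
rewrite (_ : (fun n => _) =
  fun n => \int[mu]_(x in `]a, b[) (f x * plateau n a b x)); last first.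
  by apply/funext => n; rewrite itg_oo.
rewrite /Rintegral; apply: fine_cvg; rewrite fineK //.
by apply: integrable_fin_num => //; exact: Io.
Qed.

End bumps.

(** * Weak derivatives on the interval (0, pi) *)
Section weak_derivatives.
Context {R : realType}.
Implicit Types (a b c x : R) (f g h phi : R -> R).

Local Notation mu := (@lebesgue_measure R).

Lemma ae_imp (P Q : R -> Prop) : (forall x, P x -> Q x) ->
  {ae mu, forall x, P x} -> {ae mu, forall x, Q x}.
Proof.
by move=> PQ; apply: filterS PQ; exact: (ae_filter_ringOfSetsType mu).
Qed.

Lemma ae_and (P Q : R -> Prop) : {ae mu, forall x, P x} ->
  {ae mu, forall x, Q x} -> {ae mu, forall x, P x /\ Q x}.
Proof.
move=> aP aQ; apply: filterS2 aP aQ; first exact: (ae_filter_ringOfSetsType mu).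
by [].
Qed.

(** On each compact subinterval the primitive of h vanishes, and almost every
    point is a Lebesgue point at which that primitive has derivative h. *)
Lemma ae_zero_of_itg h : locally_integrable dom0pi h ->
  (forall a b, 0 < a -> a < b -> b < pi -> itg a b h = 0) ->
  {ae mu, forall x, dom0pi x -> h x = 0}.
Proof.
move=> lh h0.
(* the intervals (a m, b m) exhaust (0, pi) *)
pose a (m : nat) : R := m.+1%:R^-1; pose b m : R := pi - a m.
have a0 m : 0 < a m by rewrite invr_gt0.
have bpi m : b m < pi by rewrite /b ltrBlDr ltrDl.
have Ih m : L1 (a m) (b m) h by exact: locL1.
pose hm m := h \_ `[a m, b m].
have Ihm m := L1_restrict (Ih m).
have loc m : locally_integrable [set: R] (hm m).
  exact: (open_integrable_locally openT (Ihm m)).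
have Ihy m y : mu.-integrable `]-oo, y] (EFin \o hm m).
  by apply: integrableS (Ihm m).
have H m := FTC1Ny (Ihy m) (loc m).
have {}H : {ae mu, forall x m, derivable (fun y : R => \int[mu]_(t in `]-oo, y]%classic) hm m t) x 1 /\
    derive1 (fun y : R => \int[mu]_(t in `]-oo, y]%classic) hm m t) x = hm m x}.
  exact: ae_foralln.
apply: ae_imp H => x Hx; rewrite /dom0pi /= in_itv /= => /andP[x0 xpi].
have [m /andP[am bm]] : exists m, a m < x < b m.
  have e0 : 0 < Num.min x (pi - x) by rewrite lt_min x0 subr_gt0.
  have [m Hm] := ltr_add_invr e0; exists m.
  by move: Hm; rewrite add0r lt_min -/(a m) /b => /andP[h1 h2]; apply/andP; split; lra.
have [_] := Hx m; rewrite (_ : hm m x = h x); last first.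
  by rewrite /hm patchE mem_setE in_itv /= !ltW.
move=> <-.
have near0 : \forall y \near x,
    (fun=> 0) y = (fun y : R => \int[mu]_(t in `]-oo, y]%classic) hm m t) y.
  near=> y; have ay : a m < y by near: y; exact: lt_nbhsr.
  have yb : y < b m by near: y; exact: lt_nbhsl.
  rewrite /hm -Rintegral_mkcondr (_ : _ `&` _ = `[a m, y]%classic); last first.
    apply/seteqP; split=> t /=; rewrite !in_itv /=; first by move=> [-> /andP[->]].
    move=> /andP[at_ ty]; split=> //; rewrite at_ /=; exact: le_trans ty (ltW yb).
  by rewrite -/(itg (a m) y h) h0 // (lt_trans yb).
exact: der_derive1 (der_near near0 (der_cst x 0)).
Unshelve. all: by end_near. Qed.

(** The fundamental lemma of the calculus of variations: testing with plateaus
    gives the integrals over intervals in the limit. *)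
Lemma fundamental_lemma h : locally_integrable dom0pi h ->
  (forall phi, test1 dom0pi phi -> \int[mu]_(x in dom0pi) (h x * phi x) = 0) ->
  {ae mu, forall x, dom0pi x -> h x = 0}.
Proof.
move=> lh H; apply: ae_zero_of_itg => // a b a0 ab bpi.
have L := itg_plateau_limit (locL1 a0 bpi lh).
have E n : itg a b (fun x => h x * plateau n a b x) = 0.
  rewrite -itg_supp //; last by move=> x xab; rewrite plateau_out // mulr0.
  apply: H; apply: test_supp a0 bpi _ _; first exact: plateau_smooth.
  by move=> x xab; rewrite plateau_out.
have E' : (fun n => itg a b (fun x => h x * plateau n a b x)) = fun=> 0.
  by apply/funext.
by rewrite E' in L; exact: (cvg_unique (@Rhausdorff R) L (cvg_cst _)).
Qed.

(** A compact subset of (0, pi) stays away from both ends. *)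
Lemma test1_supp phi : test1 dom0pi phi -> exists a b, [/\ 0 < a, a < b, b < pi &
  forall x, ~~ (a < x < b) -> phi x = 0 /\ derive1 phi x = 0].
Proof.
move=> [sphi [K [cK KU phi0]]].
have cl : closed K by apply: compact_closed => //; exact: Rhausdorff.
have far c : ~ K c -> exists2 e : R, 0 < e & forall x, `|c - x| < e -> ~ K x.
  move=> Kc; have : nbhs c (~` K) by apply: open_nbhs_nbhs; split => //; exact: closed_openC.
  by move=> /nbhs_ballP[e /= e0 He]; exists e => // x xe; exact: He.
have K0 x : x <= 0 -> ~ K x.
  by move=> x0 /KU; rewrite /dom0pi /= in_itv /= ltNge x0.
have Kpi x : pi <= x -> ~ K x.
  by move=> x0 /KU; rewrite /dom0pi /= in_itv /= [x < pi]ltNge x0 andbF.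
have [e1 e10 H1] := far _ (K0 0 (lexx _)).
have [e2 e20 H2] := far _ (Kpi pi (lexx _)).
have pi2 := @pi_ge2 R.
have Z x : x < e1 \/ pi - e2 < x -> phi x = 0.
  move=> xx; apply: phi0; have [x0|x0] := leP x 0; first exact: K0.
  have [xp|xp] := leP pi x; first exact: Kpi.
  case: xx => xx.
    by apply: H1; rewrite sub0r normrN gtr0_norm.
  by apply: H2; rewrite gtr0_norm; lra.
have m1 : 0 < Num.min e1 1 <= 1 /\ Num.min e1 1 <= e1.
  by rewrite lt_min e10 ltr01 !ge_min !lexx orbT.
have m2 : 0 < Num.min e2 1 <= 1 /\ Num.min e2 1 <= e2.
  by rewrite lt_min e20 ltr01 !ge_min !lexx orbT.
case: m1 => /andP[m1 m1'] m1e; case: m2 => /andP[m2 m2'] m2e.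
exists (Num.min e1 1 / 2), (pi - Num.min e2 1 / 2).
split; [lra|lra|lra|move=> x; rewrite negb_and -!leNgt => xx].
have xx' : x < e1 \/ pi - e2 < x by case/orP: xx => xx; [left|right]; lra.
split; first exact: Z.
apply: der_derive1; apply: (der_near _ (der_cst x 0)).
case: xx' => xx'; near=> t; apply/esym/Z; [left|right].
  by near: t; exact: lt_nbhsl.
by near: t; exact: lt_nbhsr.
Unshelve. all: by end_near. Qed.

Lemma L1_dom f : L1 0 pi f -> mu.-integrable dom0pi (EFin \o f).
Proof.
move=> If; apply: integrableS If => //; first exact: measurable_itv.
move=> x; rewrite /dom0pi /= !in_itv /= => /andP[x0 xp].
by apply/andP; split; lra.
Qed.

Lemma L1_loc f : L1 0 pi f -> locally_integrable dom0pi f.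
Proof.
by move=> If; apply: open_integrable_locally; [exact: interval_open|exact: L1_dom].
Qed.

Lemma measurable_dom_cc f : measurable_fun dom0pi f -> measurable_fun `[0, pi] f.
Proof.
move=> mf; have pi0 := @pi_gt0 R.
have -> : `[0, pi]%classic = [set (0:R)] `|` (dom0pi `|` [set pi]).
  apply/seteqP; split=> x; rewrite /dom0pi /= !in_itv /=.
    move=> /andP[]; rewrite le_eqVlt => /predU1P[->|x0]; first by left.
    rewrite le_eqVlt => /predU1P[->|xp]; first by right; right.
    by right; left; apply/andP.
  by case=> [->|[/andP[x0 xp]|->]]; apply/andP; split; lra.
have mdom : measurable (@dom0pi R) by exact: measurable_itv.
apply/measurable_funU; [by []|exact: measurableU|].
split; first exact: measurable_fun_set1.
by apply/measurable_funU => //; split => //; exact: measurable_fun_set1.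
Qed.

Lemma integral_dom0pi (f : R -> \bar R) : measurable_fun dom0pi f ->
  (\int[mu]_(x in dom0pi) f x = \int[mu]_(x in `[0%R, pi]) f x)%E.
Proof.
by move=> mf; rewrite -(integral_itv_bndoo true false mf).
Qed.

Lemma L1_dom_iff f : L1 0 pi f <-> mu.-integrable dom0pi (EFin \o f).
Proof.
split; first exact: L1_dom.
move=> /integrableP[/measurable_EFinP mf fin]; apply/integrableP; split.
  by apply/measurable_EFinP; exact: measurable_dom_cc.
by rewrite -integral_dom0pi //; do 2 apply: measurableT_comp => //.
Qed.

Lemma L1_test a b f phi : L1 a b f -> smooth1 phi ->
  L1 a b (fun x => f x * phi x).
Proof.
move=> If sphi; apply: L1_eq (ccL1M _ If) => [x _|]; first by rewrite mulrC.
by apply: cc_cont => x _; exact: smooth_cont.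
Qed.

Lemma weak1_abscont F f : abscont 0 pi F f -> weak1 dom0pi 1 F f.
Proof.
move=> HF; have If := abscont_L1 HF.
have IF : L1 0 pi F by exact/ccL1/(abscont_cc HF).
split; [exact: L1_loc|exact: L1_loc|move=> phi tphi].
have [a [b [a0 ab bpi H]]] := test1_supp tphi.
have sphi := tphi.1.
rewrite (itg_supp a0 bpi); last by move=> x /H[_]; rewrite derive1n1 => ->; rewrite mulr0.
rewrite (itg_supp a0 bpi); last by move=> x /H[-> _]; rewrite mulr0.
have HF' : abscont a b F f by apply: abscontS HF; lra.
have Hphi : abscont a b phi (derive1 phi).
  apply: abscont_C1 => [|x _]; last exact: smooth_der.
  by apply: cc_cont => x _; exact/smooth_cont/smooth_derive1.
have := abscont_itg (ltW ab) (abscontM HF' Hphi).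
have na : ~~ (a < a < b) by rewrite ltxx.
have nb : ~~ (a < b < b) by rewrite ltxx andbF.
have [-> _] := H _ na; have [-> _] := H _ nb.
rewrite itgD; last 2 first.
- exact: L1_test (HF'.1) sphi.
- apply: L1_test (smooth_derive1 sphi); apply: ccL1; exact: abscont_cc HF'.
by rewrite expr1 mulN1r !mulr0 subrr derive1n1 => /eqP; rewrite addrC addr_eq0 => /eqP.
Qed.

Lemma weak1B f1 g1 f2 g2 phi : weak1 dom0pi 1 f1 g1 -> weak1 dom0pi 1 f2 g2 ->
  test1 dom0pi phi ->
  \int[mu]_(x in dom0pi) ((f1 x - f2 x) * derive1 phi x) =
  - \int[mu]_(x in dom0pi) ((g1 x - g2 x) * phi x).
Proof.
move=> [lf1 lg1 w1] [lf2 lg2 w2] tphi.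
have [a [b [a0 ab bpi H]]] := test1_supp tphi.
have sphi := tphi.1; have sphi' := smooth_derive1 sphi.
have S0 f : \int[mu]_(x in dom0pi) (f x * phi x) = itg a b (fun x => f x * phi x).
  by apply: itg_supp => // x /H[-> _]; rewrite mulr0.
have S1 f : \int[mu]_(x in dom0pi) (f x * derive1 phi x) =
    itg a b (fun x => f x * derive1 phi x).
  by apply: itg_supp => // x /H[_ ->]; rewrite mulr0.
have := w1 _ tphi; have := w2 _ tphi.
rewrite derive1n1 expr1 !mulN1r !S0 !S1 => E2 E1.
have L h := @locL1 _ a b h a0 bpi.
rewrite (@eq_itg _ _ _ _ (fun x => f1 x * derive1 phi x - f2 x * derive1 phi x)); last first.
  by move=> x _; rewrite mulrBl.
rewrite itgB ?E1 ?E2; [|exact: L1_test (L _ lf1) _|exact: L1_test (L _ lf2) _].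
rewrite (@eq_itg _ _ _ (fun x => (g1 x - g2 x) * phi x)
  (fun x => g1 x * phi x - g2 x * phi x)); last first.
  by move=> x _; rewrite mulrBl.
rewrite itgB; [ring|exact: L1_test (L _ lg1) _|exact: L1_test (L _ lg2) _].
Qed.

Lemma loc_sub f g : locally_integrable dom0pi f -> locally_integrable dom0pi g ->
  locally_integrable dom0pi (fun x => f x - g x).
Proof. exact: locally_integrableB. Qed.

Lemma weak1_unique f g1 g2 : weak1 dom0pi 1 f g1 -> weak1 dom0pi 1 f g2 ->
  {ae mu, forall x, dom0pi x -> g1 x = g2 x}.
Proof.
move=> w1 w2; have [_ l1 _] := w1; have [_ l2 _] := w2.
have := @fundamental_lemma _ (loc_sub l1 l2).
move=> H; have {}H : {ae mu, forall x, dom0pi x -> g1 x - g2 x = 0}.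
  apply: H => phi tphi; have := weak1B w1 w2 tphi.
  have -> : \int[mu]_(x in dom0pi) ((f x - f x) * derive1 phi x) = 0.
    rewrite (@eq_Rintegral _ _ _ _ _ (fun=> 0)); first by rewrite Rintegral_cst ?mul0r //; exact: measurable_itv.
    by move=> x _; rewrite subrr mul0r.
  by move/eqP; rewrite eq_sym oppr_eq0 => /eqP.
by apply: ae_imp H => x Hx /Hx /eqP; rewrite subr_eq0 => /eqP.
Qed.

End weak_derivatives.

(** * Absolutely continuous representatives *)
Section sobolev_representative.
Context {R : realType}.
Implicit Types (a b c x : R) (f g h phi : R -> R).

Local Notation mu := (@lebesgue_measure R).

Lemma itg_zero a b f : (forall x, a <= x <= b -> f x = 0) -> itg a b f = 0.
Proof.
move=> f0; have [ab|ba] := leP a b.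
  by rewrite (eq_itg f0) itg_cst // mul0r.
by rewrite /itg set_itv_ge ?Rintegral_set0 // bnd_simp -ltNge.
Qed.

Lemma itg_gt0 a b f : a < b -> cc a b f -> (forall x, a < x < b -> 0 < f x) ->
  0 < itg a b f.
Proof.
move=> ab cf f0; set c := a + (b - a) / 3; set d := a + 2 * (b - a) / 3.
have ac : a < c by rewrite /c; lra.
have cd : c < d by rewrite /c /d; lra.
have db : d < b by rewrite /d; lra.
have [||m m0 Hm] := @cc_pos _ c d f.
- by apply: ccS cf; lra.
- by move=> x /andP[cx xd]; apply: f0; apply/andP; split; lra.
have If := ccL1 cf.
have f0' x : a < x < b -> 0 <= f x by move=> /f0 /ltW.
have ends : forall x y, a <= x -> x <= y -> y <= b -> 0 <= itg x y f.
  move=> x y ax xy yb; rewrite -itg_oo; last by apply: L1S If.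
  apply: Rintegral_ge0 => t; rewrite /= in_itv /= => /andP[xt ty].
  by apply: f0'; apply/andP; split; lra.
have : m * (d - c) <= itg c d f.
  rewrite -itg_cst; last lra.
  apply: le_itg; [exact/ccL1/cc_cst|by apply: L1S If; lra|exact: Hm].
have := ends a c; have := ends d b.
rewrite (@itg_split _ a b c) //; [|lra..].
rewrite (@itg_split _ c b d) //; [|lra|lra|by apply: L1S If; lra].
move=> /(_ (ltW (lt_trans ac cd)))  H1 H2 H3.
have {}H1 : 0 <= itg d b f by apply: ends; lra.
have {}H2 : 0 <= itg a c f by apply: ends; lra.
have : 0 < m * (d - c) by rewrite mulr_gt0 // subr_gt0.
lra.
Qed.

(** The primitive of psi is constant on both sides of the support of psi, and
    equal to 0 there because psi has integral 0. *)
Lemma test_antiderivative a b psi : 0 < a -> a < b -> b < pi -> smooth1 psi ->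
  (forall x, ~~ (a < x < b) -> psi x = 0) -> itg a b psi = 0 ->
  exists2 phi, test1 dom0pi phi & derive1 phi = psi.
Proof.
move=> a0 ab bpi spsi psi0 int0.
pose phi x := itg (a - 1) x psi.
have Ipsi x y : L1 x y psi by apply/ccL1/cc_cont => t _; exact: smooth_cont.
have phi_lo x : x <= a -> phi x = 0.
  move=> xa; apply: itg_zero => t /andP[_ tx]; apply: psi0.
  by rewrite negb_and -!leNgt (le_trans tx xa).
have phi_hi x : b <= x -> phi x = 0.
  move=> bx; rewrite /phi (@itg_split _ _ _ a); [|lra|lra|exact: Ipsi].
  rewrite -/(phi a) phi_lo // add0r (@itg_split _ _ _ b); [|lra|lra|exact: Ipsi].
  rewrite int0 add0r; apply: itg_zero => t /andP[bt _]; apply: psi0.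
  by rewrite negb_and -!leNgt bt orbT.
have dphi x : der x phi (psi x).
  have [xa|ax] := ltP x a.
    have -> : psi x = 0 by apply: psi0; rewrite negb_and -!leNgt (ltW xa).
    apply: (der_near _ (der_cst x 0)); near=> t; rewrite phi_lo //.
    by apply/ltW; near: t; exact: lt_nbhsl.
  have [||||d e] := @continuous_FTC1_closed _ psi (a - 1) x (x + 1).
  - lra.
  - exact: Ipsi.
  - lra.
  - exact: smooth_cont.
  by rewrite -e; exact: derivable_der.
have dE : derive1 phi = psi by apply/funext => x; exact: der_derive1.
exists phi; last exact: dE.
apply: (test_supp a0 bpi).
  by apply/smooth1P; split; [move=> x; exact: der_derivable (dphi x)|rewrite dE].
move=> x; rewrite negb_and -!leNgt => /orP[]; [exact: phi_lo|exact: phi_hi].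
Unshelve. all: by end_near. Qed.

(** The lemma of du Bois-Reymond.  For any test function psi, the function
    psi - k beta, with k chosen to make its integral 0, is the derivative of a
    test function; hence h - c is orthogonal to psi, where c is the mean of h
    against the fixed bump beta. *)
Lemma weak_const h : locally_integrable dom0pi h ->
  (forall phi, test1 dom0pi phi ->
    \int[mu]_(x in dom0pi) (h x * derive1 phi x) = 0) ->
  exists c, {ae mu, forall x, dom0pi x -> h x = c}.
Proof.
move=> lh H; have pi2 := @pi_ge2 R.
pose beta := bumpf (2^-1 : R) 1.
have sbeta : smooth1 beta by exact: bump_smooth.
have cs phi (sphi : smooth1 phi) x y : cc x y phi.
  by apply: cc_cont => t _; exact: smooth_cont.
have I0 : 0 < itg 2^-1 1 beta.
  apply: itg_gt0; [lra|exact: cs|by move=> x; exact: bump_gt0].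
pose J f := \int[mu]_(x in dom0pi) f x.
pose c := J (fun x => h x * beta x) / itg 2^-1 1 beta.
exists c.
have lc : locally_integrable (@dom0pi R) (fun=> c) by exact/L1_loc/ccL1/cc_cst.
have {}H : {ae mu, forall x, dom0pi x -> h x - c = 0}; last first.
  by apply: ae_imp H => x Hx /Hx /eqP; rewrite subr_eq0 => /eqP.
apply: fundamental_lemma; first exact: loc_sub.
move=> psi tpsi; have [a' [b' [a0' ab' bpi' H0']]] := test1_supp tpsi.
have spsi := tpsi.1.
pose a := Num.min a' 2^-1; pose b := Num.max b' 1.
have a0 : 0 < a by rewrite lt_min a0' /=; lra.
have bpi : b < pi by rewrite gt_max bpi' /=; lra.
have aa : a <= a' by rewrite ge_min lexx.
have a2 : a <= 2^-1 by rewrite ge_min lexx orbT.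
have bb : b' <= b by rewrite le_max lexx.
have b1 : 1 <= b by rewrite le_max lexx orbT.
have ab : a < b by lra.
have psi0 x : ~~ (a < x < b) -> psi x = 0.
  rewrite negb_and -!leNgt => xab; apply: (H0' x _).1.
  by rewrite negb_and -!leNgt; case/orP: xab => ?; apply/orP; [left|right]; lra.
have beta0 x : ~~ (a < x < b) -> beta x = 0.
  rewrite negb_and -!leNgt => xab; apply: bump_out.
  by rewrite negb_and -!leNgt; case/orP: xab => ?; apply/orP; [left|right]; lra.
have I0E : itg a b beta = itg 2^-1 1 beta.
  have h0 : (0 : R) < 2^-1 by lra.
  have h1 : (1 : R) < pi by lra.
  rewrite -(itg_supp a0 bpi beta0); apply: (itg_supp h0 h1) => x.
  exact: bump_out.
set k := itg a b psi / itg a b beta.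
have Ih := locL1 a0 bpi lh.
have Ipsi : L1 a b psi by exact/ccL1/cs.
have Ibeta : L1 a b beta by exact/ccL1/cs.
have Ihpsi := L1_test Ih spsi; have Ihbeta := L1_test Ih sbeta.
have sd : smooth1 (fun x => psi x - k * beta x).
  apply: smooth_algP.
  rewrite (_ : (fun x => _) = fun x => psi x + (- k) * beta x); last first.
    by apply/funext => x; rewrite mulNr.
  apply: smooth_add; first exact: smooth_base.
  by apply: smooth_mul; [exact: smooth_cst|exact: smooth_base].
have d0 x : ~~ (a < x < b) -> psi x - k * beta x = 0.
  by move=> xab; rewrite psi0 // beta0 // mulr0 subr0.
have id0 : itg a b (fun x => psi x - k * beta x) = 0.
  rewrite itgB //; last exact: L1Z.
  by rewrite itgZ // /k divfK ?subrr // I0E gt_eqF.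
have [phi tphi dphi] := test_antiderivative a0 ab bpi sd d0 id0.
have := H _ tphi; rewrite dphi.
rewrite (itg_supp a0 bpi); last by move=> x /d0 ->; rewrite mulr0.
rewrite (@eq_itg _ _ _ _ (fun x => h x * psi x - k * (h x * beta x))); last first.
  by move=> x _; ring.
rewrite itgB //; last exact: L1Z.
rewrite itgZ // => Eh.
rewrite (itg_supp a0 bpi); last by move=> x /psi0 ->; rewrite mulr0.
rewrite (@eq_itg _ _ _ _ (fun x => h x * psi x - c * psi x)); last first.
  by move=> x _; rewrite mulrBl.
rewrite itgB //; last exact: L1Z.
rewrite itgZ // -Eh /c /J (itg_supp a0 bpi); last by move=> x /beta0 ->; rewrite mulr0.
by rewrite /k -I0E; ring.
Qed.

(** The primitive of g has the same weak derivative as f, so [weak_const]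
    applies to the difference. *)
Lemma sobolev_representative f g : weak1 dom0pi 1 f g -> L1 0 pi g ->
  exists2 F, abscont 0 pi F g & {ae mu, forall x, dom0pi x -> f x = F x}.
Proof.
move=> w Ig; have AG := abscont_prim Ig.
have wG := weak1_abscont AG.
have [lf _ _] := w; have [lG _ _] := wG.
have [|c Hc] := @weak_const _ (loc_sub lf lG).
  move=> phi tphi; rewrite (weak1B w wG tphi).
  rewrite (@eq_Rintegral _ _ _ _ _ (fun=> 0)); last first.
    by move=> x _; rewrite subrr mul0r.
  by rewrite Rintegral_cst ?mul0r ?oppr0 //; exact: measurable_itv.
exists (fun x => c + itg 0 x g).
  by apply: abscont_eq (abscontD (abscont_cst 0 pi c) AG) => // x _; rewrite add0r.
by apply: ae_imp Hc => x Hx /Hx <-; rewrite subrK.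
Qed.

End sobolev_representative.

(** * First variation of the energy *)

(** Continuity by the shape of the expression; the atoms are looked up among
    the hypotheses. *)
Ltac cc_tac := lazymatch goal with
  | |- cc ?a ?b (fun _ => ?c) => exact (@cc_cst _ a b c)
  | |- cc ?a ?b (fun x => @GRing.add _ (@?f x) (@GRing.opp _ (@?h x))) =>
      refine (@ccB _ a b f h _ _); cbv beta; cc_tac
  | |- cc ?a ?b (fun x => @GRing.add _ (@?f x) (@?h x)) =>
      refine (@ccD _ a b f h _ _); cbv beta; cc_tac
  | |- cc ?a ?b (fun x => @GRing.mul _ (@?f x) (@?h x)) =>
      refine (@ccM _ a b f h _ _); cbv beta; cc_tac
  | |- cc ?a ?b (fun x => @GRing.opp _ (@?f x)) =>
      refine (@ccN _ a b f _); cbv beta; cc_tac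
  | |- cc ?a ?b (fun x => @GRing.exp _ (@?f x) ?n) =>
      refine (@ccX _ a b f n _); cbv beta; cc_tac
  | _ => try assumption
  end.
Ltac L1_tac := apply: ccL1; cc_tac.

Section first_variation.
Context {R : realType}.
Implicit Types (a b c x e g sigma gam V : R) (f h phi r : R -> R).

Local Notation mu := (@lebesgue_measure R).

(** The square root lies below its tangents.  Being one-sided, this bound makes
    it unnecessary to differentiate the length integral under the integral
    sign: the energy has a polynomial upper bound that is sharp at 0. *)
Lemma sqrt_tangent a b : 0 < a -> 0 <= b ->
  Num.sqrt b <= Num.sqrt a + (b - a) / (2 * Num.sqrt a).
Proof.
move=> a0 b0; have sa : 0 < Num.sqrt a by rewrite sqrtr_gt0.
have ea : Num.sqrt a ^+ 2 = a by rewrite sqr_sqrtr // ltW.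
have eb : Num.sqrt b ^+ 2 = b by rewrite sqr_sqrtr.
have H (q : R) : 0 < q -> (q ^+ 2 + b) / (2 * q) = q + (b - q ^+ 2) / (2 * q).
  by move=> q0; field; rewrite gt_eqF.
have := H _ sa; rewrite ea => <-.
rewrite ler_pdivlMr; last by rewrite mulr_gt0.
by have := sqr_ge0 (Num.sqrt a - Num.sqrt b); nra.
Qed.

Lemma cc_smooth f a b : smooth1 f -> cc a b f.
Proof. by move=> sf; apply: cc_cont => x _; exact: smooth_cont. Qed.

Lemma cc_sin a b : cc a b (@sin R).
Proof. by apply: cc_cont => x _; exact: continuous_sin. Qed.

Lemma cc_cos a b : cc a b (@cos R).
Proof. by apply: cc_cont => x _; exact: continuous_cos. Qed.

Lemma cc_sqrt f a b : cc a b f -> cc a b (fun x => Num.sqrt (f x)).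
Proof.
move=> /ccP cf; apply/ccP => x xab.
by apply: (cvg_comp _ _ (cf x xab)); exact: sqrt_continuous.
Qed.

Definition area_sq r : R -> R := fun x => r x ^+ 2 + derive1 r x ^+ 2.

(** The competitors are r + e phi, rescaled by the factor s that restores the
    volume.  As phi vanishes at the ends, the wetting term only feels s. *)
Lemma equilibrium_scaled g sigma gam V r phi : equilibrium g sigma gam V r ->
  smooth1 phi -> phi 0 = 0 -> phi pi = 0 ->
  exists2 e0 : R, 0 < e0 & forall e s : R, `|e| < e0 -> 0 < s ->
   0 < itg 0 pi (fun x => (r x + e * phi x) ^+ 2) /\
   (s ^+ 2 * itg 0 pi (fun x => (r x + e * phi x) ^+ 2) = V ->
     droplet_energy g sigma gam r <=
     g / 3 * (s ^+ 3 * itg 0 pi (fun x => (r x + e * phi x) ^+ 3 * sin x)) +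
     sigma * (s * itg 0 pi (fun x => Num.sqrt ((r x + e * phi x) ^+ 2 +
       (derive1 r x + e * derive1 phi x) ^+ 2))) - gam * (s * (r 0 + r pi))).
Proof.
move=> [sr [C1r r0 Vr] rmin sym] sphi phi0 phipi.
have pi0 := @pi_gt0 R.
have cr := @cc_smooth _ 0 pi sr; have cphi := @cc_smooth _ 0 pi sphi.
have cr' := @cc_smooth _ 0 pi (smooth_derive1 sr).
have cphi' := @cc_smooth _ 0 pi (smooth_derive1 sphi).
have [m m0 Hm] := cc_pos cr r0; have [M M0 HM] := cc_bound cphi.
exists (m / M); first exact: divr_gt0.
move=> e s ee0 s0.
have pos x : 0 <= x <= pi -> 0 < r x + e * phi x.
  move=> xab; have h1 := Hm x xab; have h2 := HM x xab.
  have : `|e * phi x| < m.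
    rewrite normrM; move: ee0; rewrite ltr_pdivlMr // => ee0.
    by apply: le_lt_trans ee0; exact: ler_wpM2l.
  by rewrite ltr_norml => /andP[]; lra.
split.
  apply: itg_gt0 => //; first by cc_tac.
  by move=> x /andP[x0 xp]; rewrite exprn_gt0 // pos // !ltW.
move=> sV.
pose q x := s * (r x + e * phi x).
have dq x : der x q (s * (derive1 r x + e * derive1 phi x)).
  by apply: derZ; apply: derD; [exact: smooth_der|apply: derZ; exact: smooth_der].
have q'E : derive1 q = fun x => s * (derive1 r x + e * derive1 phi x).
  by apply/funext => x; exact: der_derive1.
have adm : admissible V q.
  split.
  - split; first by move=> x; exact: der_derivable (dq x).
    rewrite q'E => x; apply: cvgM; first exact: cvg_cst.
    apply: cvgD; first exact/smooth_cont/smooth_derive1.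
    by apply: cvgM; [exact: cvg_cst|exact/smooth_cont/smooth_derive1].
  - by move=> x xab; rewrite mulr_gt0 // pos.
  - rewrite -sV -itgZ; last by L1_tac.
    by apply: eq_itg => x _; rewrite /q exprMn.
have := rmin q adm; move=> /le_trans; apply.
rewrite /droplet_energy q'E.
rewrite le_eqVlt; apply/orP; left; apply/eqP.
rewrite /q phi0 phipi !mulr0 !addr0 -mulrDr.
congr (_ * _ + _ * _ - _).
- rewrite -itgZ; last by apply: ccL1; apply: ccM; [cc_tac|exact: cc_sin].
  by apply: eq_itg => x _; ring.
- rewrite -itgZ; last by apply: ccL1; apply: cc_sqrt; cc_tac.
  apply: eq_itg => x _.
  rewrite !exprMn -mulrDr sqrtrM ?sqr_ge0 // sqrtr_sqr gtr0_norm //.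
Qed.

(** The multiplier of the volume constraint, found by comparing with dilations
    of the profile. *)
Definition pressure g sigma gam V r : R :=
  (g * itg 0 pi (fun x => r x ^+ 3 * sin x) +
   sigma * itg 0 pi (fun x => Num.sqrt (area_sq r x)) - gam * (r 0 + r pi)) / V.

(** The upper bound P of the energy of the competitors is differentiable in e,
    is minimal at e = 0, and equals the energy there; so its derivative at 0
    vanishes. *)
Lemma first_variation g sigma gam V r phi : 0 < sigma -> 0 < V ->
  equilibrium g sigma gam V r ->
  smooth1 phi -> phi 0 = 0 -> phi pi = 0 ->
  g * itg 0 pi (fun x => r x ^+ 2 * phi x * sin x) +
  sigma * itg 0 pi (fun x => (r x * phi x + derive1 r x * derive1 phi x)
     / Num.sqrt (area_sq r x)) =
  pressure g sigma gam V r * itg 0 pi (fun x => r x * phi x).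
Proof.
move=> sig0 V0 eq sphi phi0 phipi.
have [e0 e00 H] := equilibrium_scaled eq sphi phi0 phipi.
case: eq => sr [C1r r0 Vr] rmin sym.
have pi0 := @pi_gt0 R.
have cr := @cc_smooth _ 0 pi sr; have cphi := @cc_smooth _ 0 pi sphi.
have cr' := @cc_smooth _ 0 pi (smooth_derive1 sr).
have cphi' := @cc_smooth _ 0 pi (smooth_derive1 sphi).
have csin : cc 0 pi (@sin R) by exact: cc_sin.
have D0 x : 0 <= x <= pi -> 0 < area_sq r x.
  by move=> xab; apply: ltr_wpDr; rewrite ?sqr_ge0 // exprn_gt0 // r0.
have cD : cc 0 pi (area_sq r) by rewrite /area_sq; cc_tac.
have csD := cc_sqrt cD.
have ciD : cc 0 pi (fun x => (Num.sqrt (area_sq r x))^-1).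
  by apply: ccV => // x /D0 xD; rewrite gt_eqF // sqrtr_gt0.
set I := fun f => itg 0 pi f.
pose a1 := I (fun x => r x * phi x); pose a2 := I (fun x => phi x ^+ 2).
pose G0 := I (fun x => r x ^+ 3 * sin x).
pose G1 := I (fun x => r x ^+ 2 * phi x * sin x).
pose G2 := I (fun x => r x * phi x ^+ 2 * sin x).
pose G3 := I (fun x => phi x ^+ 3 * sin x).
pose L0 := I (fun x => Num.sqrt (area_sq r x)).
pose L1' := I (fun x => (r x * phi x + derive1 r x * derive1 phi x)
     / Num.sqrt (area_sq r x)).
pose L2 := I (fun x => (phi x ^+ 2 + derive1 phi x ^+ 2)
     / (2 * Num.sqrt (area_sq r x))).
pose B := gam * (r 0 + r pi).
pose W e := V + 2 * e * a1 + e ^+ 2 * a2.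
have WE e : itg 0 pi (fun x => (r x + e * phi x) ^+ 2) = W e.
  rewrite /W -Vr /a1 /a2 /I /int0pi -/(itg 0 pi _).
  rewrite -itgZ; last by L1_tac.
  rewrite -itgZ; last by L1_tac.
  rewrite -itgD; [|by L1_tac|by L1_tac].
  rewrite -itgD; [|by L1_tac|by L1_tac].
  by apply: eq_itg => x _; ring.
have GE e : itg 0 pi (fun x => (r x + e * phi x) ^+ 3 * sin x) =
   G0 + 3 * e * G1 + 3 * e ^+ 2 * G2 + e ^+ 3 * G3.
  rewrite /G0 /G1 /G2 /G3 /I.
  rewrite -itgZ; last by L1_tac.
  rewrite -itgZ; last by L1_tac.
  rewrite -itgZ; last by L1_tac.
  rewrite -itgD; [|by L1_tac|by L1_tac].
  rewrite -itgD; [|by L1_tac|by L1_tac].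
  rewrite -itgD; [|by L1_tac|by L1_tac].
  by apply: eq_itg => x _; ring.
have LE e : itg 0 pi (fun x => Num.sqrt ((r x + e * phi x) ^+ 2 +
       (derive1 r x + e * derive1 phi x) ^+ 2)) <= L0 + e * L1' + e ^+ 2 * L2.
  have ci2 : cc 0 pi (fun x => (2 * Num.sqrt (area_sq r x))^-1).
    apply: ccV; last by cc_tac.
    by move=> x /D0 xD; rewrite gt_eqF // mulr_gt0 // sqrtr_gt0.
  rewrite /L0 /L1' /L2 /I.
  rewrite -itgZ; last by L1_tac.
  rewrite -itgZ; last by L1_tac.
  rewrite -itgD; [|by L1_tac|by L1_tac].
  rewrite -itgD; [|by L1_tac|by L1_tac].
  apply: le_itg; [by apply: ccL1; apply: cc_sqrt; cc_tac|by L1_tac|].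
  move=> x xab.
  apply: le_trans (sqrt_tangent (D0 x xab) _) _.
    by rewrite addr_ge0 // sqr_ge0.
  rewrite le_eqVlt; apply/orP; left; apply/eqP.
  have : Num.sqrt (area_sq r x) != 0 by rewrite gt_eqF // sqrtr_gt0 D0.
  set Q := Num.sqrt (area_sq r x); rewrite /area_sq => Q0; field.
  exact: Q0.
(* the scaling factor that restores the volume V *)
pose s e := Num.sqrt (V / W e).
pose P e := g / 3 * (s e ^+ 3 * (G0 + 3 * e * G1 + 3 * e ^+ 2 * G2 + e ^+ 3 * G3))
   + sigma * (s e * (L0 + e * L1' + e ^+ 2 * L2)) - gam * (s e * (r 0 + r pi)).
have W0 e : `|e| < e0 -> 0 < W e.
  by move=> ee; have [+ _] := H e 1 ee ltr01; rewrite WE.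
have W00 : W 0 = V by rewrite /W; ring.
have s00 : s 0 = 1 by rewrite /s W00 divff ?sqrtr1 // gt_eqF.
have s0 e : `|e| < e0 -> 0 < s e.
  by move=> ee; rewrite sqrtr_gt0 divr_gt0 // W0.
have Pmin e : `|e| < e0 -> P 0 <= P e.
  move=> ee; have [_ +] := H e (s e) ee (s0 e ee).
  rewrite WE sqr_sqrtr ?divr_ge0 ?(ltW V0) ?(ltW (W0 _ ee)) // divfK ?gt_eqF ?W0 //.
  move=> /(_ erefl) H1; apply: le_trans (_ : droplet_energy g sigma gam r <= _).
    have E0 : droplet_energy g sigma gam r =
        g / 3 * G0 + sigma * L0 - gam * (r 0 + r pi) by [].
    by rewrite /P s00 E0 le_eqVlt; apply/orP; left; apply/eqP; ring.
  apply: le_trans H1 _; rewrite GE lerD2r lerD2l ler_pM2l // ler_pM2l ?s0 //.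
have dW e : der e W (2 * a1 + 2 * e * a2).
  rewrite /W; apply: der_eq (derD (derD (der_cst e V) (derM (derZ 2 (der_id e)) (der_cst e a1)))
   (derM (derX 1 (der_id e)) (der_cst e a2))) _.
  by rewrite /=; ring.
have ne x : 0 < x -> x != 0 by move=> x0; rewrite gt_eqF.
pose ds e := (V * (- (2 * a1 + 2 * e * a2) / W e ^+ 2)) / (2 * s e).
have dse e : `|e| < e0 -> der e s (ds e).
  move=> ee; have We := W0 _ ee.
  apply: (@der_sqrt _ _ (fun e => V / W e)); first by rewrite divr_gt0.
  by apply: derZ; apply: derV; [exact: ne|exact: dW].
pose dP e := g / 3 * ((3 * s e ^+ 2 * ds e) *
      (G0 + 3 * e * G1 + 3 * e ^+ 2 * G2 + e ^+ 3 * G3) +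
    s e ^+ 3 * (3 * G1 + 6 * e * G2 + 3 * e ^+ 2 * G3))
  + sigma * (ds e * (L0 + e * L1' + e ^+ 2 * L2) + s e * (L1' + 2 * e * L2))
  - gam * (ds e * (r 0 + r pi)).
have dPe e : `|e| < e0 -> der e P (dP e).
  move=> ee; have d1 := dse e ee; have di := der_id e.
  have dG : der e (fun e => G0 + 3 * e * G1 + 3 * e ^+ 2 * G2 + e ^+ 3 * G3)
      (3 * G1 + 6 * e * G2 + 3 * e ^+ 2 * G3).
    apply: der_eq (derD (derD (derD (der_cst e G0) (derM (derZ 3 di) (der_cst e G1)))
      (derM (derZ 3 (derX 1 di)) (der_cst e G2)))
      (derM (derX 2 di) (der_cst e G3))) _.
    by rewrite /=; ring.
  have dL : der e (fun e => L0 + e * L1' + e ^+ 2 * L2) (L1' + 2 * e * L2).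
    apply: der_eq (derD (derD (der_cst e L0) (derM di (der_cst e L1')))
      (derM (derX 1 di) (der_cst e L2))) _.
    by rewrite /=; ring.
  apply: der_eq (derB (derD (derZ (g / 3) (derM (derX 2 d1) dG))
    (derZ sigma (derM d1 dL))) (derZ gam (derM d1 (der_cst e (r 0 + r pi))))) _.
  by rewrite /dP; ring.
have n0 : `|0 : R| < e0 by rewrite normr0.
have itvE t : t \in `]- e0, e0[ -> `|t| < e0 by rewrite in_itv /= -ltr_norml.
have d0 : der 0 P 0.
  apply: (@derive1_at_min _ _ (- e0) e0).
  - by lra.
  - by move=> t /itvE /dPe; exact: der_derivable.
  - by rewrite in_itv /= oppr_lt0 e00.
  - by move=> t /itvE; exact: Pmin.
have E : dP 0 = 0 by rewrite -(der_derive1 (dPe _ n0)); exact: der_derive1 d0.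
have ds0 : ds 0 = - a1 / V by rewrite /ds s00 W00; field; exact: ne.
rewrite /dP s00 ds0 in E.
change (g * G1 + sigma * L1' = (g * G0 + sigma * L0 - gam * (r 0 + r pi)) / V * a1).
apply/eqP; rewrite -subr_eq0 -[X in _ == X]E; apply/eqP; field; exact: ne.
Qed.

End first_variation.

(** * Functions equal almost everywhere *)
Section ae_integrals.
Context {R : realType}.
Implicit Types (a b c x e : R) (f h : R -> R).

Local Notation mu := (@lebesgue_measure R).

Lemma measurable_cc_dom f : measurable_fun `[0, pi] f -> measurable_fun (@dom0pi R) f.
Proof.
apply: measurable_funS; first exact: measurable_itv.
by move=> x; rewrite /dom0pi /= !in_itv /= => /andP[/ltW -> /ltW ->].
Qed.

Lemma integral_ae (f h : R -> \bar R) : measurable_fun dom0pi f ->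
  measurable_fun dom0pi h -> {ae mu, forall x, dom0pi x -> f x = h x} ->
  (\int[mu]_(x in dom0pi) f x = \int[mu]_(x in dom0pi) h x)%E.
Proof. by move=> mf mh fh; apply: ae_eq_integral => //; exact: measurable_itv. Qed.

Lemma itg_ae f h : measurable_fun dom0pi f -> measurable_fun dom0pi h ->
  {ae mu, forall x, dom0pi x -> f x = h x} -> itg 0 pi f = itg 0 pi h.
Proof.
move=> mf mh fh; rewrite /itg /Rintegral -!integral_dom0pi; last 2 first.
- exact/measurable_EFinP.
- exact/measurable_EFinP.
congr fine; apply: integral_ae; [exact/measurable_EFinP|exact/measurable_EFinP|].
by apply: ae_imp fh => x fhx /fhx ->.
Qed.

Lemma cc_ge0_itg0 a b f : a < b -> cc a b f ->
  (forall x, a <= x <= b -> 0 <= f x) -> itg a b f = 0 ->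
  forall x, a <= x <= b -> f x = 0.
Proof.
move=> ab cf f0 i0 x xab; apply/eqP; rewrite eq_le f0 // andbT leNgt.
apply/negP => fx.
have /ccP/(_ x xab) := cf; move=> /cvgrPdist_lt /(_ _ fx).
rewrite near_withinE => /nbhs_ballP[d /= d0 Hd].
pose lo := Num.max a (x - d / 2); pose hi := Num.min b (x + d / 2).
have /andP[ax xb] := xab.
have lohi : lo < hi.
  by rewrite /lo /hi gt_max !lt_min; apply/andP; split; apply/andP; split; lra.
have alo : a <= lo by rewrite le_max lexx.
have hib : hi <= b by rewrite ge_min lexx.
have lox : x - d / 2 <= lo by rewrite le_max lexx orbT.
have hix : hi <= x + d / 2 by rewrite ge_min lexx orbT.
have : 0 < itg lo hi f.
  apply: itg_gt0 => //; first exact: ccS cf.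
  move=> t /andP[lot thi]; have := Hd t.
  rewrite /ball /= ltr_norml => /(_ _ _).
  have -> : - d < x - t < d by apply/andP; split; lra.
  move=> /(_ isT); rewrite in_itv /= => /(_ _)H.
  have {}H : `|f x - f t| < f x by apply: H; apply/andP; split; lra.
  by move: H; rewrite ltr_norml => /andP[]; lra.
have := @itg_le_sub R a b lo hi f.
by move=> /(_ alo (ltW lohi) hib (ccL1 cf) f0); rewrite i0 => h1 h2; lra.
Qed.

Lemma cc_ae_zero f : cc 0 pi f -> {ae mu, forall x, dom0pi x -> f x = 0} ->
  forall x, 0 <= x <= pi -> f x = 0.
Proof.
move=> cf f0 x xab; have c2 : cc 0 pi (fun x => f x ^+ 2) by cc_tac.
apply/eqP; rewrite -sqrf_eq0; apply/eqP.
apply: (cc_ge0_itg0 (pi_gt0 R) c2) xab; first by move=> t _; exact: sqr_ge0.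
rewrite -[RHS](@itg_zero _ 0 pi (fun=> 0)) //; apply: itg_ae.
- apply: measurable_cc_dom; exact: cc_measurable.
- exact: measurable_cst.
- by apply: ae_imp f0 => t H /H ->; rewrite expr0n.
Qed.

End ae_integrals.

(** * Square-integrable functions *)
Section square_integrable.
Context {R : realType}.
Implicit Types (a b c x e k : R) (f h v dv : R -> R).

(** The first condition carries the measurability of f. *)
Definition sqint a b f : Prop := L1 a b f /\ L1 a b (fun x => f x ^+ 2).

Lemma sqint_cc a b f : cc a b f -> sqint a b f.
Proof. by move=> cf; split; apply: ccL1 => //; cc_tac. Qed.

Lemma sqintS a b c d f : a <= c -> d <= b -> sqint a b f -> sqint c d f.
Proof. by move=> ac db [h1 h2]; split; [exact: L1S h1|exact: L1S h2]. Qed.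

Lemma sqint_L1M a b f h : sqint a b f -> sqint a b h ->
  L1 a b (fun x => f x * h x).
Proof.
move=> [If If2] [Ih Ih2].
apply: (@L1_le _ _ _ _ (fun x => f x ^+ 2 + h x ^+ 2)).
- by apply: measurable_funM; exact: L1_measurable.
- exact: L1D.
- move=> x _; rewrite [leRHS]ger0_norm ?addr_ge0 ?sqr_ge0 // ler_norml.
  by apply/andP; split; nra.
Qed.

Lemma sqintD a b f h : sqint a b f -> sqint a b h ->
  sqint a b (fun x => f x + h x).
Proof.
move=> sf sh; have [If If2] := sf; have [Ih Ih2] := sh.
have Ifh := sqint_L1M sf sh.
split; first exact: L1D.
apply: L1_eq (L1D (L1D If2 (L1Z 2 Ifh)) Ih2) => x _; ring.
Qed.

Lemma sqint_ccM a b f h : cc a b f -> sqint a b h ->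
  sqint a b (fun x => f x * h x).
Proof.
move=> cf [Ih Ih2]; split; first exact: ccL1M.
have c2 : cc a b (fun x => f x ^+ 2) by cc_tac.
by apply: L1_eq (ccL1M c2 Ih2) => x _; rewrite exprMn.
Qed.

Lemma sqintZ a b k h : sqint a b h -> sqint a b (fun x => k * h x).
Proof. exact/sqint_ccM/cc_cst. Qed.

Lemma sqintB a b f h : sqint a b f -> sqint a b h ->
  sqint a b (fun x => f x - h x).
Proof.
move=> sf sh; have [h1 h2] := sqintD sf (sqintZ (-1) sh).
by split; [apply: L1_eq h1|apply: L1_eq h2] => x _; rewrite mulN1r.
Qed.

Lemma cauchy_schwarz a b f h : sqint a b f -> sqint a b h ->
  itg a b (fun x => f x * h x) ^+ 2 <=
  itg a b (fun x => f x ^+ 2) * itg a b (fun x => h x ^+ 2).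
Proof.
move=> sf sh; have [If If2] := sf; have [Ih Ih2] := sh.
have Ifh := sqint_L1M sf sh.
set F := itg a b (fun x => f x ^+ 2); set H := itg a b (fun x => h x ^+ 2).
set P := itg a b (fun x => f x * h x).
have pos t : 0 <= F - 2 * t * P + t ^+ 2 * H.
  rewrite /F /P /H -itgZ // -itgB //; last exact: L1Z.
  rewrite -itgZ // -itgD; [|by apply: L1B => //; exact: L1Z|exact: L1Z].
  apply: itg_ge0 => x _.
  have -> : f x ^+ 2 - 2 * t * (f x * h x) + t ^+ 2 * h x ^+ 2 = (f x - t * h x) ^+ 2.
    by ring.
  exact: sqr_ge0.
have H0 : 0 <= H by apply: itg_ge0 => x _; exact: sqr_ge0.
have F0 : 0 <= F by apply: itg_ge0 => x _; exact: sqr_ge0.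
move: H0; rewrite le_eqVlt => /predU1P[HE|H0].
  rewrite -HE mulr0 in pos *.
  have [->|P0] := eqVneq P 0; first by rewrite expr0n.
  have := pos ((F + 1) / (2 * P)); rewrite mulr0 addr0.
  have -> : 2 * ((F + 1) / (2 * P)) * P = F + 1 by field.
  by lra.
have := pos (P / H).
have -> : F - 2 * (P / H) * P + (P / H) ^+ 2 * H = F - P ^+ 2 / H.
  by field; rewrite gt_eqF.
by rewrite subr_ge0 ler_pdivrMr.
Qed.

(** Absolute continuity of the integral at the middle c of [0, pi]: the
    contribution of a small symmetric interval around c is negligible. *)
Lemma itg_small f c x1 e : 0 < c -> c < pi -> c = pi - c -> L1 0 pi f -> x1 < c -> 0 < e ->
  exists x, [/\ 0 <= x, x1 <= x, x < c & itg x (pi - x) f <= e].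
Proof.
move=> c0 cpi cc If x1c e0.
have A := abscont_prim If; set F := (fun x => itg 0 x f) in A.
have /ccP cF := abscont_cc A.
have cin : 0 <= c <= pi by rewrite !ltW.
have e20 : 0 < e / 2 by rewrite divr_gt0.
have := cF c cin; move=> /cvgrPdist_lt /(_ _ e20).
rewrite near_withinE => /nbhs_ballP[d /= d0 Hd].
pose x := Num.max (Num.max 0 x1) (c - d / 2).
have xc : x < c by rewrite /x !gt_max c0 x1c /=; lra.
have x0 : 0 <= x by rewrite /x !le_max lexx.
have x1x : x1 <= x by rewrite /x !le_max lexx orbT.
have xd : c - d / 2 <= x by rewrite /x le_max lexx orbT.
exists x; split => //.
have near t : x <= t -> t <= pi - x -> `|F c - F t| < e / 2.
  move=> xt tx; apply: Hd; last by rewrite in_itv /=; apply/andP; split; lra.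
  by rewrite /ball /= ltr_norml; apply/andP; split; lra.
rewrite (A.2 x (pi - x)) //; [|lra|lra].
have := near x (lexx _); have := near (pi - x).
have h1 : x <= pi - x by lra.
move=> /(_ h1 (lexx _)) h2 /(_ h1) h3.
move: h2 h3; rewrite !ltr_norml => /andP[? ?] /andP[? ?]; lra.
Qed.

End square_integrable.

(** * Coercivity of the form *)
Section arithmetic.
Context {R : realType}.

Lemma norm_opp_le (a b : R) : `|a| <= b -> - a <= b.
Proof. by rewrite ler_norml => /andP[]; lra. Qed.

(** The bookkeeping of [form_lower]: the identities on the two outer intervals
    are added to crude bounds on the middle one, where Q, m0 and the p_i are the
    form, the integral of w / z^2 and the constraint. *)
Lemma square_sum_arith (Q Q1 Q2 Q3 m0 w1 w2 w3 p1 p2 p3 s1 s2 t1 t2 k l EL ER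
    aq av d1 d2 C e : R) :
  Q = Q1 + Q2 + Q3 -> m0 = w1 + w2 + w3 -> p1 + p2 + p3 = 0 ->
  Q1 = s1 - 2 * k * p1 + k ^+ 2 * l * w1 - EL ->
  Q3 = s2 - 2 * k * p3 + k ^+ 2 * l * w3 - (- ER) ->
  aq + av + (k ^+ 2 * l * w2 + C * (d1 + d2)) <= e ->
  - Q2 <= aq -> - (2 * k * p2) <= av ->
  EL <= C * d1 -> - ER <= C * d2 -> t1 <= s1 -> t2 <= s2 ->
  t1 + t2 + k ^+ 2 * l * m0 <= Q + e.
Proof.
move=> -> -> p0 -> -> h1 h2 h3 h4 h5 h6 h7.
have {}p0 : 2 * k * p1 + 2 * k * p2 + 2 * k * p3 = 0 by rewrite -!mulrDr p0 mulr0.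
rewrite mulrDr in h1; lra.
Qed.

Lemma odd_cube_le0 (t f : R) : t <= 0 -> t ^+ 3 * f ^+ 2 <= 0.
Proof.
move=> t0; rewrite exprS -mulrA; apply: mulr_le0_ge0 => //.
by rewrite mulr_ge0 ?sqr_ge0.
Qed.

Lemma odd_cube_ge0 (t f : R) : 0 <= t -> 0 <= t ^+ 3 * f ^+ 2.
Proof. by move=> t0; rewrite mulr_ge0 ?sqr_ge0 // exprn_ge0. Qed.

Lemma sqrD_le (a b : R) : (a + b) ^+ 2 <= 2 * a ^+ 2 + 2 * b ^+ 2.
Proof. by have := sqr_ge0 (a - b); nra. Qed.

Lemma sqrD3_le (a b c : R) : (a + b + c) ^+ 2 <= 3 * (a ^+ 2 + b ^+ 2 + c ^+ 2).
Proof.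
have := sqr_ge0 (a - b); have := sqr_ge0 (b - c); have := sqr_ge0 (a - c).
by nra.
Qed.

Lemma four_parts_le (a1 a2 b1 b2 m e P T : R) :
  a2 + b2 <= m -> m <= e -> a1 + b1 <= P -> 0 <= T ->
  a1 + a2 + (b2 + b1) <= P + T + e.
Proof. lra. Qed.

(** A linear system of determinant proportional to n1 + n2 > 0, solved with
    bounds. *)
Lemma two_coefficients (al be h n1 n2 d1 d2 Q C1 C2 : R) :
  0 < h -> 0 < n1 -> 0 < n2 -> (al - be) * h = d1 -> al * n1 + be * n2 = d2 ->
  d1 ^+ 2 <= C1 * Q -> d2 ^+ 2 <= C2 * Q ->
  al ^+ 2 <= 2 * ((n2 / h) ^+ 2 * C1 + C2) / (n1 + n2) ^+ 2 * Q /\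
  be ^+ 2 <= 2 * ((n1 / h) ^+ 2 * C1 + C2) / (n1 + n2) ^+ 2 * Q.
Proof.
move=> h0 n10 n20 E1 E2 H1 H2.
have N0 : 0 < n1 + n2 by rewrite addr_gt0.
have solve (x p q m : R) : x * (n1 + n2) = q + m * p / h -> p ^+ 2 <= C1 * Q ->
    q ^+ 2 <= C2 * Q -> x ^+ 2 <= 2 * ((m / h) ^+ 2 * C1 + C2) / (n1 + n2) ^+ 2 * Q.
  move=> E h1 h2; rewrite mulrAC ler_pdivlMr ?exprn_gt0 // -exprMn E.
  apply: le_trans (sqrD_le _ _) _.
  have -> : (m * p / h) ^+ 2 = (m / h) ^+ 2 * p ^+ 2 by field; rewrite gt_eqF.
  have := ler_wpM2l (sqr_ge0 (m / h)) h1; nra.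
split.
  apply: (@solve _ d1 d2) => //; rewrite -E1 -E2; field; by rewrite gt_eqF.
apply: (@solve _ (- d1) d2) => //; last by rewrite sqrrN.
by rewrite -E1 -E2; field; rewrite gt_eqF.
Qed.

Lemma two_pieces_eq (al be k v1 v2 m1 m2 n1 n2 : R) : v1 + v2 = 0 ->
  al * n1 + be * n2 = - (k * (m1 + m2) + (v1 - k * m1 - al * n1 + (v2 - k * m2 - be * n2))).
Proof. by move=> h; rewrite -[LHS]subr0 -h; ring. Qed.

Lemma coefficient_arith (k m1 p q W eL eR C Q : R) : 0 <= W ->
  p ^+ 2 <= W * eL -> q ^+ 2 <= W * eR -> eL + eR <= C * Q -> k ^+ 2 <= C * Q ->
  (k * m1 + (p + q)) ^+ 2 <= (2 * m1 ^+ 2 * C + 4 * W * C) * Q.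
Proof.
move=> W0 hp hq hr hk; apply: le_trans (sqrD_le _ _) _.
have h1 := ler_wpM2l (sqr_ge0 m1) hk.
have h2 := ler_wpM2l W0 hr.
have h3 := sqrD_le p q.
rewrite mulrDr in h2; rewrite exprMn; lra.
Qed.

Lemma poincare_arith (iL iR eL eR k mz nv al be C Ca Cb Q : R) :
  iL <= 3 * (eL + k ^+ 2 * mz + al ^+ 2 * nv) ->
  iR <= 3 * (eR + k ^+ 2 * mz + be ^+ 2 * nv) -> eL + eR <= C * Q ->
  k ^+ 2 <= C * Q -> al ^+ 2 <= Ca * Q -> be ^+ 2 <= Cb * Q -> 0 <= mz -> 0 <= nv ->
  iL + iR <= 3 * (C + 2 * C * mz + Ca * nv + Cb * nv) * Q.
Proof.
move=> hL hR he hk ha hb mz0 nv0.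
have h1 := ler_wpM2r mz0 hk; have h2 := ler_wpM2r nv0 ha; have h3 := ler_wpM2r nv0 hb.
lra.
Qed.

Lemma gradient_arith (Am M C Q iv dv : R) : 0 < Am -> 0 < M ->
  Am * dv - M * iv <= Q -> iv <= C * Q ->
  iv + dv <= (C + (1 + M * C) / Am) * Q.
Proof.
move=> Am0 M0 h1 h2.
have h3 : dv <= (1 + M * C) / Am * Q.
  rewrite mulrAC ler_pdivlMr //; have := ler_wpM2l (ltW M0) h2; lra.
lra.
Qed.

Lemma sobolev_arith (a b M N v2 d2 : R) :
  a <= M * v2 -> b <= 2 * M * d2 + 2 * N * v2 -> 0 <= M * d2 -> 0 <= M * v2 ->
  0 <= N * d2 -> a + b <= (v2 + d2) * (M + 2 * M + 2 * N).
Proof. lra. Qed.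

End arithmetic.

(** The section is abstract: it uses the functions A, w = r^2, y, z and vs only
    through the equations that relate them and the signs of z and y.  They are
    differentiable, but no second derivative of the profile appears. *)
Section coercivity.
Context {R : realType}.
Implicit Types (a b x t k : R) (v dv f : R -> R).
Variables (g lam : R) (A w y z vs : R -> R).
Let c : R := pi / 2.
Hypotheses (lam0 : 0 < lam) (cA : cc 0 pi A) (cw : cc 0 pi w).
Hypothesis A0 : forall x, 0 <= x <= pi -> 0 < A x.
Hypothesis w0 : forall x, 0 <= x <= pi -> 0 < w x.
Hypothesis dy : forall x, 0 <= x <= pi -> der x y (w x * vs x).
Hypothesis dvs : forall x, 0 <= x <= pi -> der x vs (- (z x * y x / A x)).
Hypothesis zE : forall x, z x = lam - g * y x.
Hypothesis z0 : forall x, 0 <= x <= pi -> 0 < z x.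
Hypotheses (y_0 : y 0 = 0) (y_pi : y pi = 0).
Hypothesis y0 : forall x, 0 < x < pi -> 0 < y x.
Hypothesis vsc : vs c = 0.

Let pi0 : 0 < (pi : R) := pi_gt0 R.
Let c0 : 0 < c. Proof. by rewrite divr_gt0. Qed.
Let cpi : c < pi. Proof. by rewrite /c; have := pi0; lra. Qed.
Let cE : pi - c = c. Proof. by rewrite /c; lra. Qed.

Let ne x : 0 < x -> x != 0. Proof. by move=> x0; rewrite gt_eqF. Qed.

Let y_ge0 x : 0 <= x <= pi -> 0 <= y x.
Proof.
move=> /andP[]; rewrite le_eqVlt => /predU1P[<-|x0]; first by rewrite y_0.
rewrite le_eqVlt => /predU1P[->|xp]; first by rewrite y_pi.
by apply/ltW/y0/andP.
Qed.

Let dz x : 0 <= x <= pi -> der x z (- (g * (w x * vs x))).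
Proof.
move=> xab; rewrite (_ : z = fun x => lam - g * y x); last exact/funext.
apply: der_eq (derB (der_cst x lam) (derZ g (dy xab))) _.
by rewrite sub0r.
Qed.

Let cy : cc 0 pi y. Proof. by apply: cc_cont => x xab; exact: der_cont (dy xab). Qed.
Let cz : cc 0 pi z. Proof. by apply: cc_cont => x xab; exact: der_cont (dz xab). Qed.
Let cvs : cc 0 pi vs. Proof. by apply: cc_cont => x xab; exact: der_cont (dvs xab). Qed.
Let ciA : cc 0 pi (fun x => (A x)^-1).
Proof. by apply: ccV => // x /A0 /ne. Qed.
Let ciz : cc 0 pi (fun x => (z x)^-1).
Proof. by apply: ccV => // x /z0 /ne. Qed.

(** The slope of - vs, which is positive inside (0, pi). *)
Let B x := z x * y x / A x.
Let cB : cc 0 pi B. Proof. by rewrite /B; cc_tac. Qed.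
Let B_ge0 x : 0 <= x <= pi -> 0 <= B x.
Proof.
move=> xab; rewrite /B mulr_ge0 ?invr_ge0 ?(ltW (A0 xab)) //.
by rewrite mulr_ge0 ?y_ge0 // ltW // z0.
Qed.
Let vsE a b : 0 <= a -> a <= b -> b <= pi -> vs a - vs b = itg a b B.
Proof.
move=> a0 ab bpi.
have ac : abscont 0 pi vs (fun x => - B x).
  by apply: abscont_C1 => //; apply: ccN.
have := ac.2 a b a0 ab bpi; rewrite itgN; last by apply: (@L1S _ 0 pi); [lra|lra|exact: ccL1].
by move=> E; lra.
Qed.

(** As B is positive on a neighbourhood of c, vs is comparable to the distance
    to its zero c on the whole interval. *)
Let shift_bounds : exists K kap : R, [/\ 0 < K, 0 < kap &
  forall x, 0 <= x <= pi ->
    kap * `|x - c| <= `|vs x| /\ `|vs x| <= K * `|x - c|].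
Proof.
have [K K0 HK] := cc_bound cB.
have [||m m0 Hm] := @cc_pos _ (pi / 4) (pi - pi / 4) B.
- by apply: ccS cB; have := pi0; lra.
- move=> x /andP[x1 x2]; have xx : 0 < x < pi by apply/andP; split; have := pi0; lra.
  have xx' : 0 <= x <= pi by have /andP[? ?] := xx; apply/andP; split; lra.
  by rewrite /B divr_gt0 ?A0 // mulr_gt0 ?y0 // z0.
have cE' : c = pi / 2 by [].
have sub a b : 0 <= a -> b <= pi -> L1 a b B.
  by move=> a0 bpi; apply: L1S (ccL1 cB).
have up a b : 0 <= a -> a <= b -> b <= pi -> itg a b B <= K * (b - a).
  move=> a0 ab bpi; rewrite -itg_cst //; apply: le_itg => //.
  - exact: sub.
  - exact/ccL1/cc_cst.
  - move=> x /andP[ax xb]; apply: le_trans (ler_norm _) (HK _ _).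
    by apply/andP; split; lra.
have lo a b : pi / 4 <= a -> a <= b -> b <= pi - pi / 4 -> m * (b - a) <= itg a b B.
  move=> a0 ab bpi; rewrite -itg_cst //; apply: le_itg => //.
  - exact/ccL1/cc_cst.
  - by apply: sub; have := pi0; lra.
  - by move=> x /andP[ax xb]; apply: Hm; apply/andP; split; lra.
have mono a b a' b' : 0 <= a -> a <= a' -> a' <= b' -> b' <= b -> b <= pi ->
    itg a' b' B <= itg a b B.
  move=> a0 aa ab bb bpi; apply: itg_le_sub => //; first exact: sub.
  by move=> x /andP[ax xb]; apply: B_ge0; apply/andP; split; lra.
have pos a b : 0 <= a -> b <= pi -> 0 <= itg a b B.
  move=> a0 bpi; apply: itg_ge0 => x /andP[ax xb].
  by apply: B_ge0; apply/andP; split; lra.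
exists K, (m / 2); split => //; first by rewrite divr_gt0.
have P := pi0.
move=> x /andP[x0 xpi]; have [xc|cx] := leP x c.
  have := vsE x0 xc (ltW cpi); rewrite vsc subr0 => ->.
  rewrite [`|itg _ _ _|]ger0_norm; last by apply: pos => //; exact: ltW.
  rewrite [`|x - c|]ler0_norm ?subr_le0 // opprB; split; last exact/up/ltW.
  have [x4|x4] := leP (pi / 4) x.
    apply: le_trans (_ : _ <= m * (c - x)) _; last by apply: lo => //; rewrite /c; lra.
    by apply: ler_wpM2r; lra.
  apply: le_trans (_ : _ <= itg (pi / 4) c B) _; last first.
    by apply: mono; rewrite ?/c; lra.
  apply: le_trans (_ : _ <= m * (c - pi / 4)) _; last by apply: lo; rewrite ?/c; lra.
  rewrite -mulrA ler_pM2l // /c; lra.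
have := vsE (ltW c0) (ltW cx) xpi; rewrite vsc sub0r => E.
rewrite -(normrN (vs x)) E.
rewrite [`|itg _ _ _|]ger0_norm; last by apply: pos => //; exact: ltW.
rewrite [`|x - c|]ger0_norm ?subr_ge0 ?(ltW cx) //; split; last exact: up (ltW c0) (ltW cx) xpi.
have [x4|x4] := leP x (pi - pi / 4).
  apply: le_trans (_ : _ <= m * (x - c)) _; last by apply: lo => //; [rewrite /c; lra|exact: ltW].
  by apply: ler_wpM2r; lra.
apply: le_trans (_ : _ <= itg c (pi - pi / 4) B) _; last first.
  by apply: mono; rewrite ?/c; lra.
apply: le_trans (_ : _ <= m * ((pi - pi / 4) - c)) _; last by apply: lo; rewrite ?/c; lra.
rewrite -mulrA ler_pM2l // /c; lra.
Qed.

Let vs_gt0 x : 0 <= x < c -> 0 < vs x.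
Proof.
move=> /andP[x0 xc]; have := vsE x0 (ltW xc) (ltW cpi); rewrite vsc subr0 => ->.
apply: itg_gt0 => //; first by apply: ccS cB => //; exact: ltW.
move=> t /andP[xt tc]; have tt : 0 < t < pi by have P := cpi; apply/andP; split; lra.
have tt' : 0 <= t <= pi by have /andP[? ?] := tt; apply/andP; split; lra.
by rewrite /B divr_gt0 ?A0 // mulr_gt0 ?y0 // z0.
Qed.

Let vs_lt0 x : c < x <= pi -> vs x < 0.
Proof.
move=> /andP[cx xpi]; have := vsE (ltW c0) (ltW cx) xpi; rewrite vsc sub0r => E.
suff : 0 < itg c x B by lra.
apply: itg_gt0 => //; first by apply: ccS cB => //; exact: ltW.
move=> t /andP[xt tc]; have tt : 0 < t < pi by have P := c0; apply/andP; split; lra.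
have tt' : 0 <= t <= pi by have /andP[? ?] := tt; apply/andP; split; lra.
by rewrite /B divr_gt0 ?A0 // mulr_gt0 ?y0 // z0.
Qed.

(** The second variation in the variable v = f / r. *)
Definition qform v dv x := A x * dv x ^+ 2 + (g * y x - z x) * w x * v x ^+ 2.
(** For k = z c * v c, the function U vanishes at the zero c of vs; the square
    of sq replaces A v'^2, and E is the boundary term. *)
Let U k v x := z x * v x - k.
Let sq k v dv x := A x * dv x + y x * U k v x / vs x.
Let E k v x := y x / (vs x * z x) * U k v x ^+ 2.

Let abscont_U a b k v dv : 0 <= a -> b <= pi -> abscont a b v dv ->
  abscont a b (U k v) (fun x => - (g * (w x * vs x)) * v x + z x * dv x).
Proof.
move=> a0 bpi av.
have az : abscont a b z (fun x => - (g * (w x * vs x))).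
  apply: (@abscontS _ 0 pi) => //; apply: abscont_C1 => //; cc_tac.
by apply: abscont_eq (abscontB (abscontM az av) (abscont_cst a b k)) => // x _;
  rewrite subr0.
Qed.

(** Pointwise, the integrands on the two sides differ by the derivative of E:
    with p = y / (vs z), this derivative is p' U^2 + 2 p U U', and
    p' = lam w / z^2 + y^2 / (A vs^2) by the equations for y, vs and z. *)
Let square_identity a b k v dv : 0 <= a -> a <= b -> b <= pi ->
  (forall x, a <= x <= b -> vs x != 0) -> abscont a b v dv -> sqint a b dv ->
  itg a b (qform v dv) = itg a b (fun x => sq k v dv x ^+ 2 / A x)
    - 2 * k * itg a b (fun x => w x * v x)
    + k ^+ 2 * lam * itg a b (fun x => w x / z x ^+ 2) - (E k v b - E k v a).
Proof.
move=> a0 ab bpi vs0 av sdv.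
have sub x : a <= x <= b -> 0 <= x <= pi by move=> /andP[? ?]; apply/andP; split; lra.
have res f : cc 0 pi f -> cc a b f by apply: ccS.
have cA' := res _ cA; have ciA' := res _ ciA; have cw' := res _ cw.
have cy' := res _ cy; have cz' := res _ cz; have ciz' := res _ ciz.
have cvs' := res _ cvs.
have civs' : cc a b (fun x => (vs x)^-1) by apply: ccV.
have cv := abscont_cc av; have aU := abscont_U k a0 bpi av; have cU := abscont_cc aU.
have [Idv Idv2] := sdv.
pose p x := y x / (vs x * z x).
pose dp x := lam * w x / z x ^+ 2 + y x ^+ 2 / (A x * vs x ^+ 2).
have ciz2' : cc a b (fun x => (z x ^+ 2)^-1).
  by apply: ccV => [x /sub /z0 zx|]; [rewrite expf_neq0 // gt_eqF|cc_tac].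
have civz' : cc a b (fun x => (vs x * z x)^-1).
  apply: ccV; last by cc_tac.
  by move=> x xab; rewrite mulf_neq0 ?vs0 // gt_eqF // z0 // sub.
have ciAv' : cc a b (fun x => (A x * vs x ^+ 2)^-1).
  apply: ccV; last by cc_tac.
  by move=> x xab; rewrite mulf_neq0 ?expf_neq0 ?vs0 // gt_eqF // A0 // sub.
have ap : abscont a b p dp.
  apply: abscont_C1; first by rewrite /dp; cc_tac.
  move=> x xab; have vx := vs0 _ xab; have xx := sub _ xab.
  have zx := ne (z0 xx); have Ax := ne (A0 xx).
  have dn : vs x * z x != 0 by rewrite mulf_neq0.
  apply: der_eq (derM (dy xx) (@derV _ x (fun t => vs t * z t) _ dn
    (derM (dvs xx) (dz xx)))) _.
  rewrite /dp (_ : lam = z x + g * y x); last by rewrite zE; ring.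
  by field; rewrite vx zx Ax.
have aE := abscontM ap (abscontM aU aU).
have sU : sqint a b (U k v) by exact: sqint_cc.
have ssq : sqint a b (sq k v dv).
  apply: sqintD; first exact: sqint_ccM.
  by apply: sqint_cc; cc_tac.
have Isq : L1 a b (fun x => sq k v dv x ^+ 2 / A x).
  by apply: L1_eq (ccL1M ciA' ssq.2) => x _; rewrite mulrC.
have Iwv : L1 a b (fun x => w x * v x) by L1_tac.
have Iwz : L1 a b (fun x => w x / z x ^+ 2) by L1_tac.
have -> : E k v b - E k v a = p b * (U k v b * U k v b) - p a * (U k v a * U k v a).
  by rewrite /E /p; ring.
rewrite -(abscont_itg ab aE).
rewrite -itgZ // -itgZ // -itgB //; last exact: L1Z.
rewrite -itgD; [|by apply: L1B => //; exact: L1Z|exact: L1Z].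
rewrite -itgB; [|by apply: L1D; [apply: L1B => //|]; exact: L1Z|exact: aE.1].
apply: eq_itg => x xab; have vx := vs0 _ xab; have xx := sub _ xab.
have zx := ne (z0 xx); have Ax := ne (A0 xx).
rewrite /qform /dp /p /sq /U (_ : lam = z x + g * y x); last by rewrite zE; ring.
by field; rewrite vx zx Ax.
Qed.

(** The function f = (v - k / z) / vs - al satisfies
    f' = sq / (A vs) - k g w / z^2.  Hardy's inequality with the weight
    (x - c)^2, obtained from the derivative of (x - c)^3 f^2, bounds
    (x - c) f, hence vs f, by (x - c)^2 f', and the weight compensates the
    zero of vs in the denominator.  The hypothesis on the boundary values says
    that the total boundary term of that integration by parts has the right
    sign. *)
Let hardy : exists2 C : R, 0 < C & forall a b k al v dv,
  0 <= a -> a <= b -> b <= pi ->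
  (forall x, a <= x <= b -> vs x != 0) -> abscont a b v dv -> sqint a b dv ->
  (b - c) ^+ 3 * ((v b - k / z b) / vs b - al) ^+ 2 -
  (a - c) ^+ 3 * ((v a - k / z a) / vs a - al) ^+ 2 <= 0 ->
  itg a b (fun x => (v x - k / z x - al * vs x) ^+ 2) <=
  C * (itg a b (fun x => sq k v dv x ^+ 2 / A x) + k ^+ 2).
Proof.
have [K [kap [K0 kap0 Hvs]]] := shift_bounds.
have [Am Am0 HAm] := cc_pos cA A0.
have [C2 C20 HC2] : exists2 M : R, 0 < M & forall t, 0 <= t <= pi ->
    `|2 * (t - c) ^+ 4 * g ^+ 2 * (w t / z t ^+ 2) ^+ 2| <= M.
  have ciz2 : cc 0 pi (fun x => (z x ^+ 2)^-1).
    by apply: ccV => [x /z0 zx|]; [rewrite expf_neq0 // gt_eqF|cc_tac].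
  have cid : cc 0 pi (fun x : R => x).
    by apply: cc_cont => x _; exact: (der_cont (der_id x)).
  by apply: cc_bound; cc_tac.
pose C1 : R := 2 * pi ^+ 2 / (kap ^+ 2 * Am).
have C10 : 0 < C1 by rewrite divr_gt0 ?mulr_gt0 ?exprn_gt0.
exists (K ^+ 2 * (4 / 9) * (C1 + C2 * pi)).
  have h49 : (0 : R) < 4 / 9 by lra.
  have K2 : 0 < K ^+ 2 by exact: exprn_gt0.
  have Cp : 0 < C1 + C2 * pi by rewrite addr_gt0 // mulr_gt0.
  by rewrite mulr_gt0 // mulr_gt0.
move=> a b k al v dv a0 ab bpi vs0 av sdv bd.
have sub x : a <= x <= b -> 0 <= x <= pi by move=> /andP[? ?]; apply/andP; split; lra.
have res f : cc 0 pi f -> cc a b f by apply: ccS.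
have cA' := res _ cA; have ciA' := res _ ciA; have cw' := res _ cw.
have cy' := res _ cy; have cz' := res _ cz; have ciz' := res _ ciz.
have cvs' := res _ cvs.
have civs' : cc a b (fun x => (vs x)^-1) by apply: ccV.
have cv := abscont_cc av; have aU := abscont_U k a0 bpi av; have cU := abscont_cc aU.
have [Idv Idv2] := sdv.
have cid : cc a b (fun x : R => x).
  by apply: cc_cont => x _; exact: (der_cont (der_id x)).
have ciz2' : cc a b (fun x => (z x ^+ 2)^-1).
  by apply: ccV => [x /sub /z0 zx|]; [rewrite expf_neq0 // gt_eqF|cc_tac].
have civ2' : cc a b (fun x => (vs x ^+ 2)^-1).
  by apply: ccV => [x xab|]; [rewrite expf_neq0 // vs0|cc_tac].
pose f x := (v x - k / z x) / vs x - al.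
pose df x := sq k v dv x / (A x * vs x) - k * (g * (w x / z x ^+ 2)).
have ssq : sqint a b (sq k v dv).
  apply: sqintD; first exact: sqint_ccM.
  by apply: sqint_cc; cc_tac.
have Isq : L1 a b (fun x => sq k v dv x ^+ 2 / A x).
  by apply: L1_eq (ccL1M ciA' ssq.2) => x _; rewrite mulrC.
have af : abscont a b f df.
  have a1 : abscont a b (fun x => (z x)^-1) (fun x => g * (w x * vs x) / z x ^+ 2).
    apply: abscont_C1; first by cc_tac.
    move=> x xab; have zx := ne (z0 (sub _ xab)).
    by apply: der_eq (derV zx (dz (sub _ xab))) _; rewrite opprK.
  have a2 : abscont a b (fun x => (vs x)^-1) (fun x => (z x * y x / A x) / vs x ^+ 2).
    apply: abscont_C1; first by cc_tac.
    move=> x xab.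
    by apply: der_eq (derV (vs0 _ xab) (dvs (sub _ xab))) _; rewrite opprK.
  apply: abscont_eq (abscontB (abscontM (abscontB av (abscontZ k a1)) a2)
    (abscont_cst a b al)) => x xab //.
  have vx := vs0 _ xab; have xx := sub _ xab.
  have zx := ne (z0 xx); have Ax := ne (A0 xx).
  rewrite /df /sq /U.
  by field; rewrite vx zx Ax.
have sdf : sqint a b df.
  have civA : cc a b (fun x => (A x * vs x)^-1).
    apply: ccV; last by cc_tac.
    by move=> x xab; rewrite mulf_neq0 ?vs0 // gt_eqF // A0 // sub.
  apply: sqintB; last by apply: sqint_cc; cc_tac.
  by have [h1 h2] := sqint_ccM civA ssq; split; [apply: L1_eq h1|apply: L1_eq h2] => x _;
    rewrite mulrC.
have cf := abscont_cc af.
(* the weight of the inequality *)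
pose tau x : R := x - c.
have at3 : abscont a b (fun x => tau x ^+ 3) (fun x => 3 * tau x ^+ 2).
  apply: abscont_C1 => [|x _]; first by rewrite /tau; cc_tac.
  apply: der_eq (derX 2 (derB (der_id x) (der_cst x c))) _.
  by rewrite subr0 mulr1.
have ctau : cc a b tau by rewrite /tau; cc_tac.
have aH := abscontM at3 (abscontM af af).
have If2 : L1 a b (fun x => tau x ^+ 2 * f x ^+ 2) by L1_tac.
have Idf2 : L1 a b (fun x => tau x ^+ 4 * df x ^+ 2).
  by apply: ccL1M sdf.2; cc_tac.
have step1 : itg a b (fun x => tau x ^+ 2 * f x ^+ 2) <=
    4 / 9 * itg a b (fun x => tau x ^+ 4 * df x ^+ 2).
  have h := abscont_itg ab aH.
  have : itg a b (fun x => 3 * (2^-1 * (tau x ^+ 2 * f x ^+ 2)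
      - 2 / 9 * (tau x ^+ 4 * df x ^+ 2))) <= 0.
    apply: le_trans bd; rewrite [leRHS](_ : _ = tau b ^+ 3 * (f b * f b) - tau a ^+ 3 * (f a * f a)); last by rewrite !expr2.
    rewrite -h; apply: le_itg; [|exact: aH.1|].
      by apply: L1Z; apply: L1B; exact: L1Z.
    move=> x _; rewrite -subr_ge0.
    rewrite [leRHS](_ : _ = 3 / 2 * (tau x * f x + 2 / 3 * tau x ^+ 2 * df x) ^+ 2);
      last by field.
    by rewrite mulr_ge0 ?sqr_ge0.
  rewrite itgZ; last by apply: L1B; exact: L1Z.
  by rewrite itgB ?itgZ //; [lra|exact: L1Z|exact: L1Z].
have step2 : itg a b (fun x => tau x ^+ 4 * df x ^+ 2) <=
    C1 * itg a b (fun x => sq k v dv x ^+ 2 / A x) + C2 * pi * k ^+ 2.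
  apply: le_trans (_ : _ <= itg a b (fun x => C1 * (sq k v dv x ^+ 2 / A x) + C2 * k ^+ 2)) _.
    apply: le_itg => //; first by apply: L1D; [exact: L1Z|exact/ccL1/cc_cst].
    move=> x xab; have vx := vs0 _ xab; have xx := sub _ xab.
    have zx := z0 xx; have Ax := A0 xx.
    set s := sq k v dv x.
    have d2 : df x ^+ 2 <= 2 * (s / (A x * vs x)) ^+ 2 + 2 * (k * (g * (w x / z x ^+ 2))) ^+ 2.
      rewrite /df -/s -subr_ge0.
      rewrite [leRHS](_ : _ = (s / (A x * vs x) + k * (g * (w x / z x ^+ 2))) ^+ 2);
        last by ring.
      exact: sqr_ge0.
    have t4 : 0 <= tau x ^+ 4 by rewrite exprn_even_ge0.
    apply: le_trans (ler_wpM2l t4 d2) _.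
    rewrite mulrDr; apply: lerD.
      have [hlo _] := Hvs x xx.
      have tv : kap ^+ 2 * tau x ^+ 2 <= vs x ^+ 2.
        rewrite -[leLHS]exprMn -[vs x ^+ 2]real_normK ?num_real //.
        rewrite -[(kap * tau x) ^+ 2]real_normK ?num_real //.
        by rewrite ler_sqr ?nnegrE // normrM (gtr0_norm kap0).
      have tp : tau x ^+ 2 <= pi ^+ 2.
        have /andP[x0 x1] := xx; have cE2 : c = pi / 2 by [].
        by rewrite /tau; have := pi0; nra.
      have v2 : 0 < vs x ^+ 2 by rewrite exprn_even_gt0 //= vx orbT.
      have HA := HAm x xx.
      rewrite [leLHS](_ : _ = 2 * (tau x ^+ 2 * (tau x ^+ 2 / vs x ^+ 2) / A x) * (s ^+ 2 / A x)); last first.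
        by field; rewrite vx gt_eqF.
      apply: ler_wpM2r; first by rewrite divr_ge0 ?sqr_ge0 // ltW.
      have -> : C1 = 2 * (pi ^+ 2 * (kap ^+ 2)^-1 / Am).
        by rewrite /C1; field; rewrite !gt_eqF.
      apply: ler_wpM2l => //; apply: ler_pM.
      - by rewrite mulr_ge0 ?divr_ge0 ?sqr_ge0.
      - by rewrite invr_ge0 ltW.
      - apply: ler_pM; [exact: sqr_ge0|by rewrite divr_ge0 ?sqr_ge0|exact: tp|].
        rewrite ler_pdivrMr // ler_pdivlMl ?exprn_gt0 //.
      - by rewrite lef_pV2 ?posrE.
    have t4' : 0 <= (x - c) ^+ 4 by exact: t4.
    have := HC2 x xx; rewrite ger0_norm; last first.
      by apply: mulr_ge0; [apply: mulr_ge0; [exact: mulr_ge0|exact: sqr_ge0]|exact: sqr_ge0].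
    move=> hC2; rewrite [leLHS](_ : _ = 2 * (x - c) ^+ 4 * g ^+ 2 * (w x / z x ^+ 2) ^+ 2 * k ^+ 2);
      last by rewrite /tau; ring.
    by apply: ler_wpM2r => //; exact: sqr_ge0.
  rewrite itgD; [|exact: L1Z|exact/ccL1/cc_cst].
  rewrite itgZ // itg_cst // lerD2l.
  have : C2 * k ^+ 2 * (b - a) <= C2 * k ^+ 2 * pi.
    by apply: ler_wpM2l; [rewrite mulr_ge0 ?sqr_ge0 // ltW|lra].
  by move=> /le_trans; apply; rewrite le_eqVlt; apply/orP; left; apply/eqP; ring.
have I0 : 0 <= itg a b (fun x => sq k v dv x ^+ 2 / A x).
  by apply: itg_ge0 => x xab; rewrite divr_ge0 ?sqr_ge0 // ltW // A0 // sub.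
apply: le_trans (_ : _ <= K ^+ 2 * itg a b (fun x => tau x ^+ 2 * f x ^+ 2)) _.
  rewrite -itgZ //; apply: le_itg; [by L1_tac|exact: L1Z|].
  move=> x xab; have vx := vs0 _ xab; have xx := sub _ xab.
  rewrite [leLHS](_ : _ = vs x ^+ 2 * f x ^+ 2); last first.
    by rewrite /f; field; rewrite vx gt_eqF // z0.
  rewrite mulrA; apply: ler_wpM2r; first exact: sqr_ge0.
  have [_ hhi] := Hvs x xx.
  rewrite -[leRHS]exprMn -[vs x ^+ 2]real_normK ?num_real //.
  rewrite -[(K * tau x) ^+ 2]real_normK ?num_real //.
  by rewrite ler_sqr ?nnegrE // normrM (gtr0_norm K0).
have k20 := sqr_ge0 k.
have h1 : 0 <= C1 * k ^+ 2 by rewrite mulr_ge0 // ltW.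
have h2 : 0 <= C2 * pi * itg a b (fun x => sq k v dv x ^+ 2 / A x).
  by apply: mulr_ge0 => //; apply: mulr_ge0; exact: ltW.
have h3 : itg a b (fun x => tau x ^+ 2 * f x ^+ 2) <=
    4 / 9 * ((C1 + C2 * pi) * (itg a b (fun x => sq k v dv x ^+ 2 / A x) + k ^+ 2)).
  by apply: le_trans step1 _; lra.
have := ler_wpM2l (sqr_ge0 K) h3; move=> /le_trans; apply.
by rewrite !mulrA.
Qed.

Let dU v dv x := - (g * (w x * vs x)) * v x + z x * dv x.

Let itv_trans a b t : 0 <= a -> b <= pi -> a <= t <= b -> 0 <= t <= pi.
Proof. by move=> a0 bpi /andP[at_ tb]; rewrite (le_trans a0 at_) (le_trans tb bpi). Qed.

(** Near c, the boundary term E is y U^2 / (vs z) with vs comparable to x - c,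
    and U^2 is at most |x - c| times the integral of U'^2 between x and c by
    the Cauchy-Schwarz inequality; so E tends to 0 at c. *)
Let boundary_bound : exists2 C : R, 0 < C & forall v dv,
  abscont 0 pi v dv -> sqint 0 pi dv ->
  forall x, 0 <= x -> x < c ->
    E (z c * v c) v x <= C * itg x c (fun t => dU v dv t ^+ 2) /\
    - E (z c * v c) v (pi - x) <= C * itg c (pi - x) (fun t => dU v dv t ^+ 2).
Proof.
have [K [kap [K0 kap0 Hvs]]] := shift_bounds.
have [zm zm0 Hzm] := cc_pos cz z0.
have [Y Y0 HY] := cc_bound cy.
exists (Y / (kap * zm)); first by rewrite divr_gt0 // mulr_gt0.
move=> v dv av sdv x x0 xc; set k := z c * v c.
have P := pi0; have cpi' := cpi; have c0' := c0; have cE' := cE.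
have cv := abscont_cc av.
have sdU : sqint 0 pi (dU v dv).
  apply: sqintD; last exact: (sqint_ccM cz sdv).
  by apply: sqint_cc; cc_tac.
have aU := abscont_U k (lexx 0) (lexx pi) av.
have Uc : U k v c = 0 by rewrite /U /k subrr.
have one a b : a <= b -> 0 <= a -> b <= pi ->
    (U k v b - U k v a) ^+ 2 <= (b - a) * itg a b (fun t => dU v dv t ^+ 2).
  move=> ab a0 bpi; rewrite -(aU.2 a b) //.
  have := @cauchy_schwarz _ a b (fun=> 1) (dU v dv).
  have -> : itg a b (fun=> 1 ^+ 2) = b - a by rewrite expr1n itg_cst // mul1r.
  rewrite (@eq_itg _ _ _ (fun x => 1 * dU v dv x) (dU v dv)); last by move=> t _; rewrite mul1r.
  apply; first exact/sqint_cc/cc_cst.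
  exact: sqintS sdU.
have mag t D : 0 <= t <= pi -> t != c -> U k v t ^+ 2 <= `|t - c| * D -> 0 <= D ->
    `|E k v t| <= Y / (kap * zm) * D.
  move=> tt tc UD D0; have [hlo _] := Hvs t tt.
  have tc0 : 0 < `|t - c| by rewrite normr_gt0 subr_eq0.
  have hz := Hzm t tt; have zt := z0 tt.
  have vp : 0 < `|vs t| by apply: lt_le_trans hlo; rewrite mulr_gt0.
  rewrite /E normrM (ger0_norm (sqr_ge0 _)) normrM normfV normrM (gtr0_norm zt).
  apply: le_trans (_ : _ <= Y / (kap * `|t - c| * zm) * (`|t - c| * D)) _; last first.
    by rewrite le_eqVlt; apply/orP; left; apply/eqP; field; rewrite !gt_eqF.
  apply: ler_pM => //; first by rewrite divr_ge0 // mulr_ge0 // ltW.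
    exact: sqr_ge0.
  apply: ler_pM => //; first by rewrite invr_ge0 mulr_ge0 // ltW.
    exact: HY.
  rewrite lef_pV2 ?posrE ?mulr_gt0 //; apply: ler_pM => //; last exact: ltW.
  by rewrite mulr_ge0 // ltW.
split.
  apply: le_trans (ler_norm _) _; apply: mag.
  - by apply/andP; split; lra.
  - by rewrite lt_eqF.
  - have := one x c (ltW xc) x0 (ltW cpi); rewrite Uc sub0r sqrrN.
    by rewrite distrC ger0_norm // subr_ge0 ltW.
  - by apply: itg_ge0 => t _; exact: sqr_ge0.
apply: le_trans (ler_norm _) _; rewrite normrN; apply: mag.
- by apply/andP; split; lra.
- by rewrite gt_eqF //; lra.
- have xx : c <= pi - x by lra.
  have xp : pi - x <= pi by lra.
  have := one c (pi - x) xx (ltW c0) xp; rewrite Uc subr0.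
  by rewrite ger0_norm // subr_ge0.
- by apply: itg_ge0 => t _; exact: sqr_ge0.
Qed.

Let m0 := itg 0 pi (fun x => w x / z x ^+ 2).
Let ciz2 : cc 0 pi (fun x => (z x ^+ 2)^-1).
Proof. by apply: ccV => [x /z0 zx|]; [rewrite expf_neq0 // gt_eqF|cc_tac]. Qed.
Let Iwz : L1 0 pi (fun x => w x / z x ^+ 2). Proof. by L1_tac. Qed.
Let m0_gt0 : 0 < m0.
Proof.
apply: itg_gt0 => //; first by cc_tac.
move=> x /andP[x0 x1]; have xx : 0 <= x <= pi by rewrite !ltW.
by rewrite divr_gt0 ?w0 // exprn_gt0 // z0.
Qed.

(** Identity [square_identity] on [0, x] and [pi - x, pi], with x tending to
    the middle c; what happens between is small by [itg_small].  The constraint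
    removes the term that is linear in k. *)
Let form_lower v dv x1 : abscont 0 pi v dv -> sqint 0 pi dv ->
  itg 0 pi (fun x => w x * v x) = 0 -> x1 < c ->
  itg 0 x1 (fun x => sq (z c * v c) v dv x ^+ 2 / A x) +
  itg (pi - x1) pi (fun x => sq (z c * v c) v dv x ^+ 2 / A x) +
  (z c * v c) ^+ 2 * lam * m0 <= itg 0 pi (qform v dv).
Proof.
move=> av sdv Z x1c; set k := z c * v c.
have [C C0 HC] := boundary_bound; have {}HC := HC v dv av sdv.
have P := pi0; have cpi' := cpi; have c0' := c0; have cE' := cE.
have cv := abscont_cc av.
have sdU : sqint 0 pi (dU v dv).
  apply: sqintD; last exact: (sqint_ccM cz sdv).
  by apply: sqint_cc; cc_tac.
have Iq : L1 0 pi (qform v dv).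
  apply: L1D; first exact: ccL1M sdv.2.
  by L1_tac.
have Iwv : L1 0 pi (fun x => w x * v x) by L1_tac.
(* H dominates all that is left on the middle interval *)
pose H x := (`|qform v dv x| + `|2 * k * (w x * v x)|) +
  (k ^+ 2 * lam * (w x / z x ^+ 2) + C * dU v dv x ^+ 2).
have I1 := L1abs Iq.
have I2 : L1 0 pi (fun x => `|2 * k * (w x * v x)|) by apply/L1abs/L1Z.
have I3 : L1 0 pi (fun x => k ^+ 2 * lam * (w x / z x ^+ 2)) by exact: L1Z.
have I4 : L1 0 pi (fun x => C * dU v dv x ^+ 2) by exact: L1Z sdU.2.
have IH : L1 0 pi H by apply: L1D; exact: L1D.
apply/ler_addgt0Pr => e e0.
have [x [x0 x1x xc He]] := @itg_small _ H c x1 e c0 cpi (esym cE) IH x1c e0.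
have xx' : x <= pi - x by lra.
have cx' : c <= pi - x by lra.
have x1x' : x1 <= pi by lra.
have pix1 : pi - x <= pi - x1 by rewrite lerD2l lerN2.
have x'pi : pi - x <= pi by lra.
have x'0 : 0 <= pi - x by lra.
have [EL ER] := HC x x0 xc.
have nz1 t : 0 <= t <= x -> vs t != 0.
  by move=> /andP[t0 tx]; rewrite gt_eqF // vs_gt0 // t0 /=; lra.
have nz2 t : pi - x <= t <= pi -> vs t != 0.
  by move=> /andP[t0 tx]; rewrite lt_eqF // vs_lt0 // tx andbT; lra.
have xpi : x <= pi by lra.
have SL := square_identity k (lexx 0) x0 xpi nz1 (abscontS (lexx 0) xpi av) (sqintS (lexx 0) xpi sdv).
have SR := square_identity k x'0 x'pi (lexx pi) nz2 (abscontS x'0 (lexx pi) av) (sqintS x'0 (lexx pi) sdv).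
have E0 : E k v 0 = 0 by rewrite /E y_0 !mul0r.
have Epi : E k v pi = 0 by rewrite /E y_pi !mul0r.
rewrite E0 subr0 in SL; rewrite Epi sub0r in SR.
have split3 f : L1 0 pi f -> itg 0 pi f = itg 0 x f + itg x (pi - x) f + itg (pi - x) pi f.
  move=> If; rewrite (@itg_split _ 0 pi x) // (@itg_split _ x pi (pi - x)) //.
    by rewrite addrA.
  by apply: L1S If.
have sQ := split3 _ Iq; have sV := split3 _ Iwv; have sW := split3 _ Iwz.
rewrite -/m0 in sW; rewrite Z in sV.
have sub f : L1 0 pi f -> L1 x (pi - x) f by apply: L1S.
have HE : itg x (pi - x) H = itg x (pi - x) (fun t => `|qform v dv t|) +
   itg x (pi - x) (fun t => `|2 * k * (w t * v t)|) +
   (k ^+ 2 * lam * itg x (pi - x) (fun t => w t / z t ^+ 2) +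
    C * itg x (pi - x) (fun t => dU v dv t ^+ 2)).
  rewrite -itgZ; last exact: sub.
  rewrite -itgZ; last exact: sub sdU.2.
  rewrite -itgD; [|exact: sub|exact: sub].
  rewrite -itgD; [|exact: sub|exact: sub].
  by rewrite -itgD //; apply: L1D; exact: sub.
have m1 : - itg x (pi - x) (qform v dv) <= itg x (pi - x) (fun t => `|qform v dv t|).
  exact: norm_opp_le (ler_norm_itg (sub _ Iq)).
have m2 : - (2 * k * itg x (pi - x) (fun t => w t * v t)) <=
    itg x (pi - x) (fun t => `|2 * k * (w t * v t)|).
  have := norm_opp_le (ler_norm_itg (sub _ (L1Z (2 * k) Iwv))).
  by rewrite itgZ //; exact: sub.
have m3 : itg x (pi - x) (fun t => dU v dv t ^+ 2) =
    itg x c (fun t => dU v dv t ^+ 2) + itg c (pi - x) (fun t => dU v dv t ^+ 2).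
  by apply: itg_split; [exact: ltW|exact: cx'|exact: sub sdU.2].
have ssq a b : 0 <= a -> b <= pi -> (forall t, a <= t <= b -> vs t != 0) ->
    L1 a b (fun x => sq k v dv x ^+ 2 / A x).
  move=> a0 bpi nz.
  have res f : cc 0 pi f -> cc a b f by apply: ccS.
  have cA' := res _ cA; have ciA' := res _ ciA; have cy' := res _ cy.
  have cz' := res _ cz; have cv' := res _ cv.
  have civs' : cc a b (fun x => (vs x)^-1) by apply: ccV => //; exact: res.
  have s1 : sqint a b (sq k v dv).
    apply: sqintD; first by apply: sqint_ccM => //; exact: sqintS sdv.
    by apply: sqint_cc; rewrite /U; cc_tac.
  by apply: L1_eq (ccL1M ciA' s1.2) => t _; rewrite mulrC.
have sq0 t : 0 <= t <= pi -> 0 <= sq k v dv t ^+ 2 / A t.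
  by move=> tt; rewrite divr_ge0 ?sqr_ge0 // ltW // A0.
have monoL : itg 0 x1 (fun x => sq k v dv x ^+ 2 / A x) <=
    itg 0 x (fun x => sq k v dv x ^+ 2 / A x).
  have [x10|x10] := leP 0 x1.
    apply: itg_le_sub => //; first exact: ssq.
    by move=> t tx; apply: sq0; exact: itv_trans tx.
  rewrite [leLHS](_ : _ = 0); last first.
    by rewrite /itg set_itv_ge ?Rintegral_set0 // bnd_simp -ltNge.
  by apply: itg_ge0 => t tx; apply: sq0; exact: itv_trans tx.
have monoR : itg (pi - x1) pi (fun x => sq k v dv x ^+ 2 / A x) <=
    itg (pi - x) pi (fun x => sq k v dv x ^+ 2 / A x).
  have [x10|x10] := leP 0 x1.
    apply: itg_le_sub; [exact: pix1|by rewrite gerBl|by []|exact: ssq|].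
    by move=> t tx; apply: sq0; exact: itv_trans tx.
  rewrite [leLHS](_ : _ = 0); last first.
    by rewrite /itg set_itv_ge ?Rintegral_set0 // bnd_simp -ltNge ltrDl oppr_gt0.
  by apply: itg_ge0 => t tx; apply: sq0; exact: itv_trans tx.
rewrite HE m3 in He.
set SqL := itg 0 x (fun x => sq k v dv x ^+ 2 / A x) in SL monoL.
set SqR := itg (pi - x) pi (fun x => sq k v dv x ^+ 2 / A x) in SR monoR.
rewrite -/k in EL ER.
apply: (square_sum_arith sQ sW (esym sV) SL SR He); rewrite ?lerDl //.
Qed.

(** The part of v that is not accounted for by 1 / z and vs. *)
Let rest k al v x := v x - k / z x - al * vs x.

(** Both boundary terms of [hardy] have the right sign when the multiple of vs
    is chosen to make its function vanish at the outer end of each half. *)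
Let halves : exists2 C : R, 0 < C & forall v dv,
  abscont 0 pi v dv -> sqint 0 pi dv -> itg 0 pi (fun x => w x * v x) = 0 ->
  exists al be, [/\ 0 <= itg 0 pi (qform v dv),
    (z c * v c) ^+ 2 <= C * itg 0 pi (qform v dv) &
    itg 0 c (fun x => rest (z c * v c) al v x ^+ 2) +
    itg c pi (fun x => rest (z c * v c) be v x ^+ 2) <=
      C * itg 0 pi (qform v dv)].
Proof.
have [Ch Ch0 hardyC] := hardy.
have M0 : 0 < lam * m0 by rewrite mulr_gt0.
exists (Ch * (1 + 2 / (lam * m0)) + (lam * m0)^-1).
  by rewrite addr_gt0 ?invr_gt0 // mulr_gt0 // addr_gt0 // divr_gt0.
move=> v dv av sdv Z; set k := z c * v c; set Q := itg 0 pi (qform v dv).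
have sq0 a b : 0 <= a -> b <= pi -> 0 <= itg a b (fun x => sq k v dv x ^+ 2 / A x).
  move=> a0 bpi; apply: itg_ge0 => x xab; rewrite divr_ge0 ?sqr_ge0 // ltW // A0 //.
  exact: itv_trans xab.
have cv := abscont_cc av.
have k2 : k ^+ 2 * (lam * m0) <= Q.
  have := form_lower av sdv Z c0; rewrite subr0 -/k -/Q.
  have := sq0 0 0 (lexx 0) (ltW pi0); have := sq0 pi pi (ltW pi0) (lexx pi).
  rewrite mulrA; move: (itg 0 0 _) (itg pi pi _) => q1 q2 h1 h2 h3; lra.
have Q0 : 0 <= Q.
  by apply: le_trans k2; rewrite mulr_ge0 ?sqr_ge0 // ltW.
have k2' : k ^+ 2 <= (lam * m0)^-1 * Q by rewrite ler_pdivlMl // mulrC.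
exists ((v 0 - k / z 0) / vs 0), ((v pi - k / z pi) / vs pi); split => //.
  apply: le_trans k2' _; apply: ler_wpM2r => //.
  by rewrite lerDr mulr_ge0 ?(ltW Ch0) // addr_ge0 // divr_ge0 // ltW.
set al := _ / vs 0; set be := _ / vs pi.
have cr t : cc 0 pi (rest k t v) by rewrite /rest; cc_tac.
have crL := cr al; have crR := cr be.
have outer x1 : 0 <= x1 -> x1 < c ->
    itg 0 x1 (fun x => rest k al v x ^+ 2) + itg (pi - x1) pi (fun x => rest k be v x ^+ 2)
    <= Ch * (1 + 2 / (lam * m0)) * Q.
  move=> x10 x1c.
  have x1pi : x1 <= pi by apply: le_trans (ltW x1c) (ltW cpi).
  have x1p' : 0 <= pi - x1 by rewrite subr_ge0.
  have x1p'' : pi - x1 <= pi by rewrite gerBl.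
  have cx : c < pi - x1 by have := cE; have := x1c; lra.
  have nz1 t : 0 <= t <= x1 -> vs t != 0.
    by move=> /andP[t0 tx]; rewrite gt_eqF // vs_gt0 // t0 /=; apply: le_lt_trans x1c.
  have nz2 t : pi - x1 <= t <= pi -> vs t != 0.
    by move=> /andP[t0 tx]; rewrite lt_eqF // vs_lt0 // tx andbT; apply: lt_le_trans t0.
  have hL : itg 0 x1 (fun x => rest k al v x ^+ 2) <=
      Ch * (itg 0 x1 (fun x => sq k v dv x ^+ 2 / A x) + k ^+ 2).
    apply: hardyC => //; [exact: abscontS av|exact: sqintS sdv|].
    rewrite -/al [X in _ - _ * X ^+ 2]subrr expr0n mulr0 subr0.
    by apply: odd_cube_le0; rewrite subr_le0 ltW.
  have hR : itg (pi - x1) pi (fun x => rest k be v x ^+ 2) <=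
      Ch * (itg (pi - x1) pi (fun x => sq k v dv x ^+ 2 / A x) + k ^+ 2).
    apply: hardyC => //; [exact: abscontS av|exact: sqintS sdv|].
    rewrite -/be [X in _ * X ^+ 2 - _]subrr expr0n mulr0 sub0r oppr_le0.
    by apply: odd_cube_ge0; rewrite subr_ge0 ltW.
  have FL := form_lower av sdv Z x1c; rewrite -/k -/Q in FL.
  move: hL hR FL; move: (itg 0 x1 _) (itg _ pi _) => iL iR.
  move: (itg 0 x1 _) (itg _ pi _) => sL sR hL hR FL.
  have sLR : sL + sR <= Q.
    by apply: le_trans FL; rewrite lerDl mulr_ge0 ?(ltW m0_gt0) // mulr_ge0 ?sqr_ge0 // ltW.
  have := lerD hL hR; rewrite -mulrDr => /le_trans; apply.
  rewrite -mulrA; apply: ler_wpM2l; first exact: ltW.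
  by rewrite mulrDl mul1r -mulrA; lra.
apply/ler_addgt0Pr => e e0.
pose f x := rest k al v x ^+ 2 + rest k be v x ^+ 2.
have cf : cc 0 pi f by rewrite /f; cc_tac.
have [x [x0 _ xc He]] := itg_small c0 cpi (esym cE) (ccL1 cf) c0 e0.
have xpi : x <= pi by apply: le_trans (ltW xc) (ltW cpi).
have cx : c < pi - x by have := cE; have := xc; lra.
have px : pi - x <= pi by rewrite gerBl.
have px0 : 0 <= pi - x by rewrite subr_ge0.
have cL2 : cc 0 pi (fun x => rest k al v x ^+ 2) by cc_tac.
have cR2 : cc 0 pi (fun x => rest k be v x ^+ 2) by cc_tac.
have h1 := outer x x0 xc.
have s1 : itg 0 c (fun x => rest k al v x ^+ 2) =
    itg 0 x (fun x => rest k al v x ^+ 2) + itg x c (fun x => rest k al v x ^+ 2).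
  by apply: itg_split => //; [exact: ltW|exact: L1S (ltW cpi) (ccL1 cL2)].
have s2 : itg c pi (fun x => rest k be v x ^+ 2) =
    itg c (pi - x) (fun x => rest k be v x ^+ 2) + itg (pi - x) pi (fun x => rest k be v x ^+ 2).
  by apply: itg_split => //; [exact: ltW|exact: L1S (ltW c0) _ (ccL1 cR2)].
have s3 : itg x c (fun x => rest k al v x ^+ 2) + itg c (pi - x) (fun x => rest k be v x ^+ 2)
    <= itg x (pi - x) f.
  rewrite (@itg_split _ x (pi - x) c); [|exact: ltW|exact: ltW|by apply: L1S (ccL1 cf)].
  apply: lerD; apply: le_itg.
  - by apply: L1S (ccL1 cL2) => //; exact: ltW.
  - by apply: L1S (ccL1 cf) => //; exact: ltW.
  - by move=> t _; rewrite lerDl sqr_ge0.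
  - by apply: L1S (ccL1 cR2) => //; exact: ltW.
  - by apply: L1S (ccL1 cf) => //; exact: ltW.
  - by move=> t _; rewrite lerDr sqr_ge0.
have s4 : 0 <= (lam * m0)^-1 * Q by rewrite mulr_ge0 // invr_ge0 ltW.
rewrite s1 s2 mulrDl; exact: four_parts_le s3 He h1 s4.
Qed.

Let itg_cc_le a b f : 0 <= a -> a <= b -> b <= pi -> cc 0 pi f ->
  (forall x, 0 <= f x) -> itg a b f <= itg 0 pi f.
Proof. by move=> a0 ab bpi cf f0; apply: itg_le_sub => //; exact: ccL1. Qed.

Let itg_c f : cc 0 pi f -> itg 0 pi f = itg 0 c f + itg c pi f.
Proof. by move=> cf; apply: itg_split; [exact: ltW|exact: ltW|exact: ccL1]. Qed.

Let ccl f : cc 0 pi f -> cc 0 c f. Proof. by apply: ccS => //; exact: ltW. Qed.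
Let ccr f : cc 0 pi f -> cc c pi f. Proof. by apply: ccS => //; exact: ltW. Qed.

(** A constraint with weight om, tested on v = rest + k / z + al vs (be vs on
    the right half), becomes a linear relation between al and be up to terms
    that the form controls. *)
Let coefficient_bound om C v k al be Q : cc 0 pi om -> cc 0 pi v -> 0 <= C ->
  itg 0 pi (fun x => om x * v x) = 0 -> k ^+ 2 <= C * Q ->
  itg 0 c (fun x => rest k al v x ^+ 2) + itg c pi (fun x => rest k be v x ^+ 2) <= C * Q ->
  (al * itg 0 c (fun x => om x * vs x) + be * itg c pi (fun x => om x * vs x)) ^+ 2 <=
  (2 * itg 0 pi (fun x => om x / z x) ^+ 2 * C + 4 * itg 0 pi (fun x => om x ^+ 2) * C) * Q.
Proof.
move=> com cv C0 Z hk hr.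
have cr t : cc 0 pi (rest k t v) by rewrite /rest; cc_tac.
have crL := cr al; have crR := cr be.
pose p := itg 0 c (fun x => om x * rest k al v x).
pose q := itg c pi (fun x => om x * rest k be v x).
pose m1 := itg 0 pi (fun x => om x / z x).
have piece a b t : cc a b om -> cc a b v -> cc a b vs -> cc a b (fun x => (z x)^-1) ->
    itg a b (fun x => om x * rest k t v x) = itg a b (fun x => om x * v x)
     - k * itg a b (fun x => om x / z x) - t * itg a b (fun x => om x * vs x).
  move=> c1 c2 c3 c4.
  rewrite -itgZ; last by L1_tac.
  rewrite -itgZ; last by L1_tac.
  rewrite -itgB; [|by L1_tac|by L1_tac].
  rewrite -itgB; [|by L1_tac|by L1_tac].
  by apply: eq_itg => x _; rewrite /rest; ring.
have Ecoef : al * itg 0 c (fun x => om x * vs x) + be * itg c pi (fun x => om x * vs x) =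
    - (k * m1 + (p + q)).
  have pE := @piece 0 c al (ccl com) (ccl cv) (ccl cvs) (ccl ciz).
  have qE := @piece c pi be (ccr com) (ccr cv) (ccr cvs) (ccr ciz).
  have := Z; rewrite itg_c; last by cc_tac.
  have m1E : m1 = itg 0 c (fun x => om x / z x) + itg c pi (fun x => om x / z x).
    by apply: itg_c; cc_tac.
  rewrite -/p in pE; rewrite -/q in qE; rewrite m1E pE qE.
  exact: two_pieces_eq.
rewrite Ecoef sqrrN.
have com2 : cc 0 pi (fun x => om x ^+ 2) by cc_tac.
have W0 : 0 <= itg 0 pi (fun x => om x ^+ 2) by apply: itg_ge0 => x _; exact: sqr_ge0.
have pp : p ^+ 2 <= itg 0 pi (fun x => om x ^+ 2) * itg 0 c (fun x => rest k al v x ^+ 2).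
  apply: le_trans (cauchy_schwarz (sqint_cc (ccl com)) (sqint_cc (ccl crL))) _.
  apply: ler_wpM2r; first by apply: itg_ge0 => x _; exact: sqr_ge0.
  by apply: itg_cc_le => //; [exact: ltW|exact: ltW|move=> x; exact: sqr_ge0].
have qq : q ^+ 2 <= itg 0 pi (fun x => om x ^+ 2) * itg c pi (fun x => rest k be v x ^+ 2).
  apply: le_trans (cauchy_schwarz (sqint_cc (ccr com)) (sqint_cc (ccr crR))) _.
  apply: ler_wpM2r; first by apply: itg_ge0 => x _; exact: sqr_ge0.
  by apply: itg_cc_le => //; [exact: ltW|exact: ltW|move=> x; exact: sqr_ge0].
exact: coefficient_arith W0 pp qq hr hk.
Qed.

(** The weights w and w vs of the two constraints give two relations with a
    nonzero determinant: int w vs = int y' is y c on the left half and - y c on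
    the right half, while int w vs^2 is positive on both. *)
Lemma poincare : exists2 C : R, 0 < C & forall v dv,
  abscont 0 pi v dv -> sqint 0 pi dv ->
  itg 0 pi (fun x => w x * v x) = 0 -> itg 0 pi (fun x => w x * vs x * v x) = 0 ->
  0 <= itg 0 pi (qform v dv) /\
  itg 0 pi (fun x => v x ^+ 2) <= C * itg 0 pi (qform v dv).
Proof.
have [C C0 HC] := halves.
have cwv : cc 0 pi (fun x => w x * vs x) by cc_tac.
have cwvv : cc 0 pi (fun x => w x * vs x * vs x) by cc_tac.
pose Cw om := 2 * itg 0 pi (fun x => om x / z x) ^+ 2 * C + 4 * itg 0 pi (fun x => om x ^+ 2) * C.
have Cw0 om : 0 <= Cw om.
  have i0 : 0 <= itg 0 pi (fun x => om x ^+ 2) by apply: itg_ge0 => x _; exact: sqr_ge0.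
  by apply: addr_ge0; apply: mulr_ge0; rewrite ?(ltW C0) //; apply: mulr_ge0; rewrite ?sqr_ge0.
pose h := y c.
have h0 : 0 < h by apply: y0; rewrite c0 cpi.
have ay : abscont 0 pi y (fun x => w x * vs x) by apply: abscont_C1.
have hL : itg 0 c (fun x => w x * vs x) = h.
  by rewrite (ay.2 0 c) ?y_0 ?subr0 // ltW.
have hR : itg c pi (fun x => w x * vs x) = - h.
  by rewrite (ay.2 c pi) ?y_pi ?sub0r // ltW.
pose n1 := itg 0 c (fun x => w x * vs x * vs x).
pose n2 := itg c pi (fun x => w x * vs x * vs x).
have n10 : 0 < n1.
  apply: itg_gt0 => //; first exact: ccl.
  move=> x /andP[x0 xc]; have v0 : 0 < vs x by rewrite vs_gt0 // ltW.
  have xx : 0 <= x <= pi by apply/andP; split; apply: ltW => //; exact: lt_trans cpi.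
  by rewrite !mulr_gt0 // w0.
have n20 : 0 < n2.
  apply: itg_gt0 => //; first exact: ccr.
  move=> x /andP[cx xpi]; have v0 : vs x < 0 by rewrite vs_lt0 // cx ltW.
  have xx : 0 <= x <= pi by apply/andP; split; apply: ltW => //; exact: lt_trans cx.
  by rewrite -mulrA; apply: mulr_gt0; [exact: w0|rewrite nmulr_rgt0].
pose Ca (n : R) := 2 * ((n / h) ^+ 2 * Cw w + Cw (fun x => w x * vs x)) / (n1 + n2) ^+ 2.
have Ca0 n : 0 <= Ca n.
  rewrite /Ca divr_ge0 ?sqr_ge0 // mulr_ge0 // addr_ge0 ?Cw0 //.
  by rewrite mulr_ge0 ?sqr_ge0 ?Cw0.
pose mz := itg 0 pi (fun x => (z x ^+ 2)^-1).
pose nv := itg 0 pi (fun x => vs x ^+ 2).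
have mz0 : 0 <= mz by apply: itg_ge0 => x _; rewrite invr_ge0 sqr_ge0.
have nv0 : 0 <= nv by apply: itg_ge0 => x _; rewrite sqr_ge0.
exists (3 * (C + 2 * C * mz + Ca n2 * nv + Ca n1 * nv)).
  have p1 : 0 <= 2 * C * mz by apply: mulr_ge0 => //; apply: mulr_ge0 => //; exact: ltW.
  have p2 n : 0 <= Ca n * nv by exact: mulr_ge0.
  by apply: mulr_gt0 => //; do 3 (apply: ltr_wpDr; first by []).
move=> v dv av sdv Z1 Z2.
have [al [be [Q0 hk hr]]] := HC v dv av sdv Z1.
set Q := itg 0 pi (qform v dv) in Q0 hk hr *; set k := z c * v c in hk hr.
split=> //; have cv := abscont_cc av.
have e1 := coefficient_bound cw cv (ltW C0) Z1 hk hr.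
have e2 := coefficient_bound cwv cv (ltW C0) Z2 hk hr.
rewrite hL hR mulrN -mulrBl in e1; rewrite -/n1 -/n2 in e2.
have [ha hb] := two_coefficients h0 n10 n20 erefl erefl e1 e2.
rewrite -/(Ca n2) in ha; rewrite -/(Ca n1) in hb.
have cr t : cc 0 pi (rest k t v) by rewrite /rest; cc_tac.
have piece a b t : 0 <= a -> a <= b -> b <= pi -> itg a b (fun x => v x ^+ 2) <=
    3 * (itg a b (fun x => rest k t v x ^+ 2) + k ^+ 2 * mz + t ^+ 2 * nv).
  move=> a0 ab bpi; have crt := cr t.
  have L f : cc 0 pi f -> L1 a b f by move=> cf; apply: L1S (ccL1 cf).
  have c1 : cc 0 pi (fun x => v x ^+ 2) by cc_tac.
  have c2 : cc 0 pi (fun x => rest k t v x ^+ 2) by cc_tac.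
  have c3 : cc 0 pi (fun x => vs x ^+ 2) by cc_tac.
  apply: le_trans (_ : _ <= 3 * (itg a b (fun x => rest k t v x ^+ 2) +
     k ^+ 2 * itg a b (fun x => (z x ^+ 2)^-1) + t ^+ 2 * itg a b (fun x => vs x ^+ 2))) _.
    rewrite -itgZ; last exact: L.
    rewrite -itgZ; last exact: L.
    rewrite -itgD; [|exact: L|exact/L1Z/L].
    rewrite -itgD; [|by apply: L1D; [|apply: L1Z]; exact: L|exact/L1Z/L].
    rewrite -itgZ; last by apply: L1D; [apply: L1D; [|apply: L1Z]|apply: L1Z]; exact: L.
    apply: le_itg; [exact: L| |].
      by apply/L1Z/L1D; [apply: L1D; [|apply: L1Z]|apply: L1Z]; exact: L.
    move=> x _; have -> : v x = rest k t v x + k / z x + t * vs x by rewrite /rest; ring.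
    apply: le_trans (sqrD3_le _ _ _) _.
    have e1' : (k / z x) ^+ 2 = k ^+ 2 / z x ^+ 2 by rewrite exprMn exprVn.
    have e2' : (t * vs x) ^+ 2 = t ^+ 2 * vs x ^+ 2 by rewrite exprMn.
    by rewrite e1' e2'.
  apply: ler_wpM2l => //; apply: lerD; first apply: lerD => //.
    apply: ler_wpM2l; first exact: sqr_ge0.
    by apply: itg_cc_le => // x; rewrite invr_ge0 sqr_ge0.
  apply: ler_wpM2l; first exact: sqr_ge0.
  by apply: itg_cc_le => // x; rewrite sqr_ge0.
rewrite itg_c; last by cc_tac.
have pL := @piece 0 c al (lexx 0) (ltW c0) (ltW cpi).
have pR := @piece c pi be (ltW c0) (ltW cpi) (lexx pi).
exact: poincare_arith pL pR hr hk ha hb mz0 nv0.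
Qed.

(** With the L2 norm under control, the potential of the form is harmless and
    its principal part bounds v'. *)
Lemma form_coercive : exists2 C : R, 0 < C & forall v dv,
  abscont 0 pi v dv -> sqint 0 pi dv ->
  itg 0 pi (fun x => w x * v x) = 0 -> itg 0 pi (fun x => w x * vs x * v x) = 0 ->
  C * (itg 0 pi (fun x => v x ^+ 2) + itg 0 pi (fun x => dv x ^+ 2)) <=
  itg 0 pi (qform v dv).
Proof.
have [C C0 HC] := poincare.
have [Am Am0 HAm] := cc_pos cA A0.
have [M M0 HM] : exists2 M : R, 0 < M &
    forall t, 0 <= t <= pi -> `|(g * y t - z t) * w t| <= M.
  by apply: cc_bound; cc_tac.
have D0 : 0 < C + (1 + M * C) / Am.
  by rewrite addr_gt0 // divr_gt0 // addr_gt0 // mulr_gt0.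
exists (C + (1 + M * C) / Am)^-1; first by rewrite invr_gt0.
move=> v dv av sdv Z1 Z2; have [Q0 hv] := HC v dv av sdv Z1 Z2.
set Q := itg 0 pi (qform v dv) in Q0 hv *.
have cv := abscont_cc av.
have c1 : cc 0 pi (fun x => v x ^+ 2) by cc_tac.
have hq : Am * itg 0 pi (fun x => dv x ^+ 2) - M * itg 0 pi (fun x => v x ^+ 2) <= Q.
  rewrite -itgZ; last exact: sdv.2.
  rewrite -itgZ; last exact: ccL1.
  rewrite -itgB; [|exact: L1Z sdv.2|exact/L1Z/ccL1].
  apply: le_itg; first by apply: L1B; [exact: L1Z sdv.2|exact/L1Z/ccL1].
    by apply: L1D; [exact: ccL1M sdv.2|L1_tac].
  move=> x xab; rewrite /qform; apply: lerD.
    by apply: ler_wpM2r; [exact: sqr_ge0|exact: HAm].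
  rewrite -mulNr; apply: ler_wpM2r; first exact: sqr_ge0.
  by have := HM x xab; rewrite ler_norml => /andP[].
rewrite ler_pdivrMl //; exact: gradient_arith Am0 M0 hq hv.
Qed.

End coercivity.

(** * The Sobolev norms as integrals *)
Section norms.
Context {R : realType}.
Implicit Types (f h : R -> R) (d : R).

Local Notation mu := (@lebesgue_measure R).

Definition sobolevH1 f : Prop :=
  [/\ weak1 dom0pi 1 f (wder f), sqint 0 pi f & sqint 0 pi (wder f)].

Lemma sqint_dom f : measurable_fun dom0pi f ->
  (\int[mu]_(x in dom0pi) (f x ^+ 2)%:E < +oo)%E -> sqint 0 pi f.
Proof.
move=> mf fin; have mf2 : measurable_fun dom0pi (fun x => f x ^+ 2).
  exact: measurable_funX.
have If2 : L1 0 pi (fun x => f x ^+ 2).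
  apply/L1_dom_iff/integrableP; split; first exact/measurable_EFinP.
  rewrite (_ : (\int[mu]_(x in dom0pi) _)%E = (\int[mu]_(x in dom0pi) (f x ^+ 2)%:E)%E) //.
  by apply: eq_integral => x _; rewrite /= ger0_norm // sqr_ge0.
split => //; apply: (@L1_le _ _ _ _ (fun x => 1 + f x ^+ 2)).
- exact: measurable_dom_cc.
- by apply: L1D => //; exact/ccL1/cc_cst.
- move=> x _; rewrite [leRHS]ger0_norm ?addr_ge0 ?sqr_ge0 //.
  have := sqr_ge0 (f x - 1); have := sqr_ge0 (f x + 1).
  by rewrite ler_norml => h1 h2; apply/andP; split; nra.
Qed.

Lemma itg_dom f : L1 0 pi f -> (\int[mu]_(x in dom0pi) (f x)%:E)%E = (itg 0 pi f)%:E.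
Proof.
move=> If; rewrite integral_dom0pi; last first.
  by have /integrableP[] := L1_dom If.
by rewrite /itg /Rintegral fineK //; apply: integrable_fin_num.
Qed.

Lemma Lp_pow2 f : Lp_pow mu dom0pi 2 f = (\int[mu]_(x in dom0pi) (f x ^+ 2)%:E)%E.
Proof.
apply: eq_integral => x _; congr EFin.
by rewrite -[RHS]real_normK ?num_real // -powR_mulrn.
Qed.

Lemma poweR_half_sqr (x : R) : 0 <= x -> ((x%:E `^ 2^-1) ^+ 2 = x%:E)%E.
Proof.
move=> x0; rewrite poweR_EFin powR12_sqrt // -EFin_expe; congr EFin.
by rewrite sqr_sqrtr.
Qed.

Lemma poweR_half_sqry : ((+oo : \bar R) `^ (2^-1 : R) ^+ 2 = +oo)%E.
Proof. by rewrite poweRyr ?invr_eq0 ?pnatr_eq0 // expe2 mulyy. Qed.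

Lemma sobolev_pow_sum f : weakly_differentiable dom0pi (fun j => [:: j]) (weak1 dom0pi) 1 f ->
  sobolev_pow mu dom0pi (fun j => [:: j]) (weak1 dom0pi) 1 2 f =
  (Lp_pow mu dom0pi 2 f + Lp_pow mu dom0pi 2 (wder f))%E.
Proof.
move=> wd; rewrite /sobolev_pow asboolT //.
by rewrite big_nat1 big_seq1.
Qed.

Lemma Lp_pow_ge0 (p : R) f : (0 <= Lp_pow mu dom0pi p f)%E.
Proof. by apply: integral_ge0 => x _; rewrite lee_fin powR_ge0. Qed.

(** The norm is infinite outside of H^1, so any finite bound on it contains the
    weak differentiability. *)
Lemma H1_sobolev f d : (H1 f ^+ 2 <= d%:E)%E -> sobolevH1 f.
Proof.
rewrite /H1 /sob1 /sobolev_norm; have [wd|nwd] := pselect (weakly_differentiable dom0pi (fun j => [:: j]) (weak1 dom0pi) 1 f); last first.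
  by rewrite /sobolev_pow asboolF // poweR_half_sqry leye_eq.
rewrite sobolev_pow_sum // => H.
have [mf wg] := wd.
have wf : weak1 dom0pi 1 f (wder f).
  have [gg Hg] := wg 1%N 1%N isT (mem_head _ _).
  have := @xgetPex _ (cst 0) [set h | weak1 dom0pi 1 f h]; apply; by exists gg.
have fin : (Lp_pow mu dom0pi 2 f + Lp_pow mu dom0pi 2 (wder f) < +oo)%E.
  rewrite ltNge leye_eq; apply/negP => /eqP e; move: H; rewrite e.
  by rewrite poweR_half_sqry leye_eq.
have p1 := Lp_pow_ge0 2 f; have p2 := Lp_pow_ge0 2 (wder f).
have [_ [mdf _ _] _] := wf.
have fin1 : (Lp_pow mu dom0pi 2 f < +oo)%E.
  by apply: (le_lt_trans _ fin); exact: leeDl p2.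
have fin2 : (Lp_pow mu dom0pi 2 (wder f) < +oo)%E.
  by apply: (le_lt_trans _ fin); exact: leeDr p1.
rewrite Lp_pow2 in fin1; rewrite Lp_pow2 in fin2.
by split; [exact: wf|exact: sqint_dom mf fin1|exact: sqint_dom mdf fin2].
Qed.

Lemma sobolev_wd f : sobolevH1 f ->
  weakly_differentiable dom0pi (fun j => [:: j]) (weak1 dom0pi) 1 f.
Proof.
move=> [wf [If _] _]; split; first by have [] := wf => -[].
move=> j a /andP[j0 j1]; rewrite inE => /eqP ->.
have -> : j = 1%N by apply/eqP; rewrite eqn_leq j1 j0.
by exists (wder f).
Qed.

Lemma H1_sq f : sobolevH1 f ->
  (H1 f ^+ 2 = (itg 0 pi (fun x => f x ^+ 2) + itg 0 pi (fun x => wder f x ^+ 2))%:E)%E.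
Proof.
move=> sf; have [_ [_ I1] [_ I2]] := sf.
rewrite /H1 /sob1 /sobolev_norm sobolev_pow_sum; last exact: sobolev_wd.
rewrite !Lp_pow2 !itg_dom // -EFinD poweR_half_sqr //.
by apply: addr_ge0; apply: itg_ge0 => x _; exact: sqr_ge0.
Qed.

Lemma L2_sq f : sqint 0 pi f -> (L2 f ^+ 2 = (itg 0 pi (fun x => f x ^+ 2))%:E)%E.
Proof.
move=> [If If2]; rewrite /L2 /sob1 /sobolev_norm /sobolev_pow.
rewrite asboolT; last first.
  split; first by apply: measurable_cc_dom; exact: L1_measurable.
  by case=> [|j] a.
rewrite big_geq // adde0 Lp_pow2 itg_dom // poweR_half_sqr //.
by apply: itg_ge0 => x _; exact: sqr_ge0.
Qed.

Lemma L2_4 f : sqint 0 pi f -> (L2 f ^+ 4 = (itg 0 pi (fun x => f x ^+ 2) ^+ 2)%:E)%E.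
Proof.
move=> sf; rewrite EFin_expe -L2_sq //.
by rewrite !expeS !expe0 !mule1 !muleA.
Qed.

End norms.

(** * The geometry of the equilibrium profile *)
Section profile.
Context {R : realType}.
Implicit Types (x a b t : R).
Variables (g sigma gam V : R) (r : R -> R).
Hypotheses (g0 : 0 < g) (sig0 : 0 < sigma) (V0 : 0 < V) (gs : `|gam| < sigma).
Hypothesis eqr : equilibrium g sigma gam V r.

Let sr : smooth1 r. Proof. by case: eqr. Qed.
Let r0 x : 0 <= x <= pi -> 0 < r x. Proof. by case: eqr => _ [_ H _] _ _; exact: H. Qed.
Let Vr : itg 0 pi (fun x => r x ^+ 2) = V. Proof. by case: eqr => _ [_ _ H]. Qed.
Let r1 := derive1 r.
Let r2 := derive1n 2 r.
Let lam := pressure g sigma gam V r.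
Let S x := Num.sqrt (area_sq r x).
Let pi0 := @pi_gt0 R.

Let dr x : der x r (r1 x). Proof. exact: smooth_der. Qed.
Let dr1 x : der x r1 (r2 x). Proof. exact/smooth_der/smooth_derive1. Qed.
Let cr : cc 0 pi r. Proof. exact: cc_smooth. Qed.
Let cr1 : cc 0 pi r1. Proof. exact/cc_smooth/smooth_derive1. Qed.
Let cr2 : cc 0 pi r2. Proof. exact/cc_smooth/smooth_derive1/smooth_derive1. Qed.
Let cs : cc 0 pi (@sin R). Proof. exact: cc_sin. Qed.
Let cco : cc 0 pi (@cos R). Proof. exact: cc_cos. Qed.
Let D0 x : 0 <= x <= pi -> 0 < area_sq r x.
Proof. by move=> xab; apply: ltr_wpDr; rewrite ?sqr_ge0 // exprn_gt0 // r0. Qed.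
Let S0 x : 0 <= x <= pi -> 0 < S x.
Proof. by move=> xab; rewrite sqrtr_gt0 D0. Qed.
Let S2 x : 0 <= x <= pi -> S x ^+ 2 = r x ^+ 2 + r1 x ^+ 2.
Proof. by move=> xab; rewrite sqr_sqrtr // ltW // D0. Qed.
Let cS : cc 0 pi S.
Proof. by apply: cc_sqrt; rewrite /area_sq -/r1; cc_tac. Qed.

Let ciS : cc 0 pi (fun x => (S x)^-1).
Proof. by apply: ccV => // x xab; rewrite gt_eqF // S0. Qed.
Let cir : cc 0 pi (fun x => (r x)^-1).
Proof. by apply: ccV => // x xab; rewrite gt_eqF // r0. Qed.
Let cir2 : cc 0 pi (fun x => (r x ^+ 2)^-1).
Proof. by apply: ccV => [t tab|]; [rewrite gt_eqF // exprn_gt0 // r0|cc_tac]. Qed.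
Let ciS3 : cc 0 pi (fun x => (S x ^+ 3)^-1).
Proof. by apply: ccV => [t tab|]; [rewrite gt_eqF // exprn_gt0 // S0|cc_tac]. Qed.

Let dS x : 0 <= x <= pi -> der x S (r1 x * (r x + r2 x) / S x).
Proof.
move=> xab; apply: der_eq (der_sqrt (D0 xab) (derD (derX 1 (dr x)) (derX 1 (dr1 x)))) _.
rewrite -/(S x) !expr1; field; by rewrite gt_eqF // S0.
Qed.

(** The first variation says that K is a weak derivative of
    F = sigma r' / sqrt D, whose classical derivative is f; weak derivatives are
    unique, and both functions are continuous.  The equation is stated without
    denominators: it says that the curvature times sigma is lam - g y. *)
Lemma euler_lagrange x : 0 <= x <= pi ->
  sigma * (r x ^+ 2 + 2 * r1 x ^+ 2 - r x * r2 x) =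
  (lam - g * (r x * sin x)) * S x ^+ 3.
Proof.
pose F x := sigma * r1 x / S x.
pose f x := sigma * (r x * (r x * r2 x - r1 x ^+ 2)) / S x ^+ 3.
pose K x := g * (r x ^+ 2 * sin x) + sigma * r x / S x - lam * r x.
have cf : cc 0 pi f by rewrite /f; cc_tac.
have cK : cc 0 pi K by rewrite /K; cc_tac.
have wf : weak1 dom0pi 1 F f.
  apply: weak1_abscont; apply: abscont_C1 => // t tab.
  have St := S0 tab.
  apply: der_eq (derM (derM (der_cst t sigma) (dr1 t)) (derV _ (dS tab))) _.
    by rewrite gt_eqF.
  rewrite /f; apply: (@eq_trans _ _ (sigma * (r2 t * S t ^+ 2 -
    r1 t * (r1 t * (r t + r2 t))) / S t ^+ 3)).
    by field; rewrite gt_eqF.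
  by rewrite S2 //; congr (_ / _); ring.
have wK : weak1 dom0pi 1 F K.
  have [lF _ _] := wf; split; [exact: lF|exact/L1_loc/ccL1|].
  move=> phi tphi; have [a [b [a0 ab bpi Z]]] := test1_supp tphi.
  have sphi := tphi.1.
  have cphi : cc 0 pi phi by exact: cc_smooth.
  have cphi1 : cc 0 pi (derive1 phi) by exact/cc_smooth/smooth_derive1.
  have n0 : ~~ (a < 0 < b) by apply/negP => /andP[]; lra.
  have npi : ~~ (a < pi < b) by apply/negP => /andP[]; lra.
  have E := first_variation sig0 V0 eqr sphi (Z _ n0).1 (Z _ npi).1.
  rewrite expr1 mulN1r derive1n1.
  have dom h : cc 0 pi h -> \int[lebesgue_measure]_(x in dom0pi) h x = itg 0 pi h.
    move=> ch; rewrite /itg /Rintegral integral_dom0pi //.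
    by apply/measurable_EFinP; apply: measurable_cc_dom; exact: cc_measurable.
  have cFp : cc 0 pi (fun x => F x * derive1 phi x) by rewrite /F; cc_tac.
  have cKp : cc 0 pi (fun x => K x * phi x) by cc_tac.
  rewrite !dom //; apply/eqP; rewrite -addr_eq0 -itgD; [|exact: ccL1..].
  move/eqP: E; rewrite -subr_eq0 -/lam.
  rewrite -itgZ; last by L1_tac.
  rewrite -itgZ; last by rewrite -/r1; L1_tac.
  rewrite -itgZ; last by L1_tac.
  rewrite -itgD; [|by L1_tac|by rewrite -/r1; L1_tac].
  rewrite -itgB; [|by rewrite -/r1; L1_tac|by L1_tac].
  move/eqP => E; apply/eqP; rewrite -[RHS]E; apply: eq_itg => t tab.
  by rewrite /F /K -/(S t) -/(r1 t); ring.
have H := weak1_unique wf wK.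
have {}H : {ae lebesgue_measure, forall x, dom0pi x -> f x - K x = 0}.
  by apply: ae_imp H => t H /H ->; rewrite subrr.
have cfK : cc 0 pi (fun x => f x - K x) by cc_tac.
move=> xab; have := cc_ae_zero cfK H xab.
have rx := r0 xab; have Sx := S0 xab.
rewrite /f /K => E.
have {}E : sigma * (r x * r2 x - r1 x ^+ 2) =
   (g * (r x * sin x) - lam) * S x ^+ 3 + sigma * S x ^+ 2.
  apply: (mulfI (lt0r_neq0 rx)); apply/eqP; rewrite -subr_eq0 -(mulr0 (S x ^+ 3)) -E.
  by apply/eqP; field; rewrite gt_eqF.
rewrite -[LHS]subr0 -[X in _ - X](subrr (sigma * S x ^+ 2)) {1}S2 //.
by apply/eqP; rewrite -subr_eq0; apply/eqP; lra.
Qed.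

Let y x := r x * sin x.
Let z x := lam - g * y x.
Let w x := r x ^+ 2.
Let vs x := (r x * cos x + r1 x * sin x) / r x ^+ 2.
Let A x := sigma * r x ^+ 4 / S x ^+ 3.

Let w0 x : 0 <= x <= pi -> 0 < w x. Proof. by move=> /r0 rx; rewrite exprn_gt0. Qed.
Let A0 x : 0 <= x <= pi -> 0 < A x.
Proof.
by move=> xab; rewrite divr_gt0 ?exprn_gt0 ?S0 // mulr_gt0 // exprn_gt0 // r0.
Qed.

Lemma der_height x : 0 <= x <= pi -> der x y (w x * vs x).
Proof.
move=> xab; apply: der_eq (derM (dr x) (is_derive_sin x)) _.
by rewrite /w /vs mulrCA divff ?mulr1 ?gt_eqF ?exprn_gt0 ?r0 //; ring.
Qed.

Lemma der_pressure_drop x : 0 <= x <= pi -> der x z (- (g * (w x * vs x))).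
Proof.
move=> xab; apply: der_eq (derB (der_cst x lam) (derZ g (der_height xab))) _.
by rewrite sub0r.
Qed.

(** The Euler-Lagrange equation once more: after the substitution, it is the
    equation for the derivative of vs. *)
Lemma der_shift x : 0 <= x <= pi -> der x vs (- (z x * y x / A x)).
Proof.
move=> xab; have rx := r0 xab; have Sx := S0 xab; have Ax := A0 xab.
have r2x : r x ^+ 2 != 0 by rewrite gt_eqF // exprn_gt0.
apply: der_eq (derM (derD (derM (dr x) (is_derive_cos x))
   (derM (dr1 x) (is_derive_sin x)))
   (@derV _ x (fun t => r t ^+ 2) _ r2x (derX 1 (dr x)))) _.
have EL : z x * S x ^+ 3 = sigma * (r x ^+ 2 + 2 * r1 x ^+ 2 - r x * r2 x).
  by rewrite euler_lagrange.
have -> : z x * y x / A x = (z x * S x ^+ 3) * sin x / (sigma * r x ^+ 3).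
  by rewrite /A /y; field; rewrite !gt_eqF.
by rewrite EL; field; rewrite !gt_eqF.
Qed.

(** The projection of the free surface onto the horizontal axis shows that its
    length is at least r 0 + r pi, which is the length of the wetted segment;
    the claim then follows from gam < sigma. *)
Lemma pressure_gt0 : 0 < lam.
Proof.
rewrite /lam /pressure divr_gt0 //.
have r00 : 0 < r 0 by apply: r0; rewrite lexx ltW.
have rpi : 0 < r pi by apply: r0; rewrite lexx ltW.
have G0 : 0 <= itg 0 pi (fun x => r x ^+ 3 * sin x).
  apply: itg_ge0 => x xab; rewrite mulr_ge0 ?exprn_ge0 ?(ltW (r0 xab)) //.
  exact: sin_ge0_pi.
have L0 : r 0 + r pi <= itg 0 pi S.
  have dx x : der x (fun t => - (r t * cos t)) (- (r1 x * cos x + r x * - sin x)).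
    exact: derN (derM (dr x) (is_derive_cos x)).
  have ac : abscont 0 pi (fun t => - (r t * cos t))
      (fun x => - (r1 x * cos x + r x * - sin x)).
    by apply: abscont_C1 => [|x _]; [cc_tac|exact: dx].
  have := abscont_itg (ltW pi0) ac.
  rewrite cos0 cospi => E.
  have -> : r 0 + r pi = itg 0 pi (fun x => - (r1 x * cos x + r x * - sin x)).
    by rewrite E; ring.
  apply: le_itg; [exact: ac.1|exact: ccL1|].
  move=> x xab; have Sx := S0 xab; have := S2 xab.
  have := cos2Dsin2 x; move: (cos x) (sin x) => c s cs1 SE.
  have : (- (r1 x * c + r x * - s)) ^+ 2 <= S x ^+ 2.
    have -> : S x ^+ 2 = (- (r1 x * c + r x * - s)) ^+ 2 + (r x * c + r1 x * s) ^+ 2.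
      by rewrite SE -[LHS]mulr1 -cs1; ring.
    by rewrite lerDl sqr_ge0.
  by move=> H; rewrite leNgt; apply/negP => h; nra.
have B0 : gam * (r 0 + r pi) < sigma * (r 0 + r pi).
  by rewrite ltr_pM2r ?addr_gt0 //; apply: le_lt_trans gs; exact: ler_norm.
have B1 : sigma * (r 0 + r pi) <= sigma * itg 0 pi S by rewrite ler_pM2l.
have := mulr_ge0 (ltW g0) G0; rewrite -/S; lra.
Qed.

Let y_ge0 x : 0 <= x <= pi -> 0 <= y x.
Proof.
move=> xab; rewrite mulr_ge0 ?(ltW (r0 xab)) //; exact: sin_ge0_pi.
Qed.
Let cw : cc 0 pi w. Proof. by rewrite /w; cc_tac. Qed.
Let cy : cc 0 pi y. Proof. by rewrite /y; cc_tac. Qed.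
Let cz : cc 0 pi z. Proof. by rewrite /z; cc_tac. Qed.
Let cvs : cc 0 pi vs.
Proof. by apply: cc_cont => x xab; exact: der_cont (der_shift xab). Qed.
Let cA : cc 0 pi A.
Proof. by rewrite /A; cc_tac. Qed.

(** Reflection symmetry of the profile. *)
Lemma derive_rho_mid : r1 (pi / 2) = 0.
Proof.
have sym : forall x, 0 <= x <= pi -> r (pi - x) = r x by case: eqr.
have h : (fun t => pi - t) (pi / 2 : R) = pi / 2 by rewrite /=; lra.
have d1 : der (pi / 2) (fun t => r (pi - t)) (r1 (pi / 2) * (0 - 1)).
  by apply: der_comp; [rewrite h; exact: dr|exact: derB (der_cst _ _) (der_id _)].
have d2 : der (pi / 2) r (r1 (pi / 2) * (0 - 1)).
  apply: der_near d1; near=> t; apply: sym; apply/andP; split.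
    by apply/ltW; near: t; apply: lt_nbhsr; rewrite divr_gt0.
  by apply/ltW; near: t; apply: lt_nbhsl; have := pi0; lra.
have := der_derive1 d2; rewrite -/r1; lra.
Unshelve. all: by end_near. Qed.

Let mid_in : 0 <= (pi / 2 : R) <= pi.
Proof. by have := pi0 => ?; apply/andP; split; lra. Qed.

(** The vertical component of the outer normal. *)
Let ny x := (r x * sin x - r1 x * cos x) / S x.

Let ny_sq x : 0 <= x <= pi -> w x ^+ 2 * vs x ^+ 2 + S x ^+ 2 * ny x ^+ 2 = S x ^+ 2.
Proof.
move=> xab; have rx := r0 xab; have Sx := S0 xab.
have -> : w x ^+ 2 * vs x ^+ 2 = (r x * cos x + r1 x * sin x) ^+ 2.
  by rewrite /w /vs; field; rewrite gt_eqF.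
have -> : S x ^+ 2 * ny x ^+ 2 = (r x * sin x - r1 x * cos x) ^+ 2.
  by rewrite /ny; field; rewrite gt_eqF.
by rewrite S2 // -[RHS]mulr1 -(cos2Dsin2 x); ring.
Qed.

Let der_ny x : 0 <= x <= pi -> der x ny (z x / sigma * (w x * vs x)).
Proof.
move=> xab; have rx := r0 xab; have Sx := S0 xab.
apply: der_eq (derM (derB (derM (dr x) (is_derive_sin x))
   (derM (dr1 x) (is_derive_cos x))) (derV _ (dS xab))) _.
  by rewrite gt_eqF.
have zE : z x = sigma * (r x ^+ 2 + 2 * r1 x ^+ 2 - r x * r2 x) / S x ^+ 3.
  by rewrite euler_lagrange // mulfK // gt_eqF // exprn_gt0.
apply: (@eq_trans _ _ (((r1 x * sin x + r x * cos x - (r2 x * cos x + r1 x * - sin x))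
  * S x ^+ 2 - (r x * sin x - r1 x * cos x) * (r1 x * (r x + r2 x))) / S x ^+ 3)).
  by field; rewrite gt_eqF.
rewrite S2 // zE /w /vs; field.
by rewrite !gt_eqF.
Qed.

(** Pressure drop and curvature balance: ny' = (z / sigma) y', while
    z' = - g y'. *)
Let first_integral x : 0 <= x <= pi ->
  z x ^+ 2 / 2 + g * sigma * ny x = z (pi / 2) ^+ 2 / 2 + g * sigma * ny (pi / 2).
Proof.
pose F x := z x ^+ 2 / 2 + g * sigma * ny x.
have dF t : 0 <= t <= pi -> der t F 0.
  move=> tab; apply: der_eq (derD (derM (derX 1 (der_pressure_drop tab)) (der_cst t 2^-1))
    (derZ (g * sigma) (der_ny tab))) _.
  by rewrite expr1 mulr0 addr0; field; rewrite gt_eqF.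
have aF : abscont 0 pi F (fun=> 0) by apply: abscont_C1 => //; exact: cc_cst.
have E a b : 0 <= a -> a <= b -> b <= pi -> F b = F a.
  move=> a0 ab bpi; have := aF.2 a b a0 ab bpi.
  have -> : itg a b (fun=> 0 : R) = 0 by exact: itg_zero.
  by move=> /esym/eqP; rewrite subr_eq0 => /eqP.
move=> /andP[x0 xpi]; have /andP[m0 mpi] := mid_in.
by have [xm|/ltW mx] := leP x (pi / 2); [rewrite -/(F x) -(E x (pi / 2))|
  rewrite -/(F x) (E (pi / 2) x)].
Qed.

Let ny_mid : ny (pi / 2) = 1.
Proof.
rewrite /ny cos_pihalf sin_pihalf mulr0 subr0 mulr1.
have rx := r0 mid_in.
suff -> : S (pi / 2) = r (pi / 2) by rewrite divff // gt_eqF.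
by rewrite /S /area_sq -/r1 derive_rho_mid expr0n addr0 sqrtr_sqr gtr0_norm.
Qed.

Let ny_le1 x : 0 <= x <= pi -> ny x <= 1.
Proof.
move=> xab; have := ny_sq xab; have Sx := S0 xab => E.
rewrite leNgt; apply/negP => n1.
have : S x ^+ 2 * 1 < S x ^+ 2 * ny x ^+ 2.
  by rewrite ltr_pM2l ?exprn_gt0 // expr_gt1 //; lra.
have := sqr_ge0 (w x * vs x); rewrite exprMn; lra.
Qed.

(** If z vanishes somewhere, the first integral and ny <= 1 give
    z^2 = 2 g sigma (1 - ny) everywhere.  Since z'^2 is g^2 D (1 - ny^2), this
    bounds |z'| by a multiple K of |z|, and Gronwall's argument propagates the
    zero to the left end, where z = lam > 0. *)
Lemma pressure_drop_neq0 x : 0 <= x <= pi -> z x != 0.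
Proof.
move=> xab; apply/eqP => zx0.
have gs0 : 0 < g * sigma by exact: mulr_gt0.
have zE t : 0 <= t <= pi -> z t ^+ 2 = 2 * (g * sigma) * (1 - ny t).
  have := first_integral xab; rewrite zx0 ny_mid expr0n /= mul0r add0r => Ex.
  have nx := ny_le1 xab.
  have zm : z (pi / 2) ^+ 2 = 0.
    apply/eqP; rewrite eq_le sqr_ge0 andbT.
    have : g * sigma * ny x <= g * sigma * 1 by rewrite ler_pM2l.
    lra.
  by move=> /first_integral; rewrite zm ny_mid; lra.
have [M M0 HM] : exists2 M : R, 0 < M & forall t, 0 <= t <= pi -> `|S t ^+ 2| <= M.
  by apply: cc_bound; cc_tac.
pose K := 1 + g * M / sigma.
have gM : 0 < g * M / sigma by rewrite divr_gt0 // mulr_gt0.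
have K2 : g * M / sigma <= K ^+ 2 by rewrite /K; nra.
have zz t : 0 <= t <= pi -> - (K * z t ^+ 2) <= z t * - (g * (w t * vs t)).
  move=> tab; have St := S0 tab.
  have h : (g * (w t * vs t)) ^+ 2 <= K ^+ 2 * z t ^+ 2.
    have n1 := ny_le1 tab; have nn := ny_sq tab.
    have q1 : (g * (w t * vs t)) ^+ 2 = g ^+ 2 * (S t ^+ 2 * ((1 - ny t) * (1 + ny t))).
      have -> : (g * (w t * vs t)) ^+ 2 = g ^+ 2 * (w t ^+ 2 * vs t ^+ 2) by ring.
      congr (_ * _); apply: (addIr (S t ^+ 2 * ny t ^+ 2)); rewrite nn; ring.
    have q2 : S t ^+ 2 * ((1 - ny t) * (1 + ny t)) <= M * ((1 - ny t) * 2).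
      have := HM t tab; rewrite gtr0_norm ?exprn_gt0 // => SM.
      have S20 : 0 < S t ^+ 2 by rewrite exprn_gt0.
      have a1 : (1 - ny t) * (1 + ny t) <= (1 - ny t) * 2 by nra.
      apply: le_trans (_ : _ <= S t ^+ 2 * ((1 - ny t) * 2)) _.
        by rewrite ler_pM2l.
      by apply: ler_wpM2r => //; rewrite mulr_ge0 //; lra.
    rewrite q1; apply: le_trans (_ : _ <= g ^+ 2 * (M * ((1 - ny t) * 2))) _.
      by rewrite ler_pM2l // exprn_gt0.
    have -> : g ^+ 2 * (M * ((1 - ny t) * 2)) = (g * M / sigma) * z t ^+ 2.
      by rewrite zE //; field; rewrite gt_eqF.
    by apply: ler_wpM2r => //; exact: sqr_ge0.
  have K0 : 0 < K by rewrite /K; lra.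
  have : `|g * (w t * vs t)| <= K * `|z t|.
    rewrite -[K]gtr0_norm // -normrM -ler_sqr ?nnegrE //.
    by rewrite !real_normK ?num_real // [leRHS]exprMn.
  move=> h2; have : `|z t * (g * (w t * vs t))| <= K * z t ^+ 2.
    rewrite normrM -[z t ^+ 2]real_normK ?num_real // expr2 [leRHS]mulrA mulrC.
    exact: ler_wpM2r.
  by rewrite ler_norml => /andP[]; lra.
(* P is nondecreasing, vanishes at x and equals lam ^+ 2 at 0 *)
pose P t := z t ^+ 2 * expR (2 * K * t).
pose dP t := (2 * (z t * - (g * (w t * vs t))) + 2 * K * z t ^+ 2) * expR (2 * K * t).
have dPd t : 0 <= t <= pi -> der t P (dP t).
  move=> tab; apply: der_eq (derM (derX 1 (der_pressure_drop tab))
    (der_comp (is_derive_expR _) (derZ (2 * K) (der_id t)))) _.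
  by rewrite /dP expr1; ring.
have cexp : cc 0 pi (fun t => expR (2 * K * t)).
  apply: cc_cont => t _.
  exact: der_cont (der_comp (is_derive_expR _) (derZ (2 * K) (der_id t))).
have aP : abscont 0 pi P dP.
  by apply: abscont_C1 => //; rewrite /dP; cc_tac.
have /andP[x0 xpi] := xab.
have := aP.2 0 x (lexx _) x0 xpi.
have : 0 <= itg 0 x dP.
  apply: itg_ge0 => t /andP[t0 tx]; rewrite /dP mulr_ge0 ?expR_ge0 //.
  have := zz t; have -> : 0 <= t <= pi by apply/andP; split; lra.
  by move=> /(_ isT); lra.
have P0 : P 0 = lam ^+ 2.
  by rewrite /P /z /y sin0 !mulr0 subr0 expR0 mulr1.
have Px : P x = 0 by rewrite /P zx0 expr0n mul0r.
move=> h1 h2; have := exprn_gt0 2 pressure_gt0; rewrite h2 Px P0 in h1; lra.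
Qed.

Lemma pressure_drop_gt0 x : 0 <= x <= pi -> 0 < z x.
Proof.
move=> /andP[x0 xpi]; rewrite ltNge; apply/negP => zx.
have z0 : z 0 = lam by rewrite /z /y sin0 !mulr0 subr0.
have czx : {within `[0, x], continuous z} by apply: ccS cz.
have [|c] := @IVT R z 0 x 0 x0 czx.
  by rewrite z0 (min_idPr _) ?(max_idPl _) ?zx ?(ltW pressure_gt0) //;
     apply: le_trans zx (ltW pressure_gt0).
rewrite in_itv /= => /andP[c0 cx] zc.
have := @pressure_drop_neq0 c; rewrite zc eqxx => /(_ _)/negP; apply => //.
by rewrite c0 (le_trans cx xpi).
Qed.

(** * The second variation of the energy *)
Local Notation mu := (@lebesgue_measure R).
Implicit Types (f h F dF : R -> R).

Let dy x : 0 <= x <= pi -> der x y (w x * vs x). Proof. exact: der_height. Qed.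
Let dvs x : 0 <= x <= pi -> der x vs (- (z x * y x / A x)). Proof. exact: der_shift. Qed.
Let dz x : 0 <= x <= pi -> der x z (- (g * (w x * vs x))).
Proof. exact: der_pressure_drop. Qed.

Let coercive : exists2 C : R, 0 < C & forall v dv : R -> R,
  abscont 0 pi v dv -> sqint 0 pi dv ->
  itg 0 pi (fun x => w x * v x) = 0 -> itg 0 pi (fun x => w x * vs x * v x) = 0 ->
  C * (itg 0 pi (fun x => v x ^+ 2) + itg 0 pi (fun x => dv x ^+ 2)) <=
  itg 0 pi (qform g A w y z v dv).
Proof.
apply: (@form_coercive _ g lam A w y z vs) => //.
- exact: pressure_gt0.
- by move=> x; exact: pressure_drop_gt0.
- by rewrite /y sin0 mulr0.
- by rewrite /y sinpi mulr0.
- move=> x /andP[x0 xpi]; rewrite /y mulr_gt0 //; last by apply: sin_gt0_pi; rewrite x0.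
  by apply: r0; rewrite !ltW.
- by rewrite /vs cos_pihalf derive_rho_mid mulr0 mul0r addr0 mul0r.
Qed.

Let gden f h x := r x * f x * h x * sin x.
Let sden f df h dh x := (r x ^+ 2 * df x * dh x - r x * r1 x * (df x * h x + f x * dh x)
     + (r2 x * r x - r1 x ^+ 2 - r x ^+ 2) * f x * h x) / S x ^+ 3.

Let bilinear_formE f h : bilinear_form g sigma r f h =
  g * itg 0 pi (gden f h) + sigma * itg 0 pi (sden f (wder f) h (wder h)).
Proof.
rewrite /bilinear_form; congr (_ + _ * _); apply: eq_itg => x xab.
rewrite /sden; congr (_ / _).
rewrite -/(area_sq r x) /S -powR12_sqrt; last exact/ltW/D0.
by rewrite -powR_mulrn ?powR_ge0 // -powRrM mulrC.
Qed.

Let measurable_gden f h : measurable_fun dom0pi f -> measurable_fun dom0pi h ->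
  measurable_fun dom0pi (gden f h).
Proof.
have mc k : cc 0 pi k -> measurable_fun (@dom0pi R) k.
  by move=> ck; apply: measurable_cc_dom; exact: cc_measurable.
move=> mf mh; apply: measurable_funM; last exact: mc.
by apply: measurable_funM => //; apply: measurable_funM => //; exact: mc.
Qed.

Let measurable_sden f df h dh : measurable_fun dom0pi f -> measurable_fun dom0pi df ->
  measurable_fun dom0pi h -> measurable_fun dom0pi dh ->
  measurable_fun dom0pi (sden f df h dh).
Proof.
have mc k : cc 0 pi k -> measurable_fun (@dom0pi R) k.
  by move=> ck; apply: measurable_cc_dom; exact: cc_measurable.
move=> mf mdf mh mdh; apply: measurable_funM; last exact: mc.
apply: measurable_funD; first apply: measurable_funB.
- by do 2 apply: measurable_funM => //; apply: mc; cc_tac.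
- apply: measurable_funM; first by apply: mc; cc_tac.
  by apply: measurable_funD; apply: measurable_funM.
- by do 2 apply: measurable_funM => //; apply: mc; cc_tac.
Qed.

(** The form only sees the class almost everywhere of a function and of its weak
    derivative, so it can be computed on absolutely continuous
    representatives. *)
Let ae_form f df h dh F dF H dH :
  measurable_fun dom0pi f -> measurable_fun dom0pi df ->
  measurable_fun dom0pi h -> measurable_fun dom0pi dh ->
  measurable_fun dom0pi F -> measurable_fun dom0pi dF ->
  measurable_fun dom0pi H -> measurable_fun dom0pi dH ->
  {ae mu, forall x, dom0pi x -> f x = F x} -> {ae mu, forall x, dom0pi x -> df x = dF x} ->
  {ae mu, forall x, dom0pi x -> h x = H x} -> {ae mu, forall x, dom0pi x -> dh x = dH x} ->
  g * itg 0 pi (gden f h) + sigma * itg 0 pi (sden f df h dh) =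
  g * itg 0 pi (gden F H) + sigma * itg 0 pi (sden F dF H dH).
Proof.
move=> mf mdf mh mdh mF mdF mH mdH fF dfF hH dhH.
have all := ae_and (ae_and fF dfF) (ae_and hH dhH).
congr (_ * _ + _ * _); apply: itg_ae; [exact: measurable_gden|exact: measurable_gden| |
  exact: measurable_sden|exact: measurable_sden|].
- by apply: ae_imp all => x [[h1 h2] [h3 h4]] xd; rewrite /gden h1 // h3.
- by apply: ae_imp all => x [[h1 h2] [h3 h4]] xd; rewrite /sden h1 // h2 // h3 // h4.
Qed.

Let dividend F dF x := dF x / r x - F x * r1 x / r x ^+ 2.

(** The curvature equation eliminates r''. *)
Let density_square F dF x : 0 <= x <= pi ->
  g * gden F F x + sigma * sden F dF F dF x =
  qform g A w y z (fun x => F x / r x) (dividend F dF) x.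
Proof.
move=> xab; have rx := r0 xab; have Sx := S0 xab.
have E : sigma * (r2 x * r x) = sigma * (r x ^+ 2 + 2 * r1 x ^+ 2) - z x * S x ^+ 3.
  by rewrite -euler_lagrange //; ring.
have -> : sigma * sden F dF F dF x =
   (sigma * (r x ^+ 2 * dF x ^+ 2 - 2 * r x * r1 x * dF x * F x - (r1 x ^+ 2 + r x ^+ 2) * F x ^+ 2)
    + sigma * (r2 x * r x) * F x ^+ 2) / S x ^+ 3.
  by rewrite /sden; ring.
rewrite E /gden /qform /dividend /A /w /y; field.
by rewrite !gt_eqF.
Qed.

Let dxi x := r1 x * vs x - r x * (z x * y x / A x).
Let xiE x : 0 <= x <= pi -> xi_s r x = r x * vs x.
Proof.
by move=> xab; rewrite /xi_s -/(r1 x) /vs; field; rewrite gt_eqF // r0.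
Qed.

(** The right-hand side is the derivative of - z y v. *)
Let density_shift F dF x : 0 <= x <= pi ->
  g * gden F (fun x => r x * vs x) x +
  sigma * sden F dF (fun x => r x * vs x) dxi x =
  - ((- (g * (w x * vs x)) * y x + z x * (w x * vs x)) * (F x / r x) +
     z x * y x * dividend F dF x).
Proof.
move=> xab; have rx := r0 xab; have Sx := S0 xab.
have E : sigma * (r2 x * r x) = sigma * (r x ^+ 2 + 2 * r1 x ^+ 2) - z x * S x ^+ 3.
  by rewrite -euler_lagrange //; ring.
have -> : sigma * sden F dF (fun x => r x * vs x) dxi x =
   (sigma * (r x ^+ 2 * dF x * dxi x - r x * r1 x * (dF x * (r x * vs x) + F x * dxi x)
      - (r1 x ^+ 2 + r x ^+ 2) * F x * (r x * vs x))
    + sigma * (r2 x * r x) * F x * (r x * vs x)) / S x ^+ 3.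
  by rewrite /sden; ring.
rewrite E /gden /dividend /dxi /A /w.
have -> : sin x = y x / r x by rewrite /y; field; rewrite gt_eqF.
by field; rewrite !gt_eqF.
Qed.

Let quotient F dF : abscont 0 pi F dF -> sqint 0 pi dF ->
  abscont 0 pi (fun x => F x / r x) (dividend F dF) /\ sqint 0 pi (dividend F dF).
Proof.
move=> aF sF; have cF := abscont_cc aF.
have ai : abscont 0 pi (fun x => (r x)^-1) (fun x => - r1 x / r x ^+ 2).
  apply: abscont_C1; first by cc_tac.
  by move=> x xab; apply: derV => //; rewrite gt_eqF // r0.
split.
  by apply: abscont_eq (abscontM aF ai) => // x _; rewrite /dividend; ring.
apply: sqintB.
  have [h1 h2] := sqint_ccM cir sF.
  by split; [apply: L1_eq h1|apply: L1_eq h2] => x _; rewrite mulrC.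
by apply: sqint_cc; cc_tac.
Qed.

Let L1_sden f df h dh : cc 0 pi f -> cc 0 pi h -> sqint 0 pi df -> sqint 0 pi dh ->
  L1 0 pi (sden f df h dh).
Proof.
move=> cf ch sdf sdh; have I := sqint_L1M sdf sdh.
have c1 : cc 0 pi (fun x => r x ^+ 2 / S x ^+ 3) by cc_tac.
have c2 : cc 0 pi (fun x => r x * r1 x * h x / S x ^+ 3) by cc_tac.
have c3 : cc 0 pi (fun x => r x * r1 x * f x / S x ^+ 3) by cc_tac.
have c4 : cc 0 pi (fun x => (r2 x * r x - r1 x ^+ 2 - r x ^+ 2) * f x * h x / S x ^+ 3).
  by cc_tac.
apply: L1_eq (L1D (L1B (L1B (ccL1M c1 I) (ccL1M c2 sdf.1)) (ccL1M c3 sdh.1)) (ccL1 c4)).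
by move=> x _; rewrite /sden; ring.
Qed.

Let L1_gden f h : cc 0 pi f -> cc 0 pi h -> L1 0 pi (gden f h).
Proof. by move=> cf ch; rewrite /gden; L1_tac. Qed.

Let form_density f df h dh q : cc 0 pi f -> cc 0 pi h -> sqint 0 pi df -> sqint 0 pi dh ->
  (forall x, 0 <= x <= pi -> g * gden f h x + sigma * sden f df h dh x = q x) ->
  g * itg 0 pi (gden f h) + sigma * itg 0 pi (sden f df h dh) = itg 0 pi q.
Proof.
move=> cf ch sdf sdh E; have I1 := L1_gden cf ch; have I2 := L1_sden cf ch sdf sdh.
by rewrite -itgZ // -itgZ // -itgD; [exact: eq_itg|exact: L1Z|exact: L1Z].
Qed.

Let mcc k : cc 0 pi k -> measurable_fun (@dom0pi R) k.
Proof. by move=> ck; apply: measurable_cc_dom; exact: cc_measurable. Qed.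

Let cdxi : cc 0 pi dxi.
Proof.
have ciA : cc 0 pi (fun x => (A x)^-1) by apply: ccV => // x /A0 xA; rewrite gt_eqF.
by rewrite /dxi; cc_tac.
Qed.

Lemma shift_sobolev : weak1 dom0pi 1 (xi_s r) dxi /\ abscont 0 pi (xi_s r) dxi.
Proof.
have a : abscont 0 pi (fun x => r x * vs x) dxi.
  apply: abscont_C1 => // x xab.
  by apply: der_eq (derM (dr x) (dvs xab)) _; rewrite mulrN.
have a' : abscont 0 pi (xi_s r) dxi by apply: abscont_eq a => // x xab; rewrite xiE.
by split=> //; exact: weak1_abscont.
Qed.

(** The integrand r xi_s = w vs is y'. *)
Lemma itg_profile_shift : itg 0 pi (fun x => r x * xi_s r x) = 0.
Proof.
have ay : abscont 0 pi y (fun x => w x * vs x) by apply: abscont_C1 => //; cc_tac.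
rewrite (@eq_itg _ _ _ _ (fun x => w x * vs x)); last first.
  by move=> x xab; rewrite xiE // /w; ring.
by rewrite (abscont_itg (ltW pi0) ay) /y sinpi sin0 !mulr0 subrr.
Qed.

(** Invariance of the energy under horizontal translations; the density of the
    form is a derivative by [density_shift]. *)
Lemma shift_in_kernel f : sobolevH1 f -> bilinear_form g sigma r f (xi_s r) = 0.
Proof.
move=> [wf sf sdf]; have [F aF fF] := sobolev_representative wf sdf.1.
have [av sdv] := quotient aF sdf; have cF := abscont_cc aF.
have [wxi axi] := shift_sobolev.
have wxi' : weak1 dom0pi 1 (xi_s r) (wder (xi_s r)).
  by have := @xgetPex _ (cst 0) [set h | weak1 dom0pi 1 (xi_s r) h]; apply; exists dxi.
have dd := weak1_unique wxi' wxi.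
rewrite bilinear_formE.
have [[mf _ _] [mdf _ _] _] := wf; have [[mx _ _] [mdx _ _] _] := wxi'.
rewrite (@ae_form f (wder f) (xi_s r) (wder (xi_s r)) F (wder f) (fun x => r x * vs x) dxi) //.
- have ayz : abscont 0 pi (fun x => z x * y x)
      (fun x => - (g * (w x * vs x)) * y x + z x * (w x * vs x)).
    apply: abscontM; apply: abscont_C1 => //; cc_tac.
  have aE := abscontM ayz av.
  rewrite (form_density _ _ _ _ (@density_shift F (wder f))) //.
  + rewrite itgN; last exact: aE.1.
    by rewrite (abscont_itg (ltW pi0) aE) /y sin0 sinpi !(mulr0, mul0r) subrr oppr0.
  + by cc_tac.
  + exact: sqint_cc.
- exact: mcc.
- by apply: mcc; cc_tac.
- have [_ [mm _ _] _] := wxi; exact: mm.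
- exact: aeW.
- by apply: aeW => x; rewrite /dom0pi /= in_itv /= => /andP[x0 xp]; rewrite xiE // !ltW.
Qed.

(** Transfers [form_coercive] from v to f = r v: the constraints correspond, and
    multiplication by r is bounded in H^1. *)
Lemma sobolev_coercive : exists2 C : R, 0 < C & forall f, sobolevH1 f ->
  itg 0 pi (fun x => r x * f x) = 0 -> itg 0 pi (fun x => f x * xi_s r x) = 0 ->
  C * (itg 0 pi (fun x => f x ^+ 2) + itg 0 pi (fun x => wder f x ^+ 2)) <=
  bilinear_form g sigma r f f.
Proof.
have [C C0 HC] := coercive.
have [M M0 HM] := cc_bound cr; have [N N0 HN] := cc_bound cr1.
have K0 : 0 < M ^+ 2 + 2 * M ^+ 2 + 2 * N ^+ 2.
  by rewrite !addr_gt0 ?mulr_gt0 ?exprn_gt0.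
exists (C / (M ^+ 2 + 2 * M ^+ 2 + 2 * N ^+ 2)); first by rewrite divr_gt0.
move=> f [wf sf sdf] Z1 Z2; have [F aF fF] := sobolev_representative wf sdf.1.
have [av sdv] := quotient aF sdf; have cF := abscont_cc aF.
have cv := abscont_cc av.
have [[mf _ _] [mdf _ _] _] := wf.
have mF := mcc cF.
rewrite bilinear_formE (@ae_form f (wder f) f (wder f) F (wder f) F (wder f)) //;
  [|exact: aeW|exact: aeW].
rewrite (form_density cF cF sdf sdf (@density_square F (wder f))).
have Z1' : itg 0 pi (fun x => w x * (F x / r x)) = 0.
  rewrite -[RHS]Z1 (@eq_itg _ _ _ _ (fun x => r x * F x)); last first.
    by move=> x xab; rewrite /w; field; rewrite gt_eqF // r0.
  apply: itg_ae; [by apply: mcc; cc_tac|by apply: measurable_funM => //; exact: mcc|].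
  by apply: ae_imp fF => x h xd; rewrite h.
have Z2' : itg 0 pi (fun x => w x * vs x * (F x / r x)) = 0.
  rewrite -[RHS]Z2 (@eq_itg _ _ _ _ (fun x => F x * (r x * vs x))); last first.
    by move=> x xab; rewrite /w; field; rewrite gt_eqF // r0.
  rewrite [RHS](@eq_itg _ _ _ _ (fun x => f x * (r x * vs x))); last first.
    by move=> x xab; rewrite xiE.
  apply: itg_ae; first by apply: mcc; cc_tac.
    by apply: measurable_funM => //; apply: mcc; cc_tac.
  by apply: ae_imp fF => x h xd; rewrite h.
have H := HC _ _ av sdv Z1' Z2'.
rewrite mulrAC -mulrA; apply: le_trans H; apply: ler_wpM2l; first exact: ltW.
rewrite ler_pdivrMr //.
have c2 : cc 0 pi (fun x => (F x / r x) ^+ 2) by cc_tac.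
have -> : itg 0 pi (fun x => f x ^+ 2) = itg 0 pi (fun x => F x ^+ 2).
  apply: itg_ae; [exact: measurable_funX|by apply: mcc; cc_tac|].
  by apply: ae_imp fF => x h xd; rewrite h.
set v2 := itg 0 pi (fun x => (F x / r x) ^+ 2).
set d2 := itg 0 pi (fun x => dividend F (wder f) x ^+ 2).
have v20 : 0 <= v2 by apply: itg_ge0 => x _; exact: sqr_ge0.
have d20 : 0 <= d2 by apply: itg_ge0 => x _; exact: sqr_ge0.
have rM x : 0 <= x <= pi -> r x ^+ 2 <= M ^+ 2.
  move=> xab; have rx := r0 xab; have := HM x xab; rewrite gtr0_norm // => h.
  by rewrite ler_sqr ?nnegrE // ltW.
have rN x : 0 <= x <= pi -> r1 x ^+ 2 <= N ^+ 2.
  move=> xab; have h := HN x xab; rewrite -real_normK ?num_real //.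
  by rewrite ler_sqr ?nnegrE // ltW.
have h1 : itg 0 pi (fun x => F x ^+ 2) <= M ^+ 2 * v2.
  rewrite -itgZ; last exact: ccL1.
  apply: le_itg; [by L1_tac|exact/L1Z/ccL1|] => x xab.
  have rx := r0 xab; have -> : F x ^+ 2 = r x ^+ 2 * (F x / r x) ^+ 2.
    by field; rewrite gt_eqF.
  by apply: ler_wpM2r; [exact: sqr_ge0|exact: rM].
have h2 : itg 0 pi (fun x => wder f x ^+ 2) <= 2 * M ^+ 2 * d2 + 2 * N ^+ 2 * v2.
  rewrite -itgZ; last exact: sdv.2.
  rewrite -itgZ; last exact: ccL1.
  rewrite -itgD; [|exact: L1Z sdv.2|exact/L1Z/ccL1].
  apply: le_itg; [exact: sdf.2|by apply: L1D; [exact: L1Z sdv.2|exact/L1Z/ccL1]|] => x xab.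
  have rx := r0 xab.
  have -> : wder f x = r x * dividend F (wder f) x + r1 x * (F x / r x).
    by rewrite /dividend; field; rewrite gt_eqF.
  apply: le_trans (sqrD_le _ _) _.
  have q1 := ler_wpM2r (sqr_ge0 (dividend F (wder f) x)) (rM x xab).
  have q2 := ler_wpM2r (sqr_ge0 (F x / r x)) (rN x xab).
  have e1 : (r x * dividend F (wder f) x) ^+ 2 = r x ^+ 2 * dividend F (wder f) x ^+ 2.
    by rewrite exprMn.
  have e2 : (r1 x * (F x / r x)) ^+ 2 = r1 x ^+ 2 * (F x / r x) ^+ 2 by rewrite exprMn.
  by rewrite e1 e2; apply: lerD; rewrite -[leRHS]mulrA; apply: ler_wpM2l.
have M2 : 0 <= M ^+ 2 by exact: sqr_ge0.
have N2 : 0 <= N ^+ 2 by exact: sqr_ge0.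
have p1 := mulr_ge0 M2 d20; have p2 := mulr_ge0 M2 v20; have p3 := mulr_ge0 N2 d20.
exact: sobolev_arith h1 h2 p1 p2 p3.
Qed.

End profile.

(** * Time derivatives of integrals *)
Section time_derivatives.
Context {R : realType}.
Implicit Types (t s T : R) (phi : R -> R) (f h : R -> R -> R).

Lemma der_lim x (F : R -> R) d :
  (fun s : R => s^-1 * (F (x + s) - F x)) @ 0^' --> d -> der x F d.
Proof.
move=> H; have H' : (fun s : R => s^-1 *: ((F \o shift x) (s *: 1) - F x)) @ 0^' --> d.
  apply: cvg_trans H; apply: near_eq_cvg; near=> s.
  by rewrite /= /GRing.scale /= mulr1 [s + x]addrC.
apply: DeriveDef; first by apply/cvg_ex; exists d.
exact: cvg_lim.
Unshelve. all: by end_near. Qed.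

(** The function whose L2 norm tends to 0 in the definition of the derivative. *)
Definition remainder f (f' : R -> R -> R) t s : R -> R :=
  fun x => s^-1 * (f (t + s) x - f t x) - f' t x.

Lemma near_time t T : 0 < t < T -> \forall s \near (0:R)^', 0 < t + s < T.
Proof.
move=> /andP[t0 tT]; near=> s.
have st : `|s| < t by near: s; apply: dnbhs0_lt.
have sT : `|s| < T - t by near: s; apply: dnbhs0_lt; rewrite subr_gt0.
by move: st sT; rewrite !ltr_norml => /andP[? ?] /andP[? ?]; apply/andP; split; lra.
Unshelve. all: by end_near. Qed.

Section pair.
Variables (T : R) (f f' h h' : R -> R -> R).
Hypotheses (sf : forall t, 0 < t < T -> sqint 0 pi (f t))
           (sf' : forall t, 0 < t < T -> sqint 0 pi (f' t))
           (sh : forall t, 0 < t < T -> sqint 0 pi (h t))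
           (sh' : forall t, 0 < t < T -> sqint 0 pi (h' t)).
Hypotheses (df : time_deriv L2 T f f') (dh : time_deriv L2 T h h').

Let sqint_remainder k k' t s :
  sqint 0 pi (k (t + s)) -> sqint 0 pi (k t) -> sqint 0 pi (k' t) ->
  sqint 0 pi (remainder k k' t s).
Proof. by move=> s1 s2 s3; apply: sqintB => //; apply: sqintZ; exact: sqintB. Qed.

Let norm_cvg k k' t : 0 < t < T ->
  (forall t, 0 < t < T -> sqint 0 pi (k t)) -> (forall t, 0 < t < T -> sqint 0 pi (k' t)) ->
  time_deriv L2 T k k' ->
  (fun s => itg 0 pi (fun x => remainder k k' t s x ^+ 2)) @ 0^' --> (0 : R).
Proof.
move=> tT sk sk' dk; have H := dk t tT.
have H2 : (fun s => L2 (remainder k k' t s) * L2 (remainder k k' t s))%E @ 0^' --> 0%E.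
  by rewrite -[X in _ --> X](mule0 0%E); apply: cvgeM.
apply: (@cvg_trans _ ((fine \o (fun s => (L2 (remainder k k' t s) * L2 (remainder k k' t s))%E)) @ 0^')); last first.
  by apply: fine_cvg.
apply: near_eq_cvg; near=> s => /=.
have ts : 0 < t + s < T by near: s; exact: near_time.
by rewrite -expe2 L2_sq //; apply: sqint_remainder; [exact: sk|exact: sk|exact: sk'].
Unshelve. all: by end_near. Qed.

Let pair_cvg (a b : R -> R -> R) (M : R) :
  (\forall s \near (0:R)^', sqint 0 pi (a s) /\ sqint 0 pi (b s)) ->
  (\forall s \near (0:R)^', itg 0 pi (fun x => b s x ^+ 2) <= M) ->
  (fun s => itg 0 pi (fun x => a s x ^+ 2)) @ 0^' --> (0 : R) ->
  (fun s => itg 0 pi (fun x => a s x * b s x)) @ 0^' --> (0 : R).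
Proof.
move=> sab bM ca; apply/cvgr0Pnorm_lt => e e0.
have M1 : 0 < `|M| + 1 by rewrite ltr_wpDl.
move/cvgr0Pnorm_lt: ca => /(_ (e ^+ 2 / (`|M| + 1))) ca.
near=> s.
have [sa sb] : sqint 0 pi (a s) /\ sqint 0 pi (b s) by near: s.
have := cauchy_schwarz sa sb.
have Mb : itg 0 pi (fun x => b s x ^+ 2) <= `|M| + 1.
  apply: le_trans (_ : M <= _); first by near: s.
  by have := ler_norm M; lra.
have Na : `|itg 0 pi (fun x => a s x ^+ 2)| < e ^+ 2 / (`|M| + 1).
  by near: s; apply: ca; rewrite divr_gt0 // exprn_gt0.
have a0 : 0 <= itg 0 pi (fun x => a s x ^+ 2) by apply: itg_ge0 => x _; exact: sqr_ge0.
rewrite ger0_norm // ltr_pdivlMr // in Na.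
move=> cs; rewrite -ltr_sqr ?nnegrE ?(ltW e0) // real_normK ?num_real //.
apply: le_lt_trans cs _; apply: le_lt_trans Na.
exact: ler_wpM2l.
Unshelve. all: by end_near. Qed.

Lemma inner_deriv t : 0 < t < T ->
  der t (fun t => itg 0 pi (fun x => f t x * h t x))
    (itg 0 pi (fun x => f' t x * h t x) + itg 0 pi (fun x => f t x * h' t x)).
Proof.
move=> tT; have nf := norm_cvg tT sf sf' df; have nh := norm_cvg tT sh sh' dh.
pose e s := remainder f f' t s; pose d s := remainder h h' t s.
have near_e : \forall s \near (0:R)^', sqint 0 pi (e s).
  near=> s; have ts : 0 < t + s < T by near: s; exact: near_time.
  by apply: sqint_remainder; [exact: sf|exact: sf|exact: sf'].
have near_d : \forall s \near (0:R)^', sqint 0 pi (d s).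
  near=> s; have ts : 0 < t + s < T by near: s; exact: near_time.
  by apply: sqint_remainder; [exact: sh|exact: sh|exact: sh'].
have cst_bound (k : R -> R) : \forall s \near (0:R)^', itg 0 pi (fun x => k x ^+ 2) <= itg 0 pi (fun x => k x ^+ 2).
  by near=> s.
have c1 k : sqint 0 pi k -> (fun s => itg 0 pi (fun x => e s x * k x)) @ 0^' --> (0 : R).
  move=> sk; apply: (@pair_cvg e (fun=> k)) nf; last exact: cst_bound.
  by near=> s; split => //; near: s.
have c2 k : sqint 0 pi k -> (fun s => itg 0 pi (fun x => d s x * k x)) @ 0^' --> (0 : R).
  move=> sk; apply: (@pair_cvg d (fun=> k)) nh; last exact: cst_bound.
  by near=> s; split => //; near: s.
have c3 : (fun s => itg 0 pi (fun x => e s x * d s x)) @ 0^' --> (0 : R).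
  apply: (@pair_cvg e d 1) nf.
    by near=> s; split; near: s.
  near=> s; apply: le_trans (ler_norm _) _; near: s.
  by move/cvgr0Pnorm_le : nh; apply.
have cid : (fun s : R => s) @ 0^' --> (0 : R) by apply: cvg_within_filter; exact: cvg_id.
apply: der_lim.
set L := (X in _ --> X).
(* the error of the product rule, bilinear in the two remainders and the data *)
pose rem s := itg 0 pi (fun x => e s x * h t x) + itg 0 pi (fun x => d s x * f t x) +
  s * (itg 0 pi (fun x => f' t x * h' t x) + itg 0 pi (fun x => d s x * f' t x) +
    itg 0 pi (fun x => e s x * h' t x) + itg 0 pi (fun x => e s x * d s x)).
have crem : (fun s => L + rem s) @ 0^' --> L.
  rewrite -[X in _ --> X]addr0; apply: cvgD; first exact: cvg_cst.
  rewrite -[X in _ --> X](_ : 0 + 0 + 0 * (itg 0 pi (fun x => f' t x * h' t x) + 0 + 0 + 0) = 0);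
    last by rewrite mul0r !addr0.
  apply: cvgD; first by apply: cvgD; [exact/c1/sh|exact/c2/sf].
  apply: cvgM => //; apply: cvgD => //; apply: cvgD; last exact/c1/sh'.
  by apply: cvgD; [exact: cvg_cst|exact/c2/sf'].
apply: cvg_trans crem; apply: near_eq_cvg; near=> s.
have s0 : s != 0 by near: s; exact: nbhs_dnbhs_neq.
have ts : 0 < t + s < T by near: s; exact: near_time.
have se : sqint 0 pi (e s) by near: s.
have sd : sqint 0 pi (d s) by near: s.
have [f1 f2 h1 h2] : [/\ sqint 0 pi (f t), sqint 0 pi (f' t), sqint 0 pi (h t) & sqint 0 pi (h' t)].
  by split; [exact: sf|exact: sf'|exact: sh|exact: sh'].
have I a b : sqint 0 pi a -> sqint 0 pi b -> L1 0 pi (fun x => a x * b x).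
  exact: sqint_L1M.
apply/esym; rewrite -itgB; [|exact: I (sf ts) (sh ts)|exact: I].
rewrite -itgZ; last by apply: L1B; [exact: I (sf ts) (sh ts)|exact: I].
rewrite /L /rem -!itgD; try by do ?[apply: L1D]; apply: I.
rewrite -itgZ; last by do ?[apply: L1D]; apply: I.
rewrite -!itgD; try by do ?[apply: L1Z|apply: L1D]; apply: I.
by apply: eq_itg => x _; rewrite /e /d /remainder; field.
Unshelve. all: by end_near. Qed.

End pair.

End time_derivatives.

(** * The energy controls the perturbation *)
Section energy_bounds.
Context {R : realType}.

Lemma vec_sq_ge0 (N : (R * R -> R) -> \bar R) u :
  (forall f, 0 <= N f)%E -> (0 <= vec_sq N u)%E.
Proof. by move=> N0; apply: adde_ge0; apply: expe_ge0. Qed.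

Lemma H1_le_energy (rho0 : R -> R) em ep al u p pole xi t k : (k < 3)%N ->
  (H1 (xi k t) ^+ 2 <= total_energy rho0 em ep al u p pole xi t)%E.
Proof.
move=> k3; rewrite /total_energy; cbv zeta.
have sob_ge0 (m : nat) (q : R) f : (0 <= sob2 (fluid_domain rho0) m q f)%E by exact: poweR_ge0.
have slob_ge0 (m : nat) (s q : R) f : (0 <= slob2 (fluid_domain rho0) m s q f)%E by exact: poweR_ge0.
have slob1_ge0 (m : nat) (s q : R) f : (0 <= slob1 m s q f)%E by exact: poweR_ge0.
have H1_ge0 f : (0 <= H1 f)%E by exact: poweR_ge0.
have drop (a b c : \bar R) : (0 <= c)%E -> (a <= b)%E -> (a <= b + c)%E.
  by move=> c0 /le_trans; apply; rewrite leeDl.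
do 9 (apply: (drop); first by [apply: vec_sq_ge0 | apply: expe_ge0 |
  rewrite lee_fin addr_ge0 ?sqr_ge0]).
have term_ge0 (i : 'I_3) : (0 <= vec_sq (sob2 (fluid_domain rho0) 0 2) (u i t) + H1 (xi i t) ^+ 2)%E.
  by apply: adde_ge0; [exact: vec_sq_ge0|exact: expe_ge0].
rewrite (bigD1 (Ordinal k3)) //= -[leLHS]adde0; apply: leeD; last first.
  by apply: sume_ge0 => i _; exact: term_ge0.
by rewrite -[leLHS]add0e; apply: leeD => //; exact: vec_sq_ge0.
Qed.

End energy_bounds.

Section corrected_perturbation.
Context {R : realType}.
Variables (r : R -> R).
Hypotheses (sr : smooth1 r).
Implicit Types (f : R -> R) (a : R).
Local Notation mu := (@lebesgue_measure R).
Local Notation H1sq f := (itg 0 pi (fun x => f x ^+ 2) + itg 0 pi (fun x => wder f x ^+ 2)).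

(** Correcting f by a multiple a of the profile costs a^2 in the H^1 norm. *)
Lemma sobolev_sub_smooth f a : sobolevH1 f -> sobolevH1 (fun x => f x - a * r x) /\
  H1sq f <= 2 * H1sq (fun x => f x - a * r x) +
    2 * a ^+ 2 * (itg 0 pi (fun x => r x ^+ 2) + itg 0 pi (fun x => derive1 r x ^+ 2)).
Proof.
move=> [wf sf sdf]; set h := fun x => f x - a * r x.
have cr : cc 0 pi r by exact: cc_smooth.
have cr1 : cc 0 pi (derive1 r) by exact/cc_smooth/smooth_derive1.
have car : cc 0 pi (fun x => a * r x) by cc_tac.
have ar : abscont 0 pi (fun x => a * r x) (fun x => a * derive1 r x).
  by apply: abscontZ; apply: abscont_C1 => // x _; exact: smooth_der.
have wr := weak1_abscont ar.
have wh : weak1 dom0pi 1 h (fun x => wder f x - a * derive1 r x).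
  have [lf lg _] := wf; have [lr lr1 _] := wr.
  split; [exact: loc_sub|exact: loc_sub|move=> phi tphi].
  by rewrite expr1 mulN1r derive1n1; exact: weak1B wf wr tphi.
have wh' : weak1 dom0pi 1 h (wder h).
  have := @xgetPex _ (cst 0) [set k | weak1 dom0pi 1 h k]; apply.
  by exists (fun x => wder f x - a * derive1 r x).
have ae := weak1_unique wh' wh.
have sh : sqint 0 pi h by apply: sqintB => //; apply: sqintZ; exact: sqint_cc.
have sdh0 : sqint 0 pi (fun x => wder f x - a * derive1 r x).
  by apply: sqintB => //; apply: sqintZ; exact: sqint_cc.
have [_ [mdh _ _] _] := wh'; have [_ [mdh0 _ _] _] := wh.
have E : itg 0 pi (fun x => wder h x ^+ 2) =
    itg 0 pi (fun x => (wder f x - a * derive1 r x) ^+ 2).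
  apply: itg_ae; [exact: measurable_funX|exact: measurable_funX|].
  by apply: ae_imp ae => x H xd; rewrite H.
have sdh : sqint 0 pi (wder h).
  apply: sqint_dom => //.
  rewrite (_ : (\int[mu]_(x in dom0pi) _)%E =
     (\int[mu]_(x in dom0pi) ((wder f x - a * derive1 r x) ^+ 2)%:E)%E).
    by rewrite (itg_dom sdh0.2) ltry.
  apply: integral_ae; [exact/measurable_EFinP/measurable_funX|
    exact/measurable_EFinP/measurable_funX|].
  by apply: ae_imp ae => x H xd; rewrite H.
split; first by split.
have bound (k c q : R -> R) : sqint 0 pi k -> sqint 0 pi c -> cc 0 pi q ->
    (forall x, k x = c x + a * q x) ->
    itg 0 pi (fun x => k x ^+ 2) <= 2 * itg 0 pi (fun x => c x ^+ 2) +
      2 * a ^+ 2 * itg 0 pi (fun x => q x ^+ 2).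
  move=> sk sc cq kE; have [_ q2] := sqint_cc cq.
  rewrite -itgZ; last exact: sc.2.
  rewrite -itgZ //.
  rewrite -itgD; [|exact: L1Z sc.2|exact: L1Z].
  apply: le_itg; [exact: sk.2|by apply: L1D; [exact: L1Z sc.2|exact: L1Z]|] => x _.
  rewrite kE; apply: le_trans (sqrD_le _ _) _.
  by rewrite le_eqVlt; apply/orP; left; apply/eqP; ring.
have b1 := bound f h r sf sh cr (fun x => esym (subrK _ _)).
have b2 := bound (wder f) _ (derive1 r) sdf sdh0 cr1 (fun x => esym (subrK _ _)).
by rewrite -E in b2; rewrite !mulrDr addrACA; exact: lerD.
Qed.

End corrected_perturbation.

(** * The constraints satisfied by the corrected perturbations *)
Section constraints.
Context {R : realType}.
Implicit Types t T : R.

Lemma int0piE (f : R -> R) : int0pi f = itg 0 pi f.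
Proof. by []. Qed.

Lemma time_deriv_cst T (k : R -> R) : time_deriv L2 T (fun=> k) (fun=> cst 0).
Proof.
move=> t _; have -> : (fun h : R => L2 (fun x => h^-1 * (k x - k x) - 0)) = (fun=> 0%E).
  apply/funext => h; have -> : (fun x : R => h^-1 * (k x - k x) - 0) = cst 0.
    by apply/funext => x; rewrite subrr mulr0 subrr.
  have c0 : cc 0 pi (cst 0 : R -> R) by exact: cc_cst.
  have := L2_sq (sqint_cc c0); rewrite (_ : itg 0 pi _ = 0); last first.
    rewrite (@eq_itg _ _ _ _ (fun x => 0 * (cst 0 : R -> R) x)).
      by rewrite itgZ ?mul0r //; exact: ccL1.
    by move=> x _; rewrite /= expr2.
  by move=> /eqP; rewrite expe2 mule_eq0 orbb => /eqP.
exact: cvg_cst.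
Qed.

Lemma der_cst_interval T (F : R -> R) c t d : 0 < t < T ->
  (forall s, 0 < s < T -> F s = c) -> der t F d -> d = 0.
Proof.
move=> tT Fc dF; have F0 : der t F 0.
  apply: der_near (der_cst t c); near=> s; rewrite Fc //.
  by have : s \in `]0, T[ by [near: s; apply: near_in_itvoo; rewrite in_itv]; rewrite in_itv.
by rewrite -(@derive_val _ _ _ _ _ _ _ dF) (@derive_val _ _ _ _ _ _ _ F0).
Unshelve. all: by end_near. Qed.

Lemma itg_fixed_deriv T (f f' : R -> R -> R) (k : R -> R) t :
  (forall s, 0 < s < T -> sqint 0 pi (f s)) ->
  (forall s, 0 < s < T -> sqint 0 pi (f' s)) ->
  time_deriv L2 T f f' -> cc 0 pi k -> 0 < t < T ->
  der t (fun s => itg 0 pi (fun x => f s x * k x)) (itg 0 pi (fun x => f' t x * k x)).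
Proof.
move=> sf sf' df ck tT; have sk := sqint_cc ck.
have s0 : sqint 0 pi (cst 0 : R -> R) by apply: sqint_cc; exact: cc_cst.
apply: der_eq (inner_deriv sf sf' (fun _ _ => sk) (fun _ _ => s0) df (@time_deriv_cst T k) tT) _.
rewrite [X in _ + X](@eq_itg _ _ _ _ (fun x => 0 * f t x)).
  by rewrite itgZ ?mul0r ?addr0 //; exact: (sf _ tT).1.
by move=> x _; rewrite /= mulr0 mul0r.
Qed.

Section perturbation.
Variables (r s : R -> R) (T V : R) (xi : nat -> R -> R -> R).
Hypotheses (cr : cc 0 pi r) (cs : cc 0 pi s) (Vr : itg 0 pi (fun x => r x ^+ 2) = V)
           (V0 : 0 < V).
Hypotheses (sq : forall k t, (k < 3)%N -> 0 < t < T -> sqint 0 pi (xi k t)).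
Hypothesis dxi : forall k, (k < 2)%N -> time_deriv L2 T (xi k) (xi k.+1).
Hypothesis mass : forall t, 0 < t < T -> itg 0 pi (fun x => (r x + xi 0%N t x) ^+ 2) = V.
Hypothesis shift0 : forall t, 0 < t < T -> itg 0 pi (fun x => xi 0%N t x * s x) = 0.
Local Notation ip i j t := (itg 0 pi (fun x => xi i t x * xi j t x)).
Local Notation ir i t := (itg 0 pi (fun x => xi i t x * r x)).

(** The choice of the pole, differentiated in time. *)
Lemma shift_constraint k t : (k < 3)%N -> 0 < t < T ->
  itg 0 pi (fun x => xi k t x * s x) = 0.
Proof.
elim: k t => [|k IH] t k3 tT; first exact: shift0.
have k2 : (k < 2)%N by [].
apply: (der_cst_interval tT (fun u uT => IH u (ltnW k3) uT)).
apply: (itg_fixed_deriv (T := T)) => //; [move=> u uT; apply: sq => //; exact: ltnW|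
  by move=> u uT; exact: sq|exact: dxi].
Qed.

Let mass0 t : 0 < t < T -> 2 * ir 0%N t + ip 0%N 0%N t = 0.
Proof.
move=> tT; have sx := sq (isT : 0 < 3)%N tT; have srr := sqint_cc cr.
have := mass tT; rewrite (@eq_itg _ _ _ _ (fun x => r x ^+ 2 + (2 * (xi 0%N t x * r x) + xi 0%N t x * xi 0%N t x)));
  last by move=> x _; ring.
have I1 : L1 0 pi (fun x => 2 * (xi 0%N t x * r x)) by apply: L1Z; exact: sqint_L1M.
have I2 : L1 0 pi (fun x => xi 0%N t x * xi 0%N t x) by exact: sqint_L1M.
rewrite itgD; [|exact: srr.2|exact: L1D].
by rewrite itgD // itgZ ?Vr; [move=> E; lra|exact: sqint_L1M].
Qed.

Let ip_deriv i j t : (i < 2)%N -> (j < 2)%N -> 0 < t < T ->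
  der t (fun t => ip i j t) (ip i.+1 j t + ip i j.+1 t).
Proof.
move=> i2 j2 tT; apply: (inner_deriv (T := T)) => //;
  by [move=> u uT; apply: sq => //; exact: ltnW|move=> u uT; exact: sq|exact: dxi].
Qed.

Let ir_deriv i t : (i < 2)%N -> 0 < t < T -> der t (fun t => ir i t) (ir i.+1 t).
Proof.
move=> i2 tT; apply: (itg_fixed_deriv (T := T)) => //;
  by [move=> u uT; apply: sq => //; exact: ltnW|move=> u uT; exact: sq|exact: dxi].
Qed.

Let ipC i j t : ip i j t = ip j i t.
Proof. by apply: eq_itg => x _; exact: mulrC. Qed.

Let mass1 t : 0 < t < T -> ir 1%N t + ip 0%N 1%N t = 0.
Proof.
move=> tT; have /(der_cst_interval tT mass0) : der t (fun t => 2 * ir 0%N t + ip 0%N 0%N t)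
    (2 * ir 1%N t + (ip 1%N 0%N t + ip 0%N 1%N t)).
  by apply: derD; [apply: derZ; exact: ir_deriv|exact: ip_deriv].
by rewrite (ipC 1 0) => E; lra.
Qed.

Let mass2 t : 0 < t < T -> ir 2%N t + (ip 1%N 1%N t + ip 0%N 2%N t) = 0.
Proof.
move=> tT; apply: (der_cst_interval tT mass1).
by apply: derD; [exact: ir_deriv|exact: ip_deriv].
Qed.

(** By conservation of mass, the quadratic expressions that define a_0, a_1 and
    a_2 are the coefficients of the L2 projections onto the profile. *)
Lemma a_coefE k t : (k < 3)%N -> 0 < t < T -> a_coef r xi k t * V = ir k t.
Proof.
have VN : V != 0 by rewrite gt_eqF.
move=> k3 tT; rewrite /a_coef !int0piE Vr divfK //.
have sqE i : itg 0 pi (fun x => xi i t x ^+ 2) = ip i i t.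
  by apply: eq_itg => x _; rewrite expr2.
case: k k3 => [|[|[|]]] // _; rewrite ?sqE.
- by have := mass0 tT => E; lra.
- by have := mass1 tT => E; lra.
- by have := mass2 tT => E; lra.
Qed.

Lemma corrected_mass k t : (k < 3)%N -> 0 < t < T ->
  itg 0 pi (fun x => r x * corrected r xi k t x) = 0.
Proof.
move=> k3 tT; have sx := sq k3 tT; have srr := sqint_cc cr.
rewrite (@eq_itg _ _ _ _ (fun x => xi k t x * r x - a_coef r xi k t * r x ^+ 2));
  last by move=> x _; rewrite /corrected; ring.
rewrite itgB; [|exact: sqint_L1M|exact: L1Z srr.2].
by rewrite itgZ ?Vr ?a_coefE ?subrr //; exact: srr.2.
Qed.

Lemma corrected_shift k t : itg 0 pi (fun x => r x * s x) = 0 ->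
  (k < 3)%N -> 0 < t < T -> itg 0 pi (fun x => corrected r xi k t x * s x) = 0.
Proof.
move=> rs0 k3 tT; have sx := sq k3 tT.
rewrite (@eq_itg _ _ _ _ (fun x => xi k t x * s x - a_coef r xi k t * (r x * s x)));
  last by move=> x _; rewrite /corrected; ring.
have Irs : L1 0 pi (fun x => r x * s x) by apply: sqint_L1M; exact: sqint_cc.
rewrite itgB; [|by apply: sqint_L1M => //; exact: sqint_cc|exact: L1Z].
by rewrite itgZ // rs0 mulr0 subr0 shift_constraint.
Qed.

Lemma a_coef_sq t : 0 < t < T ->
  let X i := itg 0 pi (fun x => xi i t x ^+ 2) in
  [/\ a_coef r xi 0 t ^+ 2 * (4 * V ^+ 2) = X 0%N ^+ 2,
      a_coef r xi 1 t ^+ 2 * V ^+ 2 <= X 0%N * X 1%N &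
      a_coef r xi 2 t ^+ 2 * V ^+ 2 <= 2 * X 1%N ^+ 2 + 2 * (X 0%N * X 2%N)].
Proof.
move=> tT X.
have sqE i : ip i i t = X i by apply: eq_itg => x _; rewrite expr2.
have CS i j : (i < 3)%N -> (j < 3)%N -> ip i j t ^+ 2 <= X i * X j.
  by move=> i3 j3; apply: cauchy_schwarz; exact: sq.
have e0 := a_coefE (isT : 0 < 3)%N tT; have e1 := a_coefE (isT : 1 < 3)%N tT.
have e2 := a_coefE (isT : 2 < 3)%N tT.
have m0 := mass0 tT; have m1 := mass1 tT; have m2 := mass2 tT.
split.
- rewrite (_ : _ * _ = (2 * (a_coef r xi 0 t * V)) ^+ 2); last by ring.
  by rewrite e0 -sqE (_ : 2 * _ = - ip 0%N 0%N t) ?sqrrN //; lra.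
- by rewrite -exprMn e1 (_ : ir 1%N t = - ip 0%N 1%N t) ?sqrrN ?CS //; lra.
- rewrite -exprMn e2 (_ : ir 2%N t = - (ip 1%N 1%N t + ip 0%N 2%N t)); last by lra.
  rewrite sqrrN sqE; apply: le_trans (sqrD_le _ _) _.
  by rewrite lerD2l ler_pM2l // CS.
Qed.

End perturbation.

End constraints.

(** * Coercivity in terms of the perturbation *)
Section final_arithmetic.
Context {R : realFieldType}.
Implicit Types (C c V S N X Y Z W B a d e : R).

(** N, X and a stand for the squared norms of the corrected perturbation and of
    the perturbation, and for the coefficient of the correction. *)
Lemma absorb_coefficient C S N X B a e : 0 <= C -> C * N <= B ->
  X <= 2 * N + 2 * a ^+ 2 * S -> C * S * a ^+ 2 <= e -> C / 2 * X - e <= B.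
Proof.
move=> C0 CNB XN ae; have h : C * X <= C * (2 * N + 2 * a ^+ 2 * S) by rewrite ler_wpM2l.
suff : C / 2 * X <= C * N + C * S * a ^+ 2 by lra.
rewrite (_ : C * S * a ^+ 2 = C * (a ^+ 2 * S)); last by ring.
rewrite !mulrDr in h.
have -> : C / 2 * X = (C * X) / 2 by ring.
rewrite ler_pdivrMr //; move: h.
rewrite (_ : C * (2 * N) + C * (2 * a ^+ 2 * S) = (C * N + C * (a ^+ 2 * S)) * 2) //; ring.
Qed.

Lemma halve_linear C X Y e : 0 <= C -> Y <= X -> 0 <= e ->
  C / 4 * X - e <= C / 2 * X - C / 4 * Y.
Proof.
move=> C0 YX e0; have : C * Y <= C * X by rewrite ler_wpM2l.
lra.
Qed.

Lemma halve_quadratic C X Y Z W e : 0 <= C -> 0 <= X ->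
  C / 4 * X - e * Y - e * W * Z <= C / 2 * X - e * (Y + Z * W).
Proof.
move=> C0 X0; have : 0 <= C * X by exact: mulr_ge0.
rewrite mulrDr [Z * W]mulrC [e * (W * Z)]mulrA; lra.
Qed.

Lemma lee_finB (h k : \bar R) d1 d2 X Y B : h = X%:E -> k = Y%:E ->
  d1 * X - d2 * Y <= B -> (d1%:E * h - d2%:E * k <= B%:E)%E.
Proof. by move=> -> ->; rewrite -!EFinM -EFinB lee_fin. Qed.

Lemma lee_finBB (h k l m : \bar R) d1 d2 d3 X Y Z W B :
  h = X%:E -> k = Y%:E -> l = Z%:E -> m = W%:E ->
  d1 * X - d2 * Y - d3 * Z * W <= B ->
  (d1%:E * h - d2%:E * k - d3%:E * l * m <= B%:E)%E.
Proof. by move=> -> -> -> ->; rewrite -!EFinM -!EFinB lee_fin. Qed.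

End final_arithmetic.

Theorem theorem5p16 (R : realType) (g sigma V gam : R) (rho0 : R -> R)
    (omega em ep al : R) :
  0 < g -> 0 < sigma -> 0 < V -> `|gam| < sigma ->
  equilibrium g sigma gam V rho0 ->
  0 < omega < pi -> cos omega = gam / sigma ->
  0 < em -> em < ep -> ep <= Num.min 1 (-1 + pi / omega) ->
  0 < al -> al < em ->
  al < Num.min ((1 - ep) / 2) ((ep - em) / 2) -> ep <= (em + 1) / 2 ->
  exists delta c delta1 delta2 delta3 : R,
    [/\ 0 < delta, 0 < c, 0 < delta1, 0 < delta2 & 0 < delta3] /\
    forall (T : R) (u : nat -> R -> R * R -> R * R)
      (p : nat -> R -> R * R -> R) (pole : R -> R) (xi : nat -> R -> R -> R),
    0 < T ->
    (* time derivatives *)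
    (forall k, (k < 2)%N -> time_deriv L2 T (xi k) (xi k.+1)) ->
    (forall k, (k < 2)%N ->
      time_deriv (sob2 (fluid_domain rho0) 0 2) T
        (fun t x => (u k t x).1) (fun t x => (u k.+1 t x).1) /\
      time_deriv (sob2 (fluid_domain rho0) 0 2) T
        (fun t x => (u k t x).2) (fun t x => (u k.+1 t x).2)) ->
    time_deriv (sob2 (fluid_domain rho0) 0 2) T (p 0%N) (p 1%N) ->
    (forall t, 0 < t < T -> derivable pole t 1 /\ derivable (derive1 pole) t 1) ->
    (* conservation of mass and the choice of the pole *)
    (forall t, 0 < t < T -> int0pi (fun x => (rho0 x + xi 0%N t x) ^+ 2) = V) ->
    (forall t, 0 < t < T -> int0pi (fun x => xi 0%N t x * xi_s rho0 x) = 0) ->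
    (forall t, 0 < t < T ->
      (total_energy rho0 em ep al u p pole xi t <= delta%:E)%E) ->
    forall t, 0 < t < T ->
      let b i := bilinear_form g sigma rho0
                   (corrected rho0 xi i t) (corrected rho0 xi i t) in
      [/\ forall i, (i <= 2)%N ->
            bilinear_form g sigma rho0 (corrected rho0 xi i t) (xi_s rho0) = 0
            /\ (c%:E * H1 (corrected rho0 xi i t) ^+ 2 <= (b i)%:E)%E,
          (c%:E * H1 (xi 0%N t) ^+ 2 - L2 (xi 0%N t) ^+ 4 <= (b 0%N)%:E)%E,
          (delta1%:E * H1 (xi 1%N t) ^+ 2 - delta2%:E * L2 (xi 0%N t) ^+ 4
             <= (b 1%N)%:E)%E
        & (delta1%:E * H1 (xi 2%N t) ^+ 2 - delta2%:E * L2 (xi 1%N t) ^+ 4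
             - delta3%:E * L2 (xi 2%N t) ^+ 2 * L2 (xi 0%N t) ^+ 2
             <= (b 2%N)%:E)%E].
Proof.
move=> g0 sig0 V0 gs eqr _ _ _ _ _ _ _ _ _.
have [C C0 coer] := sobolev_coercive g0 sig0 V0 gs eqr.
have [sr [_ _ Vr] _ _] := eqr.
have rs0 := itg_profile_shift sig0 V0 eqr.
have cr : cc 0 pi rho0 by exact: cc_smooth.
have [_ cs] := shift_sobolev sig0 V0 eqr; move/abscont_cc in cs.
pose S := itg 0 pi (fun x => rho0 x ^+ 2) + itg 0 pi (fun x => derive1 rho0 x ^+ 2).
have Sge : V <= S.
  by rewrite /S -[itg 0 pi _]/(int0pi _) Vr lerDl; apply: itg_ge0 => x _; exact: sqr_ge0.
have S0 : 0 < S by exact: lt_le_trans Sge.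
pose C' := Num.min C (4 * V ^+ 2 / S).
have V20 : 0 < V ^+ 2 by exact: exprn_gt0.
have C'0 : 0 < C' by rewrite lt_min C0 divr_gt0 // mulr_gt0.
have C'C : C' <= C by rewrite ge_min lexx.
have C'S : C' * S <= 4 * V ^+ 2 by rewrite -ler_pdivlMr // ge_min lexx orbT.
(* delta lets the contribution of a_1 take at most half of the constant C / 2,
   and C' is so small that the contribution of a_0 carries the constant 1 *)
exists (V ^+ 2 / (4 * S)), (C' / 2), (C / 4), (2 * C * S / V ^+ 2), (2 * C * S / V ^+ 2).
have CSV : 0 < 2 * C * S / V ^+ 2 by rewrite divr_gt0 // !mulr_gt0.
split; first by split => //; rewrite !(divr_gt0, mulr_gt0).
move=> T u p pole xi T0 dxi _ _ _ mass shift0 En t tT b.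
have H1d k s : (k < 3)%N -> 0 < s < T -> (H1 (xi k s) ^+ 2 <= (V ^+ 2 / (4 * S))%:E)%E.
  by move=> k3 sT; apply: le_trans (En s sT); exact: H1_le_energy.
have sob k s : (k < 3)%N -> 0 < s < T -> sobolevH1 (xi k s).
  by move=> k3 sT; exact: H1_sobolev (H1d k s k3 sT).
have sq k s : (k < 3)%N -> 0 < s < T -> sqint 0 pi (xi k s).
  by move=> k3 sT; have [] := sob k s k3 sT.
pose Y (f : R -> R) := itg 0 pi (fun x => f x ^+ 2).
pose W (f : R -> R) := Y f + Y (wder f).
have Y_ge0 f : 0 <= Y f by apply: itg_ge0 => x _; exact: sqr_ge0.
have YW f : Y f <= W f by rewrite lerDl.
have Yd : Y (xi 0%N t) <= V ^+ 2 / (4 * S).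
  apply: le_trans (YW _) _; have := H1d 0%N t isT tT.
  by rewrite H1_sq ?lee_fin //; exact: sob.
have corr k : (k < 3)%N -> [/\ sobolevH1 (corrected rho0 xi k t),
    W (xi k t) <= 2 * W (corrected rho0 xi k t) + 2 * a_coef rho0 xi k t ^+ 2 * S &
    C * W (corrected rho0 xi k t) <= b k].
  move=> k3; have [sc Wc] := sobolev_sub_smooth sr (a_coef rho0 xi k t) (sob k t k3 tT).
  split => //; apply: coer => //.
    exact: (corrected_mass cr Vr V0 sq dxi mass k3 tT).
  exact: (corrected_shift cr cs sq dxi shift0 rs0 k3 tT).
have [a0E a1E a2E] := a_coef_sq cr Vr V0 sq dxi mass tT.
rewrite -!/(Y _) in a0E a1E a2E.
have W_ge0 f : 0 <= W f by exact: le_trans (YW f).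
have C'b k : (k < 3)%N -> C' * W (corrected rho0 xi k t) <= b k.
  by move=> k3; have [_ _] := corr k k3; apply: le_trans; rewrite ler_wpM2r.
split.
- move=> k k2; have [sc _ _] := corr k k2; split; first exact: (shift_in_kernel sig0 V0 eqr sc).
  rewrite H1_sq // -EFinM lee_fin; apply: le_trans (C'b k k2).
  by rewrite ler_wpM2r ?W_ge0 // ler_pdivrMr // ler_peMr ?(ltW C'0) // ler1n.
- have [sc Wc _] := corr 0%N isT.
  rewrite (H1_sq (sob 0%N t isT tT)) (L2_4 (sq 0%N t isT tT)) -EFinM -EFinB lee_fin.
  apply: (absorb_coefficient (ltW C'0) (C'b 0%N isT) Wc).
  apply: le_trans (_ : 4 * V ^+ 2 * a_coef rho0 xi 0 t ^+ 2 <= _).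
    by rewrite ler_wpM2r ?sqr_ge0.
  by rewrite mulrC a0E.
- have [sc Wc Cb] := corr 1%N isT.
  apply: (lee_finB (H1_sq (sob 1%N t isT tT)) (L2_4 (sq 0%N t isT tT))).
  rewrite -/(Y (xi 0%N t)) -/(W (xi 1%N t)).
  have E : C * S * a_coef rho0 xi 1 t ^+ 2 <= C / 4 * Y (xi 1%N t).
    apply: le_trans (_ : C * S / V ^+ 2 * (Y (xi 0%N t) * Y (xi 1%N t)) <= _).
      rewrite -mulrA mulrA -[_ / _ * _]mulrA ler_wpM2l ?mulr_ge0 ?(ltW C0) ?(ltW S0) //.
      by rewrite mulrC ler_pdivlMr.
    rewrite mulrA ler_wpM2r //.
    apply: le_trans (_ : C * S / V ^+ 2 * (V ^+ 2 / (4 * S)) <= _).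
      by apply: ler_wpM2l Yd; rewrite divr_ge0 ?(ltW V20) // mulr_ge0 // ltW.
    rewrite le_eqVlt; apply/orP; left; apply/eqP; field.
    by rewrite !gt_eqF.
  apply: le_trans (absorb_coefficient (ltW C0) Cb Wc E).
  apply: halve_linear (ltW C0) (YW _) _.
  by rewrite mulr_ge0 ?sqr_ge0 // ltW.
- have [sc Wc Cb] := corr 2%N isT.
  apply: (lee_finBB (H1_sq (sob 2%N t isT tT)) (L2_4 (sq 1%N t isT tT))
    (L2_sq (sq 2%N t isT tT)) (L2_sq (sq 0%N t isT tT))).
  rewrite -/(Y (xi 0%N t)) -/(Y (xi 1%N t)) -/(Y (xi 2%N t)) -/(W (xi 2%N t)).
  have E : C * S * a_coef rho0 xi 2 t ^+ 2 <=
      2 * C * S / V ^+ 2 * (Y (xi 1%N t) ^+ 2 + Y (xi 0%N t) * Y (xi 2%N t)).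
    rewrite (_ : 2 * C * S / V ^+ 2 * _ =
       C * S * ((2 * Y (xi 1%N t) ^+ 2 + 2 * (Y (xi 0%N t) * Y (xi 2%N t))) / V ^+ 2)); last by ring.
    by rewrite ler_wpM2l ?mulr_ge0 ?(ltW C0) ?(ltW S0) // ler_pdivlMr.
  apply: le_trans (absorb_coefficient (ltW C0) Cb Wc E).
  exact: halve_quadratic (ltW C0) (W_ge0 _).
Qed.
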